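(* Let $u_*\in\mathcal H^r$, $r\ge2$, be a hyperbolic (hence nondegenerate) equilibrium of $\dot v+Av=F(v)$, and assume the regularity hypothesis on $F$ near $u_*$ stated in the context. For small $\varepsilon>0$ let $u_*^\varepsilon$ be the unique equilibrium of $\dot v^\varepsilon+A_\varepsilon v^\varepsilon=F(v^\varepsilon)$ in a suitable fixed $\mathcal H^2$-neighborhood of $u_*$ (which exists and satisfies $\|u_*^\varepsilon-u_*\|_2\le C_*\varepsilon^{r-1}\|u_*\|_r$). Then $u_*^\varepsilon$ is hyperbolic for all sufficiently small $\varepsilon>0$, and the Morse index satisfies $$m(u_*^\varepsilon)=m(u_* ).$$
   Context: $\mathcal H$ is an infinite-dimensional real Hilbert space and $A:\mathrm D(A)\subset\mathcal H\to\mathcal H$ is a nonnegative self-adjoint operator with compact resolvent. For $r\ge0$, $\mathcal H^r=\mathrm D((I+A)^{r/2})$ with norm $\|u\|_r=\|(I+A)^{r/2}u\|_{\mathcal H}$. Fix $\mu>0$. For $0<\varepsilon\le1$ let $\Lambda_\varepsilon=\mu\varepsilon^{-2}$, $P_\varepsilon=\mathbf 1_{[0,\Lambda_\varepsilon]}(A)$, $Q_\varepsilon=I-P_\varepsilon$, $A_\varepsilon=A+\varepsilon^{-1}Q_\varepsilon$ with $\mathrm D(A_\varepsilon)=\mathrm D(A)=\mathcal H^2$. Regularity hypothesis on the map $F:\mathcal H\to\mathcal H$: on an open bounded neighborhood $\mathcal U\subset\mathcal H^2$ of the equilibrium under consideration, the restriction $F|_{\mathcal U}:\mathcal U\to\mathcal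 H$ is continuously Fréchet differentiable; for each $u\in\mathcal U$ its derivative extends to a bounded operator $DF(u):\mathcal H\to\mathcal H$; and there are constants $C_{\mathcal U},L_{\mathcal U}>0$ with $\sup_{u\in\mathcal U}\|DF(u)\|_{\mathcal L(\mathcal H)}\le C_{\mathcal U}$ and $\|DF(u)-DF(v)\|_{\mathcal L(\mathcal H)}\le L_{\mathcal U}\|u-v\|_2$ for $u,v\in\mathcal U$. An equilibrium $u_*\in\mathcal H^2$ satisfies $Au_*-F(u_* )=0$. It is nondegenerate if $A-DF(u_* ):\mathcal H^2\to\mathcal H$ is an isomorphism, and hyperbolic if, after complexification, $\mathscr L_*=-A+DF(u_* )$ with domain $\mathcal H^2$ satisfies $\sigma(\mathscr L_* )\cap i\mathbb R=\varnothing$. Its Morse index $m(u_* )$ is the (finite) dimension, counting algebraic multiplicities, of the unstable spectral subspace of $\mathscr L_*$ (eigenvalues with positive real part). For an equilibrium $u_*^\varepsilon$ of the renormalized equation (i.e. $A_\varepsilon u_*^\varepsilon=F(u_*^\varepsilon)$), hyperbolicity and $m(u_*^\varepsilon)$ are defined in the same way with $-A_\varepsilon+DF(u_*^\varepsilon)$. *)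

(* Defs.v *)
From HB Require Import structures.
From mathcomp Require Import all_boot all_order all_algebra.
From mathcomp Require Import all_classical all_reals all_analysis.
From mathcomp Require Import complex.

Set Implicit Arguments.
Unset Strict Implicit.
Unset Printing Implicit Defensive.

Import Order.TTheory GRing.Theory Num.Theory.
Import numFieldNormedType.Exports.

Local Open Scope classical_set_scope.
Local Open Scope ring_scope.

HB.mixin Record CompleteNormedModule_isHilbert (R : realType) H
    of CompleteNormedModule R H := {
  inner : H -> H -> R ;
  innerC : forall x y, inner x y = inner y x ;
  innerPl : forall (a : R) x y z,
    inner (a *: x + y) z = a * inner x z + inner y z ;
  inner_norm : forall x, inner x x = `|x| ^+ 2
}.

#[short(type="hilbertType")]
HB.structure Definition Hilbert (R : realType) :=
  { H of CompleteNormedModule_isHilbert R H & CompleteNormedModule R H }.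

Arguments inner {R s} : rename.

Section LinearAlgebra.
Context {K : nzRingType} {V : lmodType K}.

Definition lin_indep n (e : 'I_n -> V) : Prop :=
  forall a : 'I_n -> K, \sum_(i < n) a i *: e i = 0 -> forall i, a i = 0.

Definition lin_span (S : set V) : set V :=
  [set x | exists n (a : 'I_n -> K) (e : 'I_n -> V),
     (forall i, S (e i)) /\ x = \sum_(i < n) a i *: e i].

Definition has_dim (S : set V) (n : nat) : Prop :=
  exists e : 'I_n -> V, lin_indep e /\ lin_span (range e) = S.

Definition infinite_dimensional : Prop := ~ exists n, has_dim [set: V] n.

(* The values of [op_fun] outside [op_dom] carry no meaning. *)
Record partial_op := PartialOp { op_dom : set V ; op_fun :> V -> V }.

Definition linear_op (T : partial_op) : Prop :=
  [/\ op_dom T 0,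
      forall (a : K) x y, op_dom T x -> op_dom T y -> op_dom T (a *: x + y)
    & forall (a : K) x y, op_dom T x -> op_dom T y ->
        T (a *: x + y) = a *: T x + T y].

Definition is_resolvent (T : partial_op) (z : K) (S : V -> V) : Prop :=
  (forall y, op_dom T (S y) /\ T (S y) - z *: S y = y) /\
  (forall x, op_dom T x -> S (T x - z *: x) = x).

(* [pow_kernel T z k] is the kernel of (T - z)^k on its natural domain. *)
Fixpoint pow_kernel (T : partial_op) (z : K) (k : nat) : set V :=
  match k with
  | 0%N => [set 0]
  | k'.+1 => [set x | op_dom T x /\ pow_kernel T z k' (T x - z *: x)]
  end.

Definition generalized_eigenspace (T : partial_op) (z : K) : set V :=
  \bigcup_k pow_kernel T z k.

End LinearAlgebra.

Arguments infinite_dimensional {K} V.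
Arguments partial_op {K} V.

(* The pair (x, y) stands for x + iy. *)
Definition complexification (R : rcfType) (H : lmodType R) : Type :=
  (H * H)%type.

Section Complexification.
Context {R : rcfType} {H : lmodType R}.
Local Notation HC := (complexification H).

HB.instance Definition _ := GRing.Zmodule.copy HC (H * H)%type.

Definition cplx_scale (z : R[i]) (w : HC) : HC :=
  (complex.Re z *: w.1 - complex.Im z *: w.2,
   complex.Re z *: w.2 + complex.Im z *: w.1).

Fact cplx_scaleA a b (w : HC) : cplx_scale a (cplx_scale b w) = cplx_scale (a * b) w.
Proof.
case: a b w => [a a'] [b b'] [x y]; rewrite /cplx_scale /=; congr (_, _).
  rewrite scalerBr scalerDr scalerBl scalerDl !scalerA !opprD.
  by rewrite [X in _ + X = _]addrC addrACA.
rewrite scalerBr scalerDr scalerBl scalerDl !scalerA.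
by rewrite [X in _ + X = _]addrC addrACA.
Qed.

Fact cplx_scale1 : left_id 1 cplx_scale.
Proof. by case=> x y; rewrite /cplx_scale /= !scale0r !scale1r subr0 addr0. Qed.

Fact cplx_scaleDr : right_distributive cplx_scale +%R.
Proof.
case=> a b [x y] [x' y']; rewrite /cplx_scale /=; congr (_, _).
  by rewrite !scalerDr opprD addrACA.
by rewrite !scalerDr addrACA.
Qed.

Fact cplx_scaleDl w : {morph cplx_scale^~ w : a b / a + b}.
Proof.
case: w => x y [a b] [a' b']; rewrite /cplx_scale /=; congr (_, _).
  by rewrite !scalerDl opprD addrACA.
by rewrite !scalerDl addrACA.
Qed.

HB.instance Definition _ := GRing.Zmodule_isLmodule.Build R[i] HC
  cplx_scaleA cplx_scale1 cplx_scaleDr cplx_scaleDl.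

Definition complexify (T : partial_op H) : partial_op HC :=
  @PartialOp _ HC [set w | op_dom T w.1 /\ op_dom T w.2]
    (fun w => (T w.1, T w.2)).

End Complexification.

Section HilbertOperators.
Context {R : realType} {H : hilbertType R}.
Implicit Types (A T : partial_op H) (u v x y : H).

Definition cnorm (w : complexification H) : R :=
  Num.sqrt (`|w.1| ^+ 2 + `|w.2| ^+ 2).

Definition resolvent_set T : set R[i] :=
  [set z | exists S : complexification H -> complexification H,
     is_resolvent (complexify T) z S /\
     exists M : R, forall w, cnorm (S w) <= M * cnorm w].

Definition spectrum T : set R[i] := ~` resolvent_set T.

Definition hyperbolic T : Prop :=
  spectrum T `&` [set z | complex.Re z = 0] = set0.

Definition unstable_subspace T : set (complexification H) :=
  lin_span (\bigcup_(z in [set z : R[i] | 0 < complex.Re z])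
              generalized_eigenspace (complexify T) z).

Definition has_morse_index T (m : nat) : Prop :=
  has_dim (unstable_subspace T) m.

Definition selfadjoint_op A : Prop :=
  [/\ linear_op A, dense (op_dom A)
    & forall y z, (forall x, op_dom A x -> inner (A x) y = inner x z) <->
                  (op_dom A y /\ A y = z)].

Definition nonnegative_op A : Prop :=
  forall x, op_dom A x -> 0 <= inner (A x) x.

Definition compact_resolvent A : Prop :=
  exists (z : R) (S : H -> H),
    is_resolvent A z S /\ precompact (S @` [set x | `|x| <= 1]).

Definition orth_proj (S : set H) (x : H) : H :=
  xget 0 [set y | S y /\ forall z, S z -> inner (x - y) z = 0].

Definition eigenproj A (l : R) : H -> H :=
  orth_proj [set e | op_dom A e /\ A e = l *: e].

(* For A self-adjoint with compact resolvent the spectral measure is carried by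
   the eigenvalues, so f(A) is the diagonal operator acting as f(l) on each
   eigenspace ker (A - l), on its maximal domain; a vector is determined by its
   components in the eigenspaces. *)
Definition fcalc_graph A (f : R -> R) u v : Prop :=
  forall l, eigenproj A l v = f l *: eigenproj A l u.

Definition fcalc A (f : R -> R) : partial_op H :=
  PartialOp [set u | exists v, fcalc_graph A f u v]
            (fun u => xget 0 [set v | fcalc_graph A f u v]).

Definition fracpow A (r : R) : partial_op H :=
  fcalc A (fun l => (1 + l) `^ (r / 2)).

Definition Hsp A (r : R) : set H := op_dom (fracpow A r).

Definition Hnorm A (r : R) u : R := `|fracpow A r u|.

Definition H2_open A (U : set H) : Prop :=
  U `<=` Hsp A 2 /\
  forall u, U u -> exists2 d : R, 0 < d &
    forall v, Hsp A 2 v -> Hnorm A 2 (v - u) < d -> U v.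

Definition H2_bounded A (U : set H) : Prop :=
  exists M : R, forall u, U u -> Hnorm A 2 u <= M.

Definition lowproj A (mu eps : R) : H -> H :=
  fcalc A (\1_(`[0, mu * eps ^- 2]%classic) : R -> R).

Definition renorm_op A (mu eps : R) : partial_op H :=
  PartialOp (op_dom A) (fun u => A u + eps^-1 *: (u - lowproj A mu eps u)).

(* [DF u] is the bounded extension to H of the Frechet derivative at u of
   F : U -> H, where U carries the topology of H^2. *)
Definition regular_on A (F : H -> H) (DF : H -> {linear H -> H}) (U : set H)
    : Prop :=
  [/\ forall u, U u -> forall e : R, 0 < e -> exists2 d : R, 0 < d &
        forall h, Hsp A 2 h -> Hnorm A 2 h < d ->
          `|F (u + h) - F u - DF u h| <= e * Hnorm A 2 h,
      forall u, U u -> forall e : R, 0 < e -> exists2 d : R, 0 < d &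
        forall v, U v -> Hnorm A 2 (v - u) < d ->
          forall h, Hsp A 2 h -> `|DF v h - DF u h| <= e * Hnorm A 2 h,
      exists2 C : R, 0 < C & forall u, U u -> forall h, `|DF u h| <= C * `|h|
    & exists2 L : R, 0 < L & forall u v, U u -> U v ->
        forall h, `|DF u h - DF v h| <= L * Hnorm A 2 (u - v) * `|h| ].

Definition equilibrium T (F : H -> H) u : Prop :=
  op_dom T u /\ T u - F u = 0.

Definition linearization T (B : H -> H) : partial_op H :=
  PartialOp (op_dom T) (fun u => - T u + B u).

Definition nondegenerate_equilibrium A (B : H -> H) : Prop :=
  (forall f, exists2 u, Hsp A 2 u & A u - B u = f) /\
  exists c C : R, [/\ 0 < c, 0 < C &
    forall u, Hsp A 2 u ->
      c * Hnorm A 2 u <= `|A u - B u| <= C * Hnorm A 2 u].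

End HilbertOperators.

(* Main.v *)
Require Import Defs.
From HB Require Import structures.
From mathcomp Require Import all_boot all_order all_algebra.
From mathcomp Require Import all_classical all_reals all_analysis.
From mathcomp Require Import complex ring lra.
Import Normc.
Import Order.TTheory GRing.Theory Num.Theory.
Import numFieldNormedType.Exports.
Local Open Scope classical_set_scope.
Local Open Scope ring_scope.
Set Implicit Arguments.
Unset Strict Implicit.
Unset Printing Implicit Defensive.

(** Since the projection Q_eps only sees eigenvalues above mu eps^-2, the added term
    satisfies |eps^-1 Q_eps u| <= (eps / mu) |(1 + A) u|: it is a small perturbation
    relative to A. The equilibrium u_eps is therefore a fixed point of a contraction,
    and the resolvents of L_eps = - A_eps + DF(u_eps) converge to those of
    L = - A + DF(u_star), uniformly on bounded parts of the closed right half plane;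
    away from a bounded part, A >= 0 gives the resolvent bounds directly.

    For the Morse index, a large circle |z - c| = c avoids both spectra and its disc
    contains exactly the unstable eigenvalues. With K = c (L - c)^-1 the disc becomes
    the exterior of the unit disc, and the complementary Riesz projection is
    D = lim (1 - K^(2^j))^-1. Indeed (1 - z^2 Y^2)^-1 is the mean of (1 - z Y)^-1 and
    (1 + z Y)^-1, so each (1 - z K^(2^j))^-1 is a mean of resolvents over roots of z,
    and its Lipschitz constant in z on the unit circle decays geometrically in j. The
    same means bound |D - D_eps| by the difference of the resolvents on the circle,
    and projections at distance less than 1 have ranges of equal dimension. *)

(** * Hilbert spaces *)

(** Morse indices are defined algebraically, through spans of generalized eigenspaces, so ker D has
    to be recognized as such a span. Finite dimension of ker D makes this possible: a product of
    factors K - k annihilates ker D, and each factor is traded for a factor T - z. For L the finite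
    dimension comes from compactness; for L_eps it is inherited from L through the closeness of D
    and D_eps, so compactness is used for A alone. The circle touches the imaginary axis at 0. On it
    |z|^2 = 2 c Re z, so a point outside a thin strip along the axis has large modulus once c is
    large: hyperbolicity covers the strip, the a priori bound the rest. Powers of A are defined by
    their action on eigenspaces, so statements about them rest on completeness of the eigenvectors,
    proved from compactness of S = (1 + A)^-1. The same S is an isometry of H onto H^2; the
    equilibrium problem is written for g = (1 + A)(u - u_star) and becomes a fixed point problem in
    H itself. *)

Section Subspaces.
Context {K : nzRingType} {V : lmodType K}.
Implicit Types (M : set V) (x y : V).

Definition lin_subspace M := M 0 /\ forall a x y, M x -> M y -> M (a *: x + y).

Lemma subspaceD M x y : lin_subspace M -> M x -> M y -> M (x + y).
Proof. by move=> [_ h] Mx My; rewrite -[x]scale1r; apply: h. Qed.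

Lemma subspaceZ M a x : lin_subspace M -> M x -> M (a *: x).
Proof. by move=> [M0 h] Mx; rewrite -[a *: x]addr0; apply: h. Qed.

Lemma subspaceN M x : lin_subspace M -> M x -> M (- x).
Proof. by move=> sM Mx; rewrite -scaleN1r; apply: subspaceZ. Qed.

Lemma subspaceB M x y : lin_subspace M -> M x -> M y -> M (x - y).
Proof. by move=> sM Mx My; apply: subspaceD => //; apply: subspaceN. Qed.

Lemma subspace_sum M I (s : seq I) (f : I -> V) :
  lin_subspace M -> (forall i, M (f i)) -> M (\sum_(i <- s) f i).
Proof.
move=> sM Mf; elim: s => [|i s IH]; first by rewrite big_nil; case: sM.
by rewrite big_cons; apply: subspaceD.
Qed.

End Subspaces.

Section GeometricLimits.
Context {R : realType}.

Lemma exp_small (C q e : R) : 0 <= q < 1 -> 0 < e ->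
  exists n, C * q ^+ n < e.
Proof.
move=> /andP[q0 q1] e0.
have q1' : `|q| < 1 by rewrite ger0_norm.
have : (fun n => C * q ^+ n) @ \oo --> (0 : R).
  by rewrite -[X in _ --> X](mulr0 C); apply: cvgMr; exact: cvg_expr.
move/cvgrPdist_lt => /(_ _ e0)[n _ /(_ n (leqnn n))] /=.
by rewrite sub0r normrN => /ltr_normlW h; exists n.
Qed.

Lemma geometric_limit (V : completeNormedModType R) (u : nat -> V) (C q : R) :
  0 <= q < 1 -> (forall n, `|u n.+1 - u n| <= C * q ^+ n) ->
  exists l, forall n, `|u n - l| <= C / (1 - q) * q ^+ n.
Proof.
move=> /[dup] q01 /andP[q0 q1] uC.
have q1_gt0 : 0 < 1 - q by rewrite subr_gt0.
have C0 : 0 <= C by have := uC 0%N; rewrite expr0 mulr1 => /(le_trans (normr_ge0 _)).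
have dist n m : `|u n - u (n + m)%N| <= C / (1 - q) * q ^+ n.
  (* The factor 1 - q^m is the exact geometric sum and makes the induction on m close. *)
  have : `|u n - u (n + m)%N| <= C / (1 - q) * q ^+ n * (1 - q ^+ m).
    elim: m => [|m IH]; first by rewrite addn0 subrr normr0 expr0 subrr mulr0.
    rewrite (le_trans (ler_distD (u (n + m)%N) _ _))//.
    have um : `|u (n + m)%N - u (n + m.+1)%N| <= C * q ^+ (n + m).
      by rewrite distrC addnS; exact: uC.
    rewrite (le_trans (lerD IH um))//.
    rewrite [leLHS](_ : _ = C / (1 - q) * q ^+ n * (1 - q ^+ m.+1))//.
    by rewrite exprD exprS; field; lra.
  move=> /le_trans; apply; rewrite ler_piMr//.
    by rewrite mulr_ge0 ?exprn_ge0// divr_ge0// ltW.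
  by rewrite lerBlDr lerDl exprn_ge0.
have : cvg (u @ \oo).
  apply/cauchy_cvgP/cauchy_exP => e e0.
  have [N NE] := exp_small (C / (1 - q)) q01 e0.
  exists (u N); exists N => // n /= Nn.
  by rewrite -ball_normE /= -(subnKC Nn) (le_lt_trans (dist _ _)).
move=> /cvg_ex[l ul]; exists l => n.
apply/ler_addgt0Pr => e e0.
move/cvgrPdist_lt : ul => /(_ _ e0)[N _ /(_ (n + N)%N (leq_addl _ _))] /=.
rewrite distrC => h; rewrite (le_trans (ler_distD (u (n + N)%N) _ _))//.
by rewrite lerD// ltW.
Qed.

End GeometricLimits.

Section HilbertSpace.
Context {R : realType} {H : hilbertType R}.
Implicit Types (x y z : H) (M : set H).

Lemma innerDl x y z : inner (x + y) z = inner x z + inner y z.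
Proof. by rewrite -[x in LHS]scale1r innerPl mul1r. Qed.

Lemma inner0l z : inner (0 : H) z = 0.
Proof. by have := innerDl 0 0 z; rewrite addr0 => h; lra. Qed.

Lemma innerZl a x z : inner (a *: x) z = a * inner x z.
Proof. by rewrite -[a *: x]addr0 innerPl inner0l addr0. Qed.

Lemma innerNl x z : inner (- x) z = - inner x z.
Proof. by rewrite -scaleN1r innerZl mulN1r. Qed.

Lemma innerBl x y z : inner (x - y) z = inner x z - inner y z.
Proof. by rewrite innerDl innerNl. Qed.

Lemma innerDr x y z : inner z (x + y) = inner z x + inner z y.
Proof. by rewrite ![inner z _]innerC innerDl. Qed.

Lemma inner0r z : inner z (0 : H) = 0.
Proof. by rewrite innerC inner0l. Qed.

Lemma innerZr a x z : inner z (a *: x) = a * inner z x.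
Proof. by rewrite ![inner z _]innerC innerZl. Qed.

Lemma innerNr x z : inner z (- x) = - inner z x.
Proof. by rewrite ![inner z _]innerC innerNl. Qed.

Lemma innerBr x y z : inner z (x - y) = inner z x - inner z y.
Proof. by rewrite innerDr innerNr. Qed.

Lemma inner_suml I (s : seq I) (f : I -> H) z :
  inner (\sum_(i <- s) f i) z = \sum_(i <- s) inner (f i) z.
Proof.
by elim: s => [|i s IH]; rewrite ?big_nil ?inner0l// !big_cons innerDl IH.
Qed.

Lemma inner_sumr I (s : seq I) (f : I -> H) z :
  inner z (\sum_(i <- s) f i) = \sum_(i <- s) inner z (f i).
Proof. by rewrite innerC inner_suml; apply: eq_bigr => i _; exact: innerC. Qed.

Lemma sqr_normD x y : `|x + y| ^+ 2 = `|x| ^+ 2 + 2 * inner x y + `|y| ^+ 2.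
Proof.
by rewrite -!inner_norm innerDl !innerDr [inner y x]innerC; ring.
Qed.

Lemma sqr_normB x y : `|x - y| ^+ 2 = `|x| ^+ 2 - 2 * inner x y + `|y| ^+ 2.
Proof. by rewrite sqr_normD innerNr normrN; ring. Qed.

Lemma inner_ge0 x : 0 <= inner x x.
Proof. by rewrite inner_norm exprn_ge0. Qed.

Lemma inner_eq0 x : inner x x = 0 -> x = 0.
Proof. by rewrite inner_norm => /eqP; rewrite sqrf_eq0 normr_eq0 => /eqP. Qed.

Lemma inner_all0 x : (forall y, inner x y = 0) -> x = 0.
Proof. by move=> /(_ x)/inner_eq0. Qed.

Lemma inner_ext x y : (forall z, inner x z = inner y z) -> x = y.
Proof.
move=> h; apply/eqP; rewrite -subr_eq0; apply/eqP/inner_all0 => z.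
by rewrite innerBl h subrr.
Qed.

Lemma cauchy_schwarz x y : `|inner x y| <= `|x| * `|y|.
Proof.
have [->|y0] := eqVneq y 0; first by rewrite inner0r !normr0 mulr0.
have ny0 : 0 < `|y| by rewrite normr_gt0.
have := inner_ge0 (`|y| ^+ 2 *: x - inner x y *: y).
rewrite !innerBl !innerBr !innerZl !innerZr [inner y x]innerC !inner_norm => h.
have y2 : 0 < `|y| ^+ 2 by rewrite exprn_gt0.
rewrite -(@ler_pXn2r _ 2) ?nnegrE ?mulr_ge0// real_normK ?num_real//.
rewrite exprMn -(ler_pM2l y2) -subr_ge0; apply: le_trans h _.
by rewrite le_eqVlt; apply/orP; left; apply/eqP; ring.
Qed.

Lemma inner_le x y : inner x y <= `|x| * `|y|.
Proof. exact: le_trans (ler_norm _) (cauchy_schwarz _ _). Qed.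

Definition norm_closed M :=
  forall x, (forall e : R, 0 < e -> exists2 y, M y & `|y - x| < e) -> M x.

Lemma closed_subspace_projection M x : lin_subspace M -> norm_closed M ->
  exists2 y, M y & forall z, M z -> inner (x - y) z = 0.
Proof.
move=> sM cM; have [M0 _] := sM.
pose D := [set `|x - y| ^+ 2 | y in M].
have D0 : D !=set0 by exists (`|x - 0| ^+ 2), 0.
have Dlb : has_lbound D by exists 0 => _ [y _ <-]; rewrite exprn_ge0.
have Dinf : has_inf D by [].
set d := inf D.
have dle y : M y -> d <= `|x - y| ^+ 2 by move=> My; apply: ge_inf => //; exists y.
have q4 n : 0 < (4^-1 : R) ^+ n by rewrite exprn_gt0// invr_gt0.
(* An excess of 4^-n in the squared distance gives, by the parallelogram identity at the midpoint,
   steps of length at most 2 * 2^-n. *)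
have /choice[u uP] n : exists y, M y /\ `|x - y| ^+ 2 < d + (4^-1) ^+ n.
  by have [_ [y My <-] h] := inf_adherent (q4 n) Dinf; exists y.
have Mu n : M (u n) by have [] := uP n.
have ud n : `|u n.+1 - u n| <= 2 * (2^-1) ^+ n.
  rewrite -(@ler_pXn2r _ 2) ?nnegrE ?mulr_ge0 ?exprn_ge0 ?invr_ge0//.
  have h1 : `|x - u n| ^+ 2 < d + (4^-1) ^+ n by have [] := uP n.
  have h2 : `|x - u n.+1| ^+ 2 < d + (4^-1) ^+ n.+1 by have [] := uP n.+1.
  have h3 : d <= `|x - 2^-1 *: (u n + u n.+1)| ^+ 2.
    by apply: dle; apply: subspaceZ => //; apply: subspaceD.
  have eqx : x - 2^-1 *: (u n + u n.+1) = 2^-1 *: ((x - u n) + (x - u n.+1)).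
    rewrite !scalerDr !scalerN opprD addrACA; congr (_ + _).
    by rewrite -scalerDl [2^-1 + _](_ : _ = 1) ?scale1r//; lra.
  have eqy : u n.+1 - u n = (x - u n) - (x - u n.+1).
    by rewrite opprB [RHS]addrC addrA subrK.
  move: h3 h1 h2; rewrite eqx eqy.
  set a := x - u n; set b := x - u n.+1.
  rewrite normrZ exprMn sqr_normD (sqr_normB a b) => h3 h1 h2.
  have n2 : `|2^-1 : R| ^+ 2 = 4^-1 by rewrite ger0_norm ?invr_ge0//; lra.
  rewrite exprMn -exprM mulnC exprM (_ : 2^-1 ^+ 2 = 4^-1 :> R); last by lra.
  move: h2; rewrite (exprS 4^-1) => h2; rewrite n2 in h3.
  have := q4 n; lra.
have q2 : 0 <= (2^-1 : R) < 1 by lra.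
have [y yP] := geometric_limit q2 ud.
have small e : 0 < e -> exists n, `|u n - y| < e.
  move=> e0; have [n nP] := exp_small (2 / (1 - 2^-1)) q2 e0.
  by exists n; rewrite (le_lt_trans (yP n)).
have My : M y by apply: cM => e /small[n ne]; exists (u n).
have yd z : M z -> `|x - y| <= `|x - z|.
  move=> Mz; apply/ler_addgt0Pr => e e0.
  have sub n : `|x - u n| ^+ 2 <= `|x - z| ^+ 2 + (4^-1) ^+ n.
    have [_ /ltW/le_trans] := uP n; apply.
    by rewrite lerD2r; exact: dle.
  have e2 : 0 < e / 2 by rewrite divr_gt0.
  have [n1 h1] := exp_small (2 / (1 - 2^-1)) q2 e2.
  have e22 : 0 < (e / 2) ^+ 2 by rewrite exprn_gt0.
  have q4' : 0 <= (4^-1 : R) < 1 by lra.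
  have [n2 h2] := exp_small 1 q4' e22.
  pose n := maxn n1 n2.
  have un : `|u n - y| <= e / 2.
    rewrite (le_trans (yP n))// (le_trans _ (ltW h1))// ler_wpM2l//.
      by rewrite divr_ge0//; lra.
    by rewrite ler_wiXn2l ?leq_maxl//; lra.
  have un2 : `|x - u n| <= `|x - z| + e / 2.
    rewrite -(@ler_pXn2r _ 2) ?nnegrE ?addr_ge0 ?(ltW e2)//.
    rewrite (le_trans (sub n))// sqrrD -addrA lerD2l.
    rewrite (le_trans (_ : _ <= (e / 2) ^+ 2))//.
      rewrite (le_trans _ (ltW h2))// mul1r ler_wiXn2l ?leq_maxr//; lra.
    by rewrite lerDr mulrn_wge0// mulr_ge0// ltW.
  rewrite (le_trans (ler_distD (u n) _ _))//; lra.
exists y => // z Mz; apply/eqP; apply: contraT => h0.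
have z0 : z != 0 by apply: contraNneq h0 => ->; rewrite inner0r.
have nz : 0 < `|z| ^+ 2 by rewrite exprn_gt0// normr_gt0.
(* This t minimizes |x - y - t z|; if it were nonzero, y + t z would be strictly closer to x than
   y. *)
pose t := inner (x - y) z / `|z| ^+ 2.
have := yd (y + t *: z) (subspaceD sM My (subspaceZ t sM Mz)).
rewrite -(@ler_pXn2r _ 2) ?nnegrE// opprD addrA (sqr_normB (x - y)) innerZr normrZ exprMn.
rewrite real_normK ?num_real// => h.
have tz : t * `|z| ^+ 2 = inner (x - y) z by rewrite /t divfK// gt_eqF.
have t0 : 0 < t ^+ 2 by rewrite exprn_even_gt0//= mulf_neq0 ?invr_eq0// gt_eqF.
have := mulr_gt0 t0 nz; move: h; rewrite -tz; nra.
Qed.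

Lemma closed_subspace_full M x : lin_subspace M -> norm_closed M ->
  (forall y, (forall z, M z -> inner y z = 0) -> y = 0) -> M x.
Proof.
move=> sM cM orth; have [y My /orth /eqP] := closed_subspace_projection x sM cM.
by rewrite subr_eq0 => /eqP ->.
Qed.

Lemma orth_projP M x : lin_subspace M -> norm_closed M ->
  M (orth_proj M x) /\ forall z, M z -> inner (x - orth_proj M x) z = 0.
Proof.
move=> sM cM; rewrite /orth_proj.
have [y My yP] := closed_subspace_projection x sM cM.
by case: xgetP => [w -> []|/(_ y)] //=; case.
Qed.

End HilbertSpace.

(** * Dimension *)

Section Dimension.
Context {K : fieldType} {V : lmodType K}.
Implicit Types (W : set V) (x y : V).

Lemma lin_span_subspace (S : set V) : lin_subspace (lin_span S).
Proof.
split.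
  exists 0%N, (fun=> 0), (fun=> 0); split; first by case.
  by rewrite big_ord0.
move=> c x y [n [a [e [Se ->]]]] [m [b [f [Sf ->]]]].
pose g i := match fintype.split i with inl j => e j | inr j => f j end.
pose d i := match fintype.split i with inl j => c * a j | inr j => b j end.
exists (n + m)%N, d, g; split.
  by move=> i; rewrite /g; case: fintype.split.
rewrite big_split_ord /= scaler_sumr; congr (_ + _); apply: eq_bigr => i _.
  by rewrite /d /g (unsplitK (inl _ i)) scalerA.
by rewrite /d /g (unsplitK (inr _ i)).
Qed.

Lemma sub_lin_span (S : set V) : S `<=` lin_span S.
Proof.
move=> x Sx; exists 1%N, (fun=> 1), (fun=> x); split=> //.
by rewrite big_ord1 scale1r.
Qed.

Lemma lin_span_min (S W : set V) : lin_subspace W -> S `<=` W -> lin_span S `<=` W.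
Proof.
move=> sW SW _ [n [a [e [Se ->]]]].
by apply: subspace_sum => // i; apply: subspaceZ => //; exact/SW/Se.
Qed.

Definition linear_on (V' : lmodType K) W (f : V -> V') :=
  forall a x y, W x -> W y -> f (a *: x + y) = a *: f x + f y.

Section LinearOn.
Context {V' : lmodType K} {W : set V} {f : V -> V'}.
Hypotheses (sW : lin_subspace W) (lf : linear_on W f).

Lemma linear_on0 : f 0 = 0.
Proof.
have W0 : W 0 by case: sW.
by have /eqP := lf 1 W0 W0; rewrite !scale1r addr0 -subr_eq0 opprD addNKr oppr_eq0 => /eqP.
Qed.

Lemma linear_on_sum n (a : 'I_n -> K) (e : 'I_n -> V) : (forall i, W (e i)) ->
  f (\sum_(i < n) a i *: e i) = \sum_(i < n) a i *: f (e i).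
Proof.
move=> We.
elim: (index_enum _) => [|i s IH]; first by rewrite !big_nil linear_on0.
rewrite !big_cons lf ?IH//.
by apply: subspace_sum => // j; apply: subspaceZ.
Qed.

End LinearOn.

(** A row in the left kernel of the matrix of images is a relation between the [f (e i)];
    injectivity of [f] makes it a relation between the [e i]. *)
Lemma lin_indep_le W n (f : V -> 'rV[K]_n) k (e : 'I_k -> V) :
  lin_subspace W -> linear_on W f -> (forall x, W x -> f x = 0 -> x = 0) ->
  (forall i, W (e i)) -> lin_indep e -> (k <= n)%N.
Proof.
move=> sW lf injf We inde.
pose M := \matrix_(i < k, j < n) f (e i) 0 j.
suff /eqP <- : row_free M by exact: rank_leq_col.
rewrite -kermx_eq0; apply/eqP/row_matrixP => i; rewrite row0.
set v := row i _.
have vM : v *m M = 0 by rewrite /v -row_mul mulmx_ker row0.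
apply/rowP => j; rewrite [RHS]mxE; apply: (inde (fun j => v 0 j)).
apply: injf; first by apply: subspace_sum => // l; apply: subspaceZ.
rewrite (linear_on_sum sW lf)//; apply/rowP => l.
rewrite summxE; move/rowP : vM => /(_ l); rewrite [in RHS]mxE [in LHS]mxE => vM.
by rewrite mxE -[RHS]vM; apply: eq_bigr => j' _; rewrite !mxE.
Qed.

(** Independent families in W have length at most n, so one of maximal length exists, and maximality
    makes it span W. *)
Lemma has_dim_of_injection W n (f : V -> 'rV[K]_n) :
  lin_subspace W -> linear_on W f -> (forall x, W x -> f x = 0 -> x = 0) ->
  exists m, has_dim W m.
Proof.
move=> sW lf injf.
pose P k := `[< exists e : 'I_k -> V, (forall i, W (e i)) /\ lin_indep e >].
have P0 : exists k, P k.
  exists 0%N; apply/asboolP; exists (fun=> 0).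
  by split => [[m lm]|a _ [m lm]].
have Ple k : P k -> (k <= n)%N.
  by move/asboolP => [e [We inde]]; exact: (lin_indep_le sW lf injf We inde).
case: (ex_maxnP P0 Ple) => m /asboolP[e [We inde]] maxm.
exists m, e; split=> //; apply/seteqP; split.
  by apply: lin_span_min => // _ [i _ <-].
move=> x Wx; apply: contrapT => xe.
suff : (m.+1 <= m)%N by rewrite ltnn.
apply: maxm; apply/asboolP.
exists (fun i => if unlift ord0 i is Some j then e j else x); split.
  by move=> i; case: unliftP.
move=> a; rewrite big_ord_recl unlift_none => a0.
have a00 : a ord0 = 0.
  apply: contrapT => /eqP a00; apply: xe.
  have -> : x = - (a ord0)^-1 *: \sum_(i < m) a (lift ord0 i) *: e i.
    have <- : \sum_(i < m) a (lift ord0 i) *: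
        (if unlift ord0 (lift ord0 i) is Some j then e j else x) =
        \sum_(i < m) a (lift ord0 i) *: e i.
      by apply: eq_bigr => i _; rewrite liftK.
    move/eqP: a0; rewrite addrC addr_eq0 => /eqP ->.
    by rewrite scalerN scaleNr opprK scalerA mulVf// scale1r.
  apply: subspaceZ; first exact: lin_span_subspace.
  apply: subspace_sum; first exact: lin_span_subspace.
  move=> i; apply: subspaceZ; first exact: lin_span_subspace.
  by apply: sub_lin_span; exists i.
move=> i; have [j ->|->//] := unliftP ord0 i.
apply: (inde (fun j => a (lift ord0 j))).
rewrite -[RHS]a0 a00 scale0r add0r; apply: eq_bigr => l _.
by rewrite liftK.
Qed.

Lemma has_dim_subspace W m : has_dim W m -> lin_subspace W.
Proof. by move=> [e [_ <-]]; exact: lin_span_subspace. Qed.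

Lemma lin_span_range n (e : 'I_n -> V) x : lin_span (range e) x ->
  exists a : 'I_n -> K, x = \sum_(i < n) a i *: e i.
Proof.
apply: (@lin_span_min _ [set x | exists a : 'I_n -> K, x = \sum_(i < n) a i *: e i]).
  split.
    by exists (fun=> 0); rewrite big1// => i _; rewrite scale0r.
  move=> c _ _ [a ->] [b ->]; exists (fun i => c * a i + b i).
  rewrite scaler_sumr -big_split /=; apply: eq_bigr => i _.
  by rewrite scalerA scalerDl.
move=> _ [i _ <-]; exists (fun j => (j == i)%:R).
by rewrite (bigD1 i)//= eqxx scale1r big1 ?addr0// => j /negbTE ->; rewrite scale0r.
Qed.

Lemma has_dim_coord W m (e : 'I_m -> V) : lin_indep e -> lin_span (range e) = W ->
  exists f : V -> 'rV[K]_m, linear_on W f /\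
    forall x, W x -> x = \sum_(i < m) f x 0 i *: e i.
Proof.
move=> inde eW.
have /choice[f fP] x : exists v : 'rV[K]_m, W x -> x = \sum_(i < m) v 0 i *: e i.
  have [Wx|nWx] := pselect (W x); last by exists 0.
  move: (Wx); rewrite -eW => /lin_span_range[a xa].
  exists (\row_i a i) => _; rewrite [LHS]xa.
  by apply: eq_bigr => i _; rewrite mxE.
exists f; split=> [|x Wx]; last exact: fP.
have sW : lin_subspace W by rewrite -eW; exact: lin_span_subspace.
move=> a x y Wx Wy.
have Wxy : W (a *: x + y) by case: sW => _; apply.
apply/rowP => i; apply/eqP; rewrite -subr_eq0; apply/eqP.
apply: (inde (fun i => f (a *: x + y) 0 i - (a *: f x + f y) 0 i)).
under eq_bigr do rewrite scalerBl !mxE scalerDl -scalerA.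
rewrite sumrB -fP// big_split /= -scaler_sumr -!fP//.
by rewrite subrr.
Qed.

Lemma has_dim_inj_le W W' m m' (g : V -> V) :
  has_dim W m -> has_dim W' m' -> linear_on W' g ->
  (forall x, W' x -> W (g x)) -> (forall x, W' x -> g x = 0 -> x = 0) ->
  (m' <= m)%N.
Proof.
move=> hW hW' lg Wg injg.
have sW' := has_dim_subspace hW'; have sW := has_dim_subspace hW.
have [e [inde eW]] := hW; have [e' [inde' eW']] := hW'.
have [f [lf fP]] := has_dim_coord inde eW.
have W'e i : W' (e' i) by rewrite -eW'; apply: sub_lin_span; exists i.
apply: (@lin_indep_le W' _ (f \o g) _ e') => //=.
  by move=> a x y W'x W'y /=; rewrite lg// lf//; apply: Wg.
move=> x W'x fg0; apply: injg => //; rewrite [LHS]fP; last exact: Wg.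
by rewrite fg0 big1// => i _; rewrite mxE scale0r.
Qed.

End Dimension.

(** Cayley-Hamilton for the matrix of T on W, with the characteristic polynomial split into linear
    factors. The product is written as an iteration because T is a bare function, linear only on
    W. *)
Lemma split_annihilator (K : closedFieldType) (V : lmodType K) (W : set V) m
    (T : V -> V) : has_dim W m -> linear_on W T -> (forall x, W x -> W (T x)) ->
  exists s : seq K, forall x, W x -> foldr (fun k y => T y - k *: y) x s = 0.
Proof.
(* Polynomials are evaluated at matrices of positive size, so dimension 0 is treated apart. *)
case: m => [|m] hW lT TW.
  have [e [_ eW]] := hW; exists [::] => x; rewrite -eW => /lin_span_range[a ->].
  by rewrite big_ord0.
have sW := has_dim_subspace hW.
have [e [inde eW]] := hW.
have We i : W (e i) by rewrite -eW; apply: sub_lin_span; exists i.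
have [f [lf fP]] := has_dim_coord inde eW.
pose M : 'M[K]_m.+1 := \matrix_(i, j) f (T (e i)) 0 j.
have fT x : W x -> f (T x) = f x *m M.
  move=> Wx; rewrite {1}[x]fP//.
  rewrite (linear_on_sum sW lT)// (linear_on_sum sW lf); last by move=> i; exact: TW.
  apply/rowP => j; rewrite summxE mxE; apply: eq_bigr => i _.
  by rewrite !mxE.
have [s sP] := closed_field_poly_normal (char_poly M).
exists s => x Wx.
have fs : W (foldr (fun k y => T y - k *: y) x s) /\
    f (foldr (fun k y => T y - k *: y) x s) =
    f x *m horner_mx M (\prod_(z <- s) ('X - z%:P)).
  elim: (s) => [|z t [Wt IH]] /=.
    by rewrite big_nil rmorph1 mulmx1.
  split; first by apply: subspaceB => //; [exact: TW|exact: subspaceZ].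
  rewrite addrC -scaleNr lf//; last exact: TW.
  rewrite fT// IH big_cons mulrC rmorphM /= rmorphB /= horner_mx_X horner_mx_C.
  rewrite mulmxA mulmxBr addrC scaleNr; congr (_ - _).
  by rewrite mul_mx_scalar.
have [Ws fs0] := fs.
rewrite [LHS]fP// fs0.
have <- : char_poly M = \prod_(z <- s) ('X - z%:P).
  by rewrite [LHS]sP (monicP (char_poly_monic M)) scale1r.
rewrite Cayley_Hamilton mulmx0.
by rewrite big1// => i _; rewrite mxE scale0r.
Qed.

(** * Resolvents on the complexification *)

Import Normc.

Lemma subr_cancel_l (V : zmodType) (w a b : V) : w - a - (w - b) = b - a.
Proof. by rewrite opprB [LHS]addrC addrA subrK. Qed.

Lemma subr_cancel_r (V : zmodType) (a b w : V) : a - w - (b - w) = a - b.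
Proof. by rewrite opprB addrA subrK. Qed.

Section LinearMap.
Context {K : nzRingType} {V V' : lmodType K}.

Definition linear_map (f : V -> V') := forall a x y, f (a *: x + y) = a *: f x + f y.

Context {f : V -> V'}.
Hypothesis lf : linear_map f.

Lemma linear_mapD x y : f (x + y) = f x + f y.
Proof. by rewrite -[x in LHS]scale1r lf scale1r. Qed.

Lemma linear_map0 : f 0 = 0.
Proof. by have /eqP := linear_mapD 0 0; rewrite addr0 -subr_eq0 opprD addNKr oppr_eq0 => /eqP. Qed.

Lemma linear_mapZ a x : f (a *: x) = a *: f x.
Proof. by rewrite -[a *: x]addr0 lf linear_map0 addr0. Qed.

Lemma linear_mapN x : f (- x) = - f x.
Proof. by rewrite -scaleN1r linear_mapZ scaleN1r. Qed.

Lemma linear_mapB x y : f (x - y) = f x - f y.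
Proof. by rewrite linear_mapD linear_mapN. Qed.

End LinearMap.

Lemma iter_linear (K : nzRingType) (V : lmodType K) n (f : V -> V) :
  linear_map f -> linear_map (iter n f).
Proof. by move=> lf; elim: n => [|n IH] a x y //=; rewrite IH lf. Qed.

Section ComplexNorm.
Context {R : realType} {H : hilbertType R}.
Local Notation HC := (complexification H).
Implicit Types (w v : HC) (z : R[i]).

Lemma normc_ge0 z : 0 <= normc z.
Proof. by case: z => a b; rewrite /= sqrtr_ge0. Qed.

Lemma normcX z n : normc (z ^+ n) = normc z ^+ n.
Proof.
by elim: n => [|n IH]; rewrite ?expr0 ?normc1// !exprS normcM IH.
Qed.

Lemma normc_real (a : R) : normc (a%:C)%C = `|a|.
Proof. by rewrite /= expr0n /= addr0 sqrtr_sqr. Qed.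

Lemma normc_sqr z : normc z ^+ 2 = complex.Re z ^+ 2 + complex.Im z ^+ 2.
Proof. by case: z => a b /=; rewrite sqr_sqrtr// addr_ge0// sqr_ge0. Qed.

Lemma cnorm_normc w : cnorm w = normc (Complex `|w.1| `|w.2|).
Proof. by []. Qed.

Lemma cnorm_ge0 w : 0 <= cnorm w.
Proof. exact: sqrtr_ge0. Qed.

Lemma cnorm_sqr w : cnorm w ^+ 2 = `|w.1| ^+ 2 + `|w.2| ^+ 2.
Proof. by rewrite sqr_sqrtr// addr_ge0// exprn_ge0. Qed.

Lemma cnorm0 : cnorm (0 : HC) = 0.
Proof. by rewrite /cnorm /= normr0 expr0n /= addr0 sqrtr0. Qed.

Lemma cnorm_fst w : `|w.1| <= cnorm w.
Proof.
rewrite -(@ler_pXn2r _ 2) ?nnegrE ?cnorm_ge0// cnorm_sqr lerDl exprn_ge0//.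
Qed.

Lemma cnorm_snd w : `|w.2| <= cnorm w.
Proof.
rewrite -(@ler_pXn2r _ 2) ?nnegrE ?cnorm_ge0// cnorm_sqr lerDr exprn_ge0//.
Qed.

Lemma cnorm_le_sum w : cnorm w <= `|w.1| + `|w.2|.
Proof.
rewrite -(@ler_pXn2r _ 2) ?nnegrE ?cnorm_ge0 ?addr_ge0// cnorm_sqr sqrrD.
by rewrite lerD2r lerDl mulrn_wge0// mulr_ge0.
Qed.

Lemma cnorm_eq0 w : cnorm w = 0 -> w = 0.
Proof.
move=> w0; have := cnorm_fst w; have := cnorm_snd w; rewrite w0 !normr_le0.
by case: w {w0} => x y /= /eqP -> /eqP ->.
Qed.

Lemma cnormD w v : cnorm (w + v) <= cnorm w + cnorm v.
Proof.
rewrite [cnorm w]cnorm_normc [cnorm v]cnorm_normc.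
apply: le_trans (le_normcD _ _).
rewrite -(@ler_pXn2r _ 2) ?nnegrE ?cnorm_ge0 ?normc_ge0// cnorm_sqr normc_sqr /=.
by rewrite lerD// ler_pXn2r ?nnegrE ?addr_ge0 ?ler_normD.
Qed.

Lemma cnormZ z w : cnorm (z *: w) = normc z * cnorm w.
Proof.
apply/eqP; rewrite -(@eqrXn2 _ 2)// ?mulr_ge0 ?cnorm_ge0 ?normc_ge0//.
rewrite exprMn !cnorm_sqr normc_sqr; case: z w => [a b] [x y] /=.
rewrite -!inner_norm innerBl !innerBr innerDl !innerDr !innerZl !innerZr.
by apply/eqP; rewrite [inner y x]innerC; ring.
Qed.

Lemma cnormN w : cnorm (- w) = cnorm w.
Proof. by rewrite -scaleN1r cnormZ normcN normc1 mul1r. Qed.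

Lemma cnorm_distC w v : cnorm (w - v) = cnorm (v - w).
Proof. by rewrite -cnormN opprB. Qed.

Lemma cnormB w v : cnorm (w - v) <= cnorm w + cnorm v.
Proof. by rewrite -(cnormN v) cnormD. Qed.

Lemma cnorm_distD u w v : cnorm (w - v) <= cnorm (w - u) + cnorm (u - v).
Proof. by apply: le_trans (cnormD _ _); rewrite addrA subrK. Qed.

Lemma cnorm_geometric_limit (u : nat -> HC) (C q : R) :
  0 <= q < 1 -> (forall n, cnorm (u n.+1 - u n) <= C * q ^+ n) ->
  exists l, forall n, cnorm (u n - l) <= 2 * (C / (1 - q)) * q ^+ n.
Proof.
move=> q01 uC.
have [x xP] : exists l, forall n, `|(u n).1 - l| <= C / (1 - q) * q ^+ n.
  apply: (@geometric_limit _ _ (fun n => (u n).1) C q q01) => n.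
  exact: le_trans (cnorm_fst (u n.+1 - u n)) (uC n).
have [y yP] : exists l, forall n, `|(u n).2 - l| <= C / (1 - q) * q ^+ n.
  apply: (@geometric_limit _ _ (fun n => (u n).2) C q q01) => n.
  exact: le_trans (cnorm_snd (u n.+1 - u n)) (uC n).
exists (x, y) => n; rewrite (le_trans (cnorm_le_sum _))//=.
rewrite (le_trans (lerD (xP n) (yP n)))//.
lra.
Qed.

Lemma cnorm_geometric0 w (C q : R) : 0 <= q < 1 ->
  (forall n, cnorm w <= C * q ^+ n) -> w = 0.
Proof.
move=> q01 wC; apply: cnorm_eq0; apply/eqP; rewrite eq_le cnorm_ge0 andbT.
apply/ler_addgt0Pr => e e0; rewrite add0r.
by have [n /ltW] := exp_small C q01 e0; apply: le_trans.
Qed.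

Definition bounded_by (M : R) (f : HC -> HC) := forall w, cnorm (f w) <= M * cnorm w.

Lemma bounded_byW M M' f : M <= M' -> bounded_by M f -> bounded_by M' f.
Proof.
by move=> MM' fM w; apply: le_trans (fM w) _; rewrite ler_wpM2r// cnorm_ge0.
Qed.

Lemma iter_bounded n M f : 0 <= M -> bounded_by M f -> bounded_by (M ^+ n) (iter n f).
Proof.
move=> M0 fM; elim: n => [|n IH] w /=; first by rewrite expr0 mul1r.
by rewrite (le_trans (fM _))// exprS -mulrA ler_wpM2l.
Qed.

(** The equation x + N x = w is solved by iterating u -> w - N u, which contracts by 1/2;
    injectivity of 1 + N makes the chosen solution G linear and a two-sided inverse. *)
Lemma neumann (N : HC -> HC) (q : R) : q <= 2^-1 -> linear_map N -> bounded_by q N ->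
  exists G : HC -> HC, [/\ linear_map G, forall w, G (w + N w) = w,
    forall w, G w + N (G w) = w & bounded_by 2 G].
Proof.
move=> q2 lN Nq.
have {q2}Nq : bounded_by 2^-1 N by exact: bounded_byW Nq.
have inj x : x + N x = 0 -> x = 0.
  move=> /eqP; rewrite addr_eq0 => /eqP xN; apply: cnorm_eq0.
  by have := Nq x; rewrite -cnormN -xN; have := cnorm_ge0 x; lra.
have /choice[G GP] w : exists x, x + N x = w.
  pose u := fix u n := if n is m.+1 then w - N (u m) else 0.
  have q01 : 0 <= (2^-1 : R) < 1 by lra.
  have uq n : cnorm (u n.+1 - u n) <= cnorm w * 2^-1 ^+ n.
    elim: n => [|n IH]; first by rewrite /= (linear_map0 lN) !subr0 expr0 mulr1.
    have -> : u n.+2 - u n.+1 = N (u n - u n.+1).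
      by rewrite (linear_mapB lN); exact: subr_cancel_l.
    by rewrite (le_trans (Nq _))// exprS mulrCA ler_wpM2l// cnorm_distC.
  have [l lP] := cnorm_geometric_limit q01 uq.
  exists l; apply/eqP; rewrite -subr_eq0; apply/eqP.
  apply: (@cnorm_geometric0 _ (2 * (2 * (cnorm w / (1 - 2^-1)))) _ q01) => n.
  have -> : l + N l - w = (l - u n.+1) + N (l - u n).
    rewrite [u n.+1](_ : _ = w - N (u n))// (linear_mapB lN) opprB.
    by rewrite [RHS]addrACA (addrAC _ (- w)) subrr sub0r.
  rewrite (le_trans (cnormD _ _))// cnorm_distC.
  have h1 := lP n.+1; have h2 := lP n.
  have h3 := Nq (l - u n); rewrite (cnorm_distC l) in h3.
  rewrite exprS mulrCA in h1; rewrite -(mulrA 2 _ (_ ^+ n)).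
  have := le_trans (cnorm_ge0 _) h2.
  set b := 2 * _ * _ in h1 h2 *; lra.
have Ginj w x : x + N x = w -> G w = x.
  move=> xw; apply/eqP; rewrite -subr_eq0; apply/eqP/inj.
  by rewrite (linear_mapB lN) addrACA -opprD GP xw subrr.
exists G; split => //.
- move=> a x y; apply: Ginj.
  by rewrite lN addrACA -scalerDr !GP.
- by move=> w; apply: Ginj.
- move=> w; have := Nq (G w); have := cnormB w (N (G w)).
  rewrite (_ : w - N (G w) = G w); last by rewrite -{1}(GP w) addrK.
  lra.
Qed.

End ComplexNorm.

Lemma linear_op_subspace (K : nzRingType) (V : lmodType K) (T : partial_op V) :
  linear_op T -> lin_subspace (op_dom T).
Proof. by move=> [T0 Tl _]; split. Qed.

Lemma linear_op_on (K : fieldType) (V : lmodType K) (T : partial_op V) :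
  linear_op T -> linear_on (op_dom T) T.
Proof. by move=> [_ _ Tl] a x y; exact: Tl. Qed.

Lemma resolvent_linear (K : fieldType) (V : lmodType K) (T : partial_op V) z S :
  linear_op T -> is_resolvent T z S -> linear_map S.
Proof.
move=> lT [S1 S2] a x y.
have [_ dl Tl] := lT.
have [[dx xE] [dy yE]] := (S1 x, S1 y).
rewrite -[in RHS](S2 (a *: S x + S y)); last exact: dl.
rewrite Tl// -[in LHS]xE -[in LHS]yE; congr S.
rewrite [in RHS]scalerDr opprD scalerBr addrACA.
by rewrite !scalerA mulrC.
Qed.

Section Resolvents.
Context {R : realType} {H : hilbertType R}.
Local Notation HC := (complexification H).
Implicit Types (T : partial_op HC) (z : R[i]) (M : R).

(* (T' - z') Z = 1 + N with N of norm at most 1/2, so (T' - z')^-1 = Z (1 + N)^-1. *)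
Lemma resolvent_perturbation T T' z z' (Z : HC -> HC) M (q : R) :
  linear_op T -> linear_op T' -> op_dom T' = op_dom T -> 0 <= M ->
  is_resolvent T z Z -> bounded_by M Z -> q <= 2^-1 ->
  (forall f, cnorm (T' (Z f) - z' *: Z f - f) <= q * cnorm f) ->
  exists Z', [/\ is_resolvent T' z' Z', bounded_by (2 * M) Z' &
    forall f, cnorm (Z' f - Z f) <= 2 * q * M * cnorm f].
Proof.
move=> lT lT' dT M0 rZ ZM q2 hq.
have lZ := resolvent_linear lT rZ.
have [Z1 Z2] := rZ; have [_ dl Tl] := lT'.
pose N f := T' (Z f) - z' *: Z f - f.
have dZ f : op_dom T' (Z f) by rewrite dT; case: (Z1 f).
have lN : linear_map N.
  move=> a x y; rewrite /N lZ Tl//.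
  by rewrite !scalerDr !scalerN !scalerA (mulrC z' a) !opprD [X in X + _ = _]addrACA [LHS]addrACA.
have [G [lG G1 G2 GM]] := neumann q2 lN hq.
have GN f : G f - f = - N (G f) by rewrite -{2}(G2 f) opprD addNKr.
exists (Z \o G); split.
- split => [y|x dx] /=.
    by split=> //; rewrite -[RHS]G2 /N [RHS]addrC subrK.
  have dx' : op_dom T x by rewrite -dT.
  rewrite -[X in _ = X](Z2 x dx'); congr Z.
  by rewrite -[RHS]G1; congr G; rewrite /N (Z2 x dx') [RHS]addrC subrK.
- move=> w /=; rewrite (le_trans (ZM _))//.
  by rewrite [2 * M]mulrC -mulrA ler_wpM2l.
- move=> f /=; rewrite -(linear_mapB lZ) GN (le_trans (ZM _))// cnormN.
  have qN := hq (G f); rewrite -/(N _) in qN.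
  (* A negative q would bound a norm from above, so then every f has norm 0 and the estimate is
     trivial. *)
  have [q0|q0] := leP 0 q.
    have h : q * cnorm (G f) <= q * (2 * cnorm f) by rewrite ler_wpM2l.
    rewrite (_ : 2 * q * M * _ = M * (q * (2 * cnorm f))); last by ring.
    by rewrite ler_wpM2l// (le_trans qN).
  have N0 : cnorm (N (G f)) = 0.
    apply/eqP; rewrite eq_le cnorm_ge0 andbT (le_trans qN)//.
    by rewrite nmulr_rle0// cnorm_ge0.
  have : cnorm f = 0.
    apply/eqP; rewrite eq_le cnorm_ge0 andbT.
    have := hq f; have := cnorm_ge0 (T' (Z f) - z' *: Z f - f) => a b.
    by have := le_trans a b; rewrite nmulr_rge0.
  by move=> ->; rewrite N0 !mulr0.
Qed.

Definition good T z M := exists2 S, is_resolvent T z S & bounded_by M S.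

Lemma good_nearby T z z' M : linear_op T -> 0 <= M -> good T z M ->
  normc (z' - z) * M <= 2^-1 -> good T z' (2 * M).
Proof.
move=> lT M0 [Z rZ ZM] zz.
have [] := resolvent_perturbation (z' := z') lT lT erefl M0 rZ ZM zz.
  move=> f; have [[_ Zf] _] := (rZ.1 f, tt).
  have -> : T (Z f) - z' *: Z f - f = - ((z' - z) *: Z f).
    by rewrite -[X in _ - X = _]Zf subr_cancel_l -[RHS]scaleNr opprB scalerBl.
  by rewrite cnormN cnormZ -mulrA ler_wpM2l ?normc_ge0.
by move=> Z' [rZ' Z'M _]; exists Z'.
Qed.

(** A lower bound on T - z replaces whatever bound the inverse came with. In the continuation below
    this undoes the doubling caused by each Neumann step. *)
Lemma good_a_priori T z M m : 0 < m -> good T z M ->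
  (forall x, op_dom T x -> m * cnorm x <= cnorm (T x - z *: x)) -> good T z m^-1.
Proof.
move=> m0 [Z [Z1 Z2] _] ap; exists Z => // w.
have [dw wE] := Z1 w.
by rewrite -(ler_pM2l m0) mulVKf ?gt_eqF// (le_trans (ap _ dw))// wE.
Qed.

(* The a priori bound keeps the resolvent norm at most 1, so every step of length
   1/2 along the segment is covered by the Neumann series. *)
Lemma good_continuation T (a d : R[i]) M : linear_op T -> good T a M ->
  (forall t : R, 0 <= t <= 1 -> forall x, op_dom T x ->
     cnorm x <= cnorm (T x - (a + t%:C%C * d) *: x)) ->
  good T (a + d) 1.
Proof.
move=> lT ga ap.
pose n := (Num.truncn (2 * normc d)).+1.
have nd : normc d * n%:R^-1 <= 2^-1.
  rewrite ler_pdivrMr//.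
  have := truncnS_gt (2 * normc d); rewrite -/n; lra.
have n0 : 0 < n%:R :> R by rewrite ltr0n.
have ap' t : 0 <= t <= 1 -> forall x, op_dom T x ->
    1 * cnorm x <= cnorm (T x - (a + t%:C%C * d) *: x).
  by move=> t01 x dx; rewrite mul1r; exact: ap.
suff h k : (k <= n)%N -> good T (a + (k%:R / n%:R)%:C%C * d) 1.
  by have := h n (leqnn n); rewrite divff ?gt_eqF// rmorph1 mul1r.
elim: k => [_|k IH kn].
  rewrite -[X in good _ _ X]invr1; apply: (@good_a_priori _ _ M) => //.
    by rewrite mul0r rmorph0 mul0r addr0.
  by apply: ap'; rewrite mul0r lexx ler01.
(* The Neumann step yields the bound 2, and the a priori estimate brings it back to 1. *)
rewrite -[X in good _ _ X]invr1; apply: (@good_a_priori _ _ (2 * 1)) => //; last first.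
  apply: ap'; apply/andP; split; first by rewrite divr_ge0// ltW.
  by rewrite ler_pdivrMr// mul1r ler_nat.
apply: (good_nearby lT ler01 (IH (ltnW kn))).
rewrite mulr1 opprD addrACA subrr add0r -mulrBl normcM -rmorphB /=.
rewrite expr0n /= addr0 sqrtr_sqr -mulrBl -natrB// subSnn mul1r mulrC.
by rewrite ger0_norm// invr_ge0 ltW.
Qed.

End Resolvents.

(** * Riesz projections by dyadic means *)

Section DyadicProjection.
Context {R : realType} {H : hilbertType R}.
Local Notation HC := (complexification H).
Implicit Types (K S Y D : HC -> HC) (z : R[i]) (w y : HC) (M : R).

Definition pencil_inverse Y z S :=
  (forall w, S (w - z *: Y w) = w) /\ (forall w, S w - z *: Y (S w) = w).

Lemma pencil_inverse_linear Y z S : linear_map Y -> pencil_inverse Y z S ->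
  linear_map S.
Proof.
move=> lY [S1 S2] a x y.
rewrite -[RHS]S1 lY !scalerDr opprD addrACA scalerA mulrC -scalerA -scalerN -scalerDr.
by rewrite !S2.
Qed.

Lemma scaler_half_double w : (2^-1 : R[i]) *: (w + w) = w.
Proof.
rewrite scalerDr -scalerDl (_ : 2^-1 + 2^-1 = 1 :> R[i]) ?scale1r//.
by rewrite [RHS]splitr mul1r.
Qed.

(* (1 - z Y^2)^-1 as the mean of (1 - s Y)^-1 and (1 + s Y)^-1, s^2 = z *)
Lemma pencil_inverse_sqr Y s S S' : linear_map Y ->
  pencil_inverse Y s S -> pencil_inverse Y (- s) S' ->
  pencil_inverse (Y \o Y) (s ^+ 2) (fun w => 2^-1 *: (S w + S' w)).
Proof.
move=> lY iS iS'.
have lS := pencil_inverse_linear lY iS; have lS' := pencil_inverse_linear lY iS'.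
case: iS iS' => S1 S2 [S'1 S'2].
have half (w v : HC) : 2^-1 *: ((w + v) + (w - v)) = w.
  by rewrite addrACA subrr addr0 scaler_half_double.
pose A w := w - s *: Y w; pose B w := w - - s *: Y w.
have AB w : A (B w) = w - s ^+ 2 *: Y (Y w).
  rewrite /A /B !scaleNr !opprK (linear_mapD lY) (linear_mapZ lY) scalerDr scalerA.
  by rewrite opprD addrA addrK expr2.
have BA w : B (A w) = w - s ^+ 2 *: Y (Y w).
  rewrite /A /B !scaleNr !opprK (linear_mapB lY) (linear_mapZ lY) scalerBr scalerA.
  by rewrite addrA subrK expr2.
split=> w /=.
  rewrite -{1}AB S1 -BA S'1 /A /B scaleNr opprK; exact: half.
rewrite !(linear_mapZ lY) scalerA mulrC -scalerA -scalerBr !(linear_mapD lY).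
rewrite (scalerDr (s ^+ 2)) opprD addrACA -BA -AB.
rewrite [A (S w)]S2 [B (S' w)]S'2 /A /B scaleNr opprK; exact: half.
Qed.

Variables (K : HC -> HC) (R0 : R[i] -> HC -> HC) (M : R).

(* With R0 z = (1 - z K)^-1, [dyadic_mean j z] is (1 - z K^(2^j))^-1, the mean of
   R0 over the 2^j-th roots of z. It replaces the contour integral of the Riesz
   projection. *)
Fixpoint dyadic_mean k z w :=
  if k is k'.+1 then
    2^-1 *: (dyadic_mean k' (sqrtc z) w + dyadic_mean k' (- sqrtc z) w)
  else R0 z w.

Lemma sqrtc_unit z : normc z = 1 -> normc (sqrtc z) = 1.
Proof.
move=> z1; have := normcX (sqrtc z) 2; rewrite sqr_sqrtc z1 => /esym/eqP.
by rewrite sqrp_eq1 ?normc_ge0// => /eqP.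
Qed.

Lemma normc_inv2 : normc (2^-1 : R[i]) = 2^-1.
Proof.
rewrite normcV (_ : 2 = (2%:R : R)%:C%C); last by rewrite rmorph_nat.
by rewrite normc_real ger0_norm.
Qed.

Hypotheses (lK : linear_map K)
  (R0P : forall z, normc z = 1 -> pencil_inverse K z (R0 z))
  (R0M : forall z, normc z = 1 -> bounded_by M (R0 z)).

Lemma iter_exp2S j w : iter (2 ^ j.+1) K w = iter (2 ^ j) K (iter (2 ^ j) K w).
Proof. by rewrite -iterD addnn expnS mul2n. Qed.

Lemma dyadic_mean_inverse j z : normc z = 1 ->
  pencil_inverse (iter (2 ^ j) K) z (dyadic_mean j z).
Proof.
elim: j z => [|j IH] z z1; first by rewrite expn0; exact: R0P.
have s1 := sqrtc_unit z1.
have := pencil_inverse_sqr (iter_linear (2 ^ j) lK) (IH _ s1) (IH (- sqrtc z) _).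
rewrite normcN sqr_sqrtc => /(_ s1)[h1 h2]; split=> w.
  by rewrite iter_exp2S; exact: h1.
by rewrite iter_exp2S; exact: h2.
Qed.

Lemma dyadic_mean_linear j z : normc z = 1 -> linear_map (dyadic_mean j z).
Proof.
move=> z1; apply: pencil_inverse_linear (dyadic_mean_inverse j z1).
exact: iter_linear.
Qed.

Lemma cnorm_mean_le w v c : cnorm w <= c -> cnorm v <= c ->
  cnorm (2^-1 *: (w + v)) <= c.
Proof.
move=> wc vc; rewrite cnormZ normc_inv2.
by have := cnormD w v; lra.
Qed.

Lemma dyadic_mean_bounded j z : normc z = 1 -> bounded_by M (dyadic_mean j z).
Proof.
elim: j z => [|j IH] z z1 w; first exact: R0M.
by apply: cnorm_mean_le; apply: IH; rewrite ?normcN sqrtc_unit.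
Qed.

Hypothesis M0 : 0 <= M.
Let L := M * (M + 1).

Lemma L_ge0 : 0 <= L.
Proof. by rewrite mulr_ge0// addr_ge0. Qed.

(** Resolvent identity: R0 z - R0 z' = (z - z') R0 z K R0 z'. Since |z'| = 1, the norm of K R0 z' w
    equals that of R0 z' w - w, whence the factor M + 1 in [L]. *)
Lemma R0_lipschitz z z' w : normc z = 1 -> normc z' = 1 ->
  cnorm (R0 z w - R0 z' w) <= L * normc (z - z') * cnorm w.
Proof.
move=> z1 z'1; have [h1 h2] := R0P z1; have [h1' h2'] := R0P z'1.
have lR := pencil_inverse_linear lK (R0P z1).
set v := R0 z' w.
have wE : w = (v - z *: K v) + (z - z') *: K v.
  by rewrite scalerBl addrA subrK h2'.
have -> : R0 z w - v = (z - z') *: R0 z (K v).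
  by rewrite {1}wE (linear_mapD lR) h1 (linear_mapZ lR) addrC addKr.
have Kv : cnorm (K v) <= (M + 1) * cnorm w.
  rewrite -[cnorm (K v)]mul1r -[X in X * cnorm (K v)]z'1 -cnormZ.
  have -> : z' *: K v = v - w by rewrite -[in RHS](h2' w) -/v subKr.
  by rewrite (le_trans (cnormB _ _))// mulrDl mul1r lerD2r; exact: R0M.
rewrite cnormZ [L * _]mulrC -mulrA ler_wpM2l ?normc_ge0//.
by rewrite (le_trans (R0M z1 _))// /L -mulrA ler_wpM2l.
Qed.

(** The squares of |s - s'| and |s + s'| add up to 4, so the larger of the two is at least sqrt 2 >
    4/3; their product is |s^2 - s'^2|, so the smaller is at most 3/4 of it. *)
Lemma unit_sqrt_dist (s s' : R[i]) : normc s = 1 -> normc s' = 1 ->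
  normc (s - s') <= 3 / 4 * normc (s ^+ 2 - s' ^+ 2) \/
  normc (s + s') <= 3 / 4 * normc (s ^+ 2 - s' ^+ 2).
Proof.
move=> s1 s'1; rewrite subr_sqr normcM.
have : normc (s - s') ^+ 2 + normc (s + s') ^+ 2 = 4.
  have := normc_sqr s; have := normc_sqr s'; rewrite s1 s'1 !normc_sqr.
  by case: s s' {s1 s'1} => [a b] [c d] /= h1 h2; lra.
have := normc_ge0 (s - s'); have := normc_ge0 (s + s').
set p := normc (s - s'); set q := normc (s + s') => q0 p0 pq.
have [q43|q43] := leP (4 / 3) q; first by left; nra.
have p43 : 4 / 3 <= p by rewrite leNgt; apply/negP => p43; nra.
by right; nra.
Qed.

(** A mean is symmetric in the two square roots, so each root of z may be paired with the nearer
    root of z'. Every level then gains the factor 3/4. *)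
Lemma dyadic_mean_lipschitz j z z' w : normc z = 1 -> normc z' = 1 ->
  cnorm (dyadic_mean j z w - dyadic_mean j z' w) <=
  L * (3 / 4) ^+ j * normc (z - z') * cnorm w.
Proof.
elim: j z z' => [|j IH] z z' z1 z'1.
  by rewrite expr0 mulr1; exact: R0_lipschitz.
have s1 := sqrtc_unit z1; have s'1 := sqrtc_unit z'1.
set s := sqrtc z; set s' := sqrtc z'.
have zE : z = s ^+ 2 by rewrite sqr_sqrtc.
have z'E : z' = s' ^+ 2 by rewrite sqr_sqrtc.
have c0 : 0 <= L * (3 / 4) ^+ j by rewrite mulr_ge0 ?L_ge0// exprn_ge0// divr_ge0.
have step t t' : normc t = 1 -> normc t' = 1 ->
    normc (t - t') <= 3 / 4 * normc (s ^+ 2 - s' ^+ 2) ->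
    cnorm (dyadic_mean j t w - dyadic_mean j t' w) <=
    L * (3 / 4) ^+ j.+1 * normc (z - z') * cnorm w.
  move=> t1 t'1 tt'; apply: le_trans (IH _ _ t1 t'1) _.
  rewrite -zE -z'E in tt'; rewrite ler_wpM2r ?cnorm_ge0//.
  have -> : L * (3 / 4) ^+ j.+1 * normc (z - z') =
      L * (3 / 4) ^+ j * (3 / 4 * normc (z - z')) by rewrite exprS; ring.
  exact: ler_wpM2l.
rewrite /= -/s -/s' -scalerBr.
have [h|h] := unit_sqrt_dist s1 s'1.
  rewrite opprD addrACA; apply: cnorm_mean_le; apply: step => //.
  - by rewrite normcN.
  - by rewrite normcN.
  - by rewrite -opprD normcN.
rewrite [dyadic_mean j s' w + _]addrC opprD addrACA.
apply: cnorm_mean_le; apply: step => //; rewrite ?normcN//.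
- by rewrite opprK.
- by rewrite -opprD normcN.
Qed.

End DyadicProjection.

Section DyadicLimit.
Context {R : realType} {H : hilbertType R}.
Local Notation HC := (complexification H).
Implicit Types (D : HC -> HC) (z : R[i]) (w y : HC).

Definition dyadic_limit (R0 : R[i] -> HC -> HC) D := exists2 C : R, 0 <= C &
  forall j w, cnorm (dyadic_mean R0 j 1 w - D w) <= C * (3 / 4) ^+ j * cnorm w.

(* What is used of the compactness of K. *)
Definition finite_codim_small (K : HC -> HC) := forall e : R, 0 < e ->
  exists n, exists2 phi : HC -> 'rV[R[i]]_n, linear_map phi &
    forall x, phi (K x) = 0 -> cnorm (K x) <= e * cnorm x.

Let q01 : 0 <= (3 / 4 : R) < 1.
Proof. lra. Qed.

(** Averaging preserves the bound d at every level, and the limit keeps it. *)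
Lemma dyadic_limit_close R0 R0' D D' (d : R) :
  dyadic_limit R0 D -> dyadic_limit R0' D' ->
  (forall z, normc z = 1 -> forall w, cnorm (R0 z w - R0' z w) <= d * cnorm w) ->
  forall w, cnorm (D w - D' w) <= d * cnorm w.
Proof.
move=> [C C0 DC] [C' C'0 DC'] RR' w.
have mean j z : normc z = 1 ->
    cnorm (dyadic_mean R0 j z w - dyadic_mean R0' j z w) <= d * cnorm w.
  elim: j z => [|j IH] z z1; first exact: RR'.
  rewrite /= -scalerBr opprD addrACA; apply: cnorm_mean_le; apply: IH.
    exact: sqrtc_unit.
  by rewrite normcN sqrtc_unit.
apply/ler_addgt0Pr => e e0.
have [j je] := exp_small ((C + C') * cnorm w) q01 e0.
rewrite (le_trans (cnorm_distD (dyadic_mean R0 j 1 w) _ _))// cnorm_distC.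
have h := cnorm_distD (dyadic_mean R0' j 1 w) (dyadic_mean R0 j 1 w) (D' w).
have h1 := DC j w; have h2 := DC' j w; have h3 := mean j 1 (normc1 R).
lra.
Qed.

Context {K : HC -> HC} {R0 : R[i] -> HC -> HC} {M k : R}.
Hypotheses (lK : linear_map K) (K0 : 0 <= k) (Kk : bounded_by k K)
  (R0P : forall z, normc z = 1 -> pencil_inverse K z (R0 z))
  (M0 : 0 <= M) (R0M : forall z, normc z = 1 -> bounded_by M (R0 z)).

Let normcN1 : normc (-1 : R[i]) = 1.
Proof. by rewrite normcN normc1. Qed.

Lemma dyadic_meanS1 j w : dyadic_mean R0 j.+1 1 w =
  2^-1 *: (dyadic_mean R0 j 1 w + dyadic_mean R0 j (- 1) w).
Proof. by rewrite -[X in _ = _ *: (dyadic_mean _ _ X _ + dyadic_mean _ _ (- X) _)]sqrtc1. Qed.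

(** Consecutive means at 1 differ by half of this difference, which is what makes them converge. *)
Lemma dyadic_mean_pm1 j w :
  cnorm (dyadic_mean R0 j (- 1) w - dyadic_mean R0 j 1 w) <=
  2 * (M * (M + 1)) * cnorm w * (3 / 4) ^+ j.
Proof.
have := dyadic_mean_lipschitz lK R0P R0M M0 j w normcN1 (normc1 R).
rewrite -opprD normcN.
rewrite (_ : 1 + 1 = (2%:R : R)%:C%C); last by rewrite rmorph_nat.
by rewrite normc_real ger0_norm//; lra.
Qed.

Lemma dyadic_limit_exists : exists D, dyadic_limit R0 D.
Proof.
have /choice[D DP] w : exists l, forall j,
    cnorm (dyadic_mean R0 j 1 w - l) <=
    2 * (M * (M + 1) * cnorm w / (1 - 3 / 4)) * (3 / 4) ^+ j.
  apply: (@cnorm_geometric_limit _ _ (fun j => dyadic_mean R0 j 1 w)) => // j.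
  rewrite dyadic_meanS1 -[in X in _ - X](scaler_half_double (dyadic_mean R0 j 1 w)).
  rewrite -scalerBr opprD addrACA subrr add0r cnormZ normc_inv2.
  by have := dyadic_mean_pm1 j w; lra.
exists D; exists (2 * (M * (M + 1) / (1 - 3 / 4))).
  have M1 : 0 <= M * (M + 1) by rewrite mulr_ge0// addr_ge0.
  by rewrite mulr_ge0// divr_ge0//; lra.
by move=> j w; apply: le_trans (DP w j) _; lra.
Qed.

Context {D : HC -> HC} {C : R}.
Hypotheses (C0 : 0 <= C) (DC : forall j w,
  cnorm (dyadic_mean R0 j 1 w - D w) <= C * (3 / 4) ^+ j * cnorm w).

Lemma limit_eq w v (c : R) : (forall j,
  cnorm (dyadic_mean R0 j 1 w - v) <= c * (3 / 4) ^+ j) -> D w = v.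
Proof.
move=> wv; apply/eqP; rewrite -subr_eq0; apply/eqP.
apply: (@cnorm_geometric0 _ _ _ (C * cnorm w + c) _ q01) => j.
rewrite (le_trans (cnorm_distD (dyadic_mean R0 j 1 w) _ _))// cnorm_distC.
by rewrite mulrDl lerD// mulrAC.
Qed.

Lemma limit_linear : linear_map D.
Proof.
move=> a w v; apply: (@limit_eq _ _ (normc a * (C * cnorm w) + C * cnorm v)) => j.
rewrite (dyadic_mean_linear lK R0P j (normc1 R)) opprD addrACA -scalerBr.
rewrite (le_trans (cnormD _ _))// cnormZ.
have := ler_wpM2l (normc_ge0 a) (DC j w); have := DC j v; lra.
Qed.

Lemma limit_commutes w : D (K w) = K (D w).
Proof.
apply: (@limit_eq _ _ (k * (C * cnorm w))) => j.
have [h1 h2] := dyadic_mean_inverse lK R0P j (normc1 R).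
have -> : dyadic_mean R0 j 1 (K w) = K (dyadic_mean R0 j 1 w).
  rewrite -[in LHS](h2 w) (linear_mapB lK) (linear_mapZ lK).
  by rewrite -iterS iterSr h1.
rewrite -(linear_mapB lK) (le_trans (Kk _))// -mulrA ler_wpM2l//.
by rewrite mulrAC.
Qed.

(** With Y = K^(2^j), (1 - Y)^-1 (1 + Y)^-1 = (1 - Y^2)^-1: the means at 1 and at -1 multiply to the
    next mean at 1, and all three tend to D. *)
Lemma limit_idempotent w : D (D w) = D w.
Proof.
have prod j : dyadic_mean R0 j 1 (dyadic_mean R0 j (- 1) w) =
    dyadic_mean R0 j.+1 1 w.
  have [a1 a2] := dyadic_mean_inverse lK R0P j (normc1 R).
  have [b1 b2] := dyadic_mean_inverse lK R0P j normcN1.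
  have [c1 c2] := dyadic_mean_inverse lK R0P j.+1 (normc1 R).
  have lY := iter_linear (2 ^ j) lK.
  rewrite -[LHS]c1; congr (dyadic_mean _ _ _ _).
  set v := dyadic_mean R0 j (- 1) w in b2 *.
  rewrite iter_exp2S -[RHS]b2 scaleN1r opprK -/v -[in RHS](a2 v) !scale1r.
  by rewrite (linear_mapB lY) addrA subrK.
have dN j : cnorm (D w - dyadic_mean R0 j (- 1) w) <=
    (2 * (M * (M + 1)) + C) * cnorm w * (3 / 4) ^+ j.
  rewrite cnorm_distC (le_trans (cnorm_distD (dyadic_mean R0 j 1 w) _ _))//.
  by have := dyadic_mean_pm1 j w; have := DC j w; lra.
apply: (@limit_eq _ _ (M * ((2 * (M * (M + 1)) + C) * cnorm w) + C * cnorm w)) => j.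
rewrite (le_trans (cnorm_distD (dyadic_mean R0 j.+1 1 w) _ _))// mulrDl lerD//.
  rewrite -prod -(linear_mapB (dyadic_mean_linear lK R0P j (normc1 R))).
  rewrite (le_trans (dyadic_mean_bounded R0M j (normc1 R) _))//.
  by rewrite -[leRHS]mulrA ler_wpM2l.
rewrite (le_trans (DC _ _))// mulrAC ler_wpM2l ?mulr_ge0 ?cnorm_ge0//.
by rewrite exprS ler_piMl ?exprn_ge0//; lra.
Qed.

Lemma iter_eigen n kappa y : K y = kappa *: y -> iter n K y = kappa ^+ n *: y.
Proof.
move=> Ky; elim: n => [|n IH] /=; first by rewrite expr0 scale1r.
by rewrite IH (linear_mapZ lK) Ky scalerA exprSr.
Qed.

Lemma mean_eigen j kappa y : K y = kappa *: y ->
  dyadic_mean R0 j 1 y - kappa ^+ (2 ^ j) *: dyadic_mean R0 j 1 y = y.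
Proof.
move=> Ky; have [a1 _] := dyadic_mean_inverse lK R0P j (normc1 R).
have lS := dyadic_mean_linear lK R0P j (normc1 R).
by rewrite -[RHS]a1 (iter_eigen _ Ky) scale1r (linear_mapB lS) (linear_mapZ lS).
Qed.

Lemma exp_exp2_le (t : R) j : 0 <= t -> t <= 1 -> t ^+ (2 ^ j) <= t ^+ j.
Proof. by move=> t0 t1; rewrite ler_wiXn2l// ltnW// ltn_expl. Qed.

(** An eigenvalue near the unit circle gives a rate t slower than 3/4; the larger of the two ratios
    serves. *)
Lemma limit_eq_max w v (c t : R) : 0 <= c -> 0 <= t < 1 -> (forall j,
  cnorm (dyadic_mean R0 j 1 w - v) <= c * t ^+ j) -> D w = v.
Proof.
move=> c0 /andP[t0 t1] wv; apply/eqP; rewrite -subr_eq0; apply/eqP.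
pose q := Num.max t (3 / 4).
have tq : t <= q by rewrite le_max lexx.
have q34 : 3 / 4 <= q by rewrite le_max lexx orbT.
have q0 : 0 <= q := le_trans t0 tq.
have qq : 0 <= q < 1 by rewrite q0/= /q gt_max t1/=; lra.
apply: (@cnorm_geometric0 _ _ _ (C * cnorm w + c) _ qq) => j.
rewrite (le_trans (cnorm_distD (dyadic_mean R0 j 1 w) _ _))// cnorm_distC.
rewrite mulrDl lerD//.
  rewrite (le_trans (DC _ _))// mulrAC ler_wpM2l ?mulr_ge0 ?cnorm_ge0//.
  by rewrite lerXn2r// nnegrE; lra.
by rewrite (le_trans (wv j))// ler_wpM2l// lerXn2r// nnegrE.
Qed.

(** On an eigenvector the mean acts as (1 - kappa^(2^j))^-1, which tends to 1 when |kappa| < 1 and,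
    for the companion lemma, to 0 when |kappa| > 1. *)
Lemma limit_eigen_inside kappa y : K y = kappa *: y -> normc kappa < 1 -> D y = y.
Proof.
move=> Ky k1; have k0 := normc_ge0 kappa.
apply: (@limit_eq_max _ _ (M * cnorm y) (normc kappa)); rewrite ?k0 ?mulr_ge0 ?cnorm_ge0//.
move=> j; rewrite -[X in _ - X](mean_eigen j Ky) subKr cnormZ normcX mulrC.
rewrite ler_pM ?cnorm_ge0 ?exprn_ge0//; first exact: dyadic_mean_bounded (normc1 R) _.
by apply: exp_exp2_le => //; exact: ltW.
Qed.

Lemma limit_eigen_outside kappa y : K y = kappa *: y -> 1 < normc kappa -> D y = 0.
Proof.
move=> Ky k1; have k0 := normc_ge0 kappa.
have kn0 : kappa != 0 by apply/eqP => k00; move: k1; rewrite k00 normc0 ltNge ler01.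
have V01 : 0 <= (normc kappa)^-1 < 1 by rewrite invr_ge0 k0 invf_lt1// (lt_trans ltr01).
apply: (@limit_eq_max _ _ ((M + 1) * cnorm y) (normc kappa)^-1) => //.
  by rewrite mulr_ge0 ?cnorm_ge0// addr_ge0.
move=> j; rewrite subr0; set d := dyadic_mean R0 j 1 y.
have -> : d = (kappa ^+ (2 ^ j))^-1 *: (d - y).
  rewrite -[X in _ *: (_ - X)](mean_eigen j Ky) -/d subKr scalerA mulVf ?scale1r//.
  by rewrite expf_neq0.
rewrite cnormZ normcV normcX -exprVn mulrC.
rewrite ler_pM ?cnorm_ge0 ?exprn_ge0//.
- by case/andP: V01.
- rewrite (le_trans (cnormB _ _))// mulrDl mul1r lerD2r.
  exact: dyadic_mean_bounded (normc1 R) _.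
- by case/andP: V01 => V0 V1; apply: exp_exp2_le => //; exact: ltW.
Qed.

Lemma eigen_unit kappa y : K y = kappa *: y -> normc kappa = 1 -> y = 0.
Proof.
move=> Ky k1; have kn0 : kappa != 0.
  by apply/eqP => k00; move/eqP: k1; rewrite k00 normc0 eq_sym oner_eq0.
have kV : normc kappa^-1 = 1 by rewrite normcV k1 invr1.
have [h _] := R0P kV; rewrite -[LHS]h Ky scalerA mulVf// scale1r subrr.
exact: linear_map0 (pencil_inverse_linear lK (R0P kV)).
Qed.

(** For w in ker D the mean at a large level j is at most |w|/4, and w is this mean minus K (X w).
    If [phi] kills K (X w), that term is at most |w|/4 as well, so w = 0: [phi] after K X is
    injective on ker D. *)
Lemma limit_kernel_finite_dim : finite_codim_small K ->
  exists m, has_dim [set w | D w = 0] m.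
Proof.
move=> cK.
have q4 : 0 < (4^-1 : R) by rewrite invr_gt0.
have [j je] := exp_small C q01 q4.
(* One factor of K^(2^j) is held back, since [phi] controls only vectors of the form K x. *)
have lX : linear_map (fun w => iter (2 ^ j).-1 K (dyadic_mean R0 j 1 w)).
  move=> a x y; rewrite (dyadic_mean_linear lK R0P j (normc1 R)).
  exact: iter_linear.
set X := (fun w => _) in lX.
pose b := k ^+ (2 ^ j).-1 * M.
have b0 : 0 <= b by rewrite mulr_ge0// exprn_ge0.
have Xb : bounded_by b X.
  move=> w; rewrite /X (le_trans (iter_bounded _ K0 Kk _))// /b -mulrA.
  by rewrite ler_wpM2l ?exprn_ge0//; exact: dyadic_mean_bounded (normc1 R) _.
have e0 : 0 < (4 * (b + 1))^-1 by rewrite invr_gt0; lra.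
have [n [phi lphi phiP]] := cK _ e0.
apply: (@has_dim_of_injection _ _ _ n (fun w => phi (K (X w)))).
- split=> [|a x y /= Dx Dy]; first exact: linear_map0 limit_linear.
  by rewrite limit_linear Dx Dy scaler0 addr0.
- by move=> a x y _ _; rewrite lX lK lphi.
move=> w /= Dw /phiP KX.
have KXE : K (X w) = dyadic_mean R0 j 1 w - w.
  rewrite /X -iterS prednK ?expn_gt0//.
  have [_ a2] := dyadic_mean_inverse lK R0P j (normc1 R).
  by rewrite -[X in _ - X](a2 w) scale1r subKr.
apply: cnorm_eq0; apply/eqP; rewrite eq_le cnorm_ge0 andbT.
have dm : cnorm (dyadic_mean R0 j 1 w) <= 4^-1 * cnorm w.
  have := DC j w; rewrite Dw subr0 => /le_trans; apply.
  by rewrite ler_wpM2r ?cnorm_ge0// ltW.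
have KX4 : cnorm (K (X w)) <= 4^-1 * cnorm w.
  rewrite (le_trans KX)// invfM -mulrA ler_wpM2l ?invr_ge0// ler_pdivrMl; last lra.
  rewrite (le_trans (Xb w))// ler_wpM2r ?cnorm_ge0// lerDl//.
have := cnormB (dyadic_mean R0 j 1 w) (dyadic_mean R0 j 1 w - w).
by rewrite subKr -KXE; have := cnorm_ge0 w; lra.
Qed.

End DyadicLimit.

(** * Unstable subspaces *)

Section GeneralizedEigenspaces.
Context {K : fieldType} {V : lmodType K} {T : partial_op V}.
Hypothesis lT : linear_op T.
Implicit Types (z : K) (x y : V).

Let shift_lin a x y z : op_dom T x -> op_dom T y ->
  T (a *: x + y) - z *: (a *: x + y) = a *: (T x - z *: x) + (T y - z *: y).
Proof.
move=> dx dy; have [_ _ Tl] := lT; rewrite Tl// scalerBr scalerDr opprD.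
by rewrite addrACA !scalerA mulrC.
Qed.

Let dom_sub : lin_subspace (op_dom T) := linear_op_subspace lT.

Let T0 : T 0 = 0 := linear_on0 dom_sub (linear_op_on lT).

Lemma pow_kernel_subspace z j : lin_subspace (pow_kernel T z j).
Proof.
elim: j => [|j IH] /=; first by split=> // a x y -> ->; rewrite scaler0 addr0.
have [d0 dl] := dom_sub; split=> [|a x y [dx px] [dy py]] /=.
  by rewrite T0 scaler0 subr0; split=> //; case: IH.
by rewrite shift_lin//; split; [exact: dl|case: IH => _; apply].
Qed.

Lemma pow_kernelS z j x : pow_kernel T z j x -> pow_kernel T z j.+1 x.
Proof.
elim: j x => [|j IH] x /=; last by move=> [dx px]; split=> //; exact: IH.
by move=> ->; rewrite T0 scaler0 subr0; split=> //; case: dom_sub.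
Qed.

Lemma pow_kernel_le z i j x : (i <= j)%N -> pow_kernel T z i x -> pow_kernel T z j x.
Proof.
move=> /subnKC <-; elim: (_ - _)%N => [|k IH]; rewrite ?addn0// addnS.
by move=> /IH/pow_kernelS.
Qed.

Lemma generalized_eigenspace_subspace z : lin_subspace (generalized_eigenspace T z).
Proof.
split=> [|a x y [i _ ix] [j _ jy]]; first by exists 0%N.
exists (maxn i j) => //; have [_] := pow_kernel_subspace z (maxn i j); apply.
  exact: pow_kernel_le (leq_maxl _ _) ix.
exact: pow_kernel_le (leq_maxr _ _) jy.
Qed.

Lemma generalized_eigenspace_dom z x : generalized_eigenspace T z x -> op_dom T x.
Proof. by move=> [j _ /pow_kernelS[]]. Qed.

Lemma generalized_eigenspace_stable z x :
  generalized_eigenspace T z x -> generalized_eigenspace T z (T x).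
Proof.
move=> [j _ jx]; exists j => //; have [dx px] := pow_kernelS jx.
have sp := pow_kernel_subspace z j.
by rewrite -[T x](subrK (z *: x)); apply: subspaceD => //; exact: subspaceZ.
Qed.

(** Induction on the order: if (T - nu) x' = (T - z) y, then (T - nu) (y - x') = (z - nu) y. *)
Lemma generalized_eigenspace_solve z nu y : z != nu -> generalized_eigenspace T z y ->
  exists2 x, generalized_eigenspace T z x & T x - nu *: x = y.
Proof.
move=> znu [j _ jy].
have zn0 : z - nu != 0 by rewrite subr_eq0.
suff [x jx xE] : exists2 x, pow_kernel T z j x & T x - nu *: x = y.
  by exists x => //; exists j.
elim: j y jy => [|j IH] y.
  by move=> /= ->; exists 0 => //; rewrite T0 scaler0 subr0.
move=> jy; have [dy py] := jy; have [x' jx' x'E] := IH _ py.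
have sp := pow_kernel_subspace z j.+1.
have dx' : op_dom T x' by have [] := pow_kernelS jx'.
exists ((z - nu)^-1 *: (- x' + y)).
  by apply: subspaceZ => //; rewrite addrC; apply: subspaceB => //; exact: pow_kernelS.
have lin := shift_lin (z - nu)^-1 (x := - x' + y) (y := 0) nu.
rewrite addr0 T0 scaler0 subr0 addr0 in lin.
have d0 : op_dom T 0 by case: dom_sub.
have dxy : op_dom T (- x' + y) by apply: subspaceD => //; apply: subspaceN.
rewrite lin// -scaleN1r shift_lin// x'E scaleN1r opprB.
by rewrite addrA subrK -scalerBl -[y in RHS]scale1r -(mulVf zn0) -scalerA.
Qed.

End GeneralizedEigenspaces.

Section UnstableSubspace.
Context {R : realType} {H : hilbertType R}.
Local Notation HC := (complexification H).
Context {T : partial_op HC} {c : R} {Z : HC -> HC} {D : HC -> HC} {m : nat}.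
Implicit Types (z : R[i]) (x y : HC).
Local Notation cC := (c%:C%C).
Local Notation K := (fun w => cC *: Z w).

(** With K = c (T - c)^-1, 1 - zeta K = (T - c - c zeta) (T - c)^-1, whose inverse is 1 + c zeta (T
    - c - c zeta)^-1. Unit zeta thus correspond to the circle of centre c and radius c. *)
Lemma pencil_of_resolvents zeta (Z' : HC -> HC) : linear_op T ->
  is_resolvent T cC Z -> is_resolvent T (cC + cC * zeta) Z' ->
  pencil_inverse K zeta (fun w => w + (cC * zeta) *: Z' w).
Proof.
move=> lT rZ rZ'; have lZ := resolvent_linear lT rZ; have lZ' := resolvent_linear lT rZ'.
move: rZ rZ' => [Z1 Z2] [Z'1 Z'2]; split=> w.
  have [dw wE] := Z1 w.
  have -> : zeta *: (cC *: Z w) = (cC * zeta) *: Z w by rewrite scalerA mulrC.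
  have <- : T (Z w) - (cC + cC * zeta) *: Z w = w - (cC * zeta) *: Z w.
    by rewrite scalerDl opprD addrA wE.
  by rewrite Z'2// scalerDl opprD addrA wE subrK.
have [dw wE] := Z'1 w.
have -> v : zeta *: (cC *: Z v) = (cC * zeta) *: Z v by rewrite scalerA mulrC.
have -> : w + (cC * zeta) *: Z' w = T (Z' w) - cC *: Z' w.
  by rewrite -[X in X + _]wE scalerDl opprD addrA subrK.
by rewrite Z2// -[RHS]wE scalerDl opprD addrA.
Qed.

Hypotheses (c0 : 0 < c) (lT : linear_op T) (rZ : is_resolvent T cC Z)
  (lD : linear_map D) (DK : forall w, D (cC *: Z w) = cC *: Z (D w))
  (DD : forall w, D (D w) = D w)
  (Din : forall kappa y, cC *: Z y = kappa *: y -> normc kappa < 1 -> D y = y)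
  (Dout : forall kappa y, cC *: Z y = kappa *: y -> 1 < normc kappa -> D y = 0)
  (Dunit : forall kappa y, cC *: Z y = kappa *: y -> normc kappa = 1 -> y = 0).

Let lZ : linear_map Z := resolvent_linear lT rZ.
Let cC0 : cC != 0.
Proof. by rewrite fmorph_eq0 gt_eqF. Qed.

(** The map z -> c / (z - c) sends the disc |z - c| < c, without its centre, to the exterior of the
    unit disc; the centre is no eigenvalue because Z inverts T - c. *)
Lemma eigen_resolvent z y : op_dom T y -> T y = z *: y -> y = 0 \/
  z != cC /\ cC *: Z y = (cC / (z - cC)) *: y.
Proof.
move=> dy Ty; have [_ Z2] := rZ.
have h : Z ((z - cC) *: y) = y by rewrite -[RHS]Z2// Ty scalerBl.
have [zc|zc] := eqVneq z cC.
  by left; rewrite -h zc subrr scale0r (linear_map0 lZ).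
right; split=> //; rewrite -{2}h (linear_mapZ lZ) scalerA divfK//.
by rewrite subr_eq0.
Qed.

Lemma eigen_disc z y : op_dom T y -> T y = z *: y -> normc (z - cC) < c -> D y = 0.
Proof.
move=> dy Ty zc; have [->|[zc0 Ky]] := eigen_resolvent dy Ty; first exact: linear_map0 lD.
have n0 : 0 < normc (z - cC).
  rewrite lt_def normc_ge0 andbT; apply/eqP => /eq0_normc/eqP.
  by rewrite subr_eq0 (negbTE zc0).
apply: Dout Ky _; rewrite normcM normcV normc_real gtr0_norm//.
by rewrite ltr_pdivlMr// mul1r.
Qed.

Lemma eigen_codisc z y : op_dom T y -> T y = z *: y -> c <= normc (z - cC) ->
  D y = 0 -> y = 0.
Proof.
move=> dy Ty zc Dy; have [//|[zc0 Ky]] := eigen_resolvent dy Ty.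
have n0 : 0 < normc (z - cC) by exact: lt_le_trans zc.
have nE : normc (cC / (z - cC)) = c / normc (z - cC).
  by rewrite normcM normcV normc_real gtr0_norm.
move: zc; rewrite le_eqVlt => /predU1P[zc|zc].
  by apply: (Dunit Ky); rewrite nE -zc divff// gt_eqF.
by rewrite -Dy (Din Ky)// nE ltr_pdivrMr// mul1r.
Qed.

Hypotheses (fdim : has_dim [set w | D w = 0] m)
  (Tunst : forall z y, 0 < complex.Re z -> op_dom T y -> T y = z *: y -> y <> 0 ->
     normc (z - cC) < c).

Let U := lin_span (\bigcup_(z in [set z : R[i] | 0 < complex.Re z])
                    generalized_eigenspace T z).
Let sU : lin_subspace U := lin_span_subspace _.
Let sD : lin_subspace (op_dom T) := linear_op_subspace lT.

Let U_gen z x : 0 < complex.Re z -> generalized_eigenspace T z x -> U x.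
Proof. by move=> z0 zx; apply: sub_lin_span; exists z. Qed.

Let U_dom : U `<=` op_dom T.
Proof. by apply: lin_span_min => // x [z _]; exact: generalized_eigenspace_dom. Qed.

Let T_lin a x y : op_dom T x -> op_dom T y -> T (a *: x + y) = a *: T x + T y.
Proof. by case: lT => _ _; apply. Qed.

Let T0 : T 0 = 0 := linear_on0 sD (linear_op_on lT).

Let TZ a x : op_dom T x -> T (a *: x) = a *: T x.
Proof. by move=> dx; rewrite -[a *: x]addr0 T_lin ?T0 ?addr0//; case: sD. Qed.

Let TB x y : op_dom T x -> op_dom T y -> T (x - y) = T x - T y.
Proof. by move=> dx dy; rewrite [x - y]addrC -[- y]scaleN1r T_lin// scaleN1r addrC. Qed.

Let U_stable x : U x -> U (T x).
Proof.
move=> Ux; suff [] : (op_dom T `&` [set x | U (T x)]) x by [].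
move: x Ux; apply: lin_span_min.
  split; first by split; [case: sD|rewrite /= T0; case: sU].
  move=> a x y [dx Ux] [dy Uy]; split; first by case: sD => _; apply.
  by rewrite /= T_lin//; case: sU => _; apply.
move=> x [z z0 zx]; split; first exact: generalized_eigenspace_dom zx.
by apply: U_gen z0 _; exact: generalized_eigenspace_stable.
Qed.

Let re_disc z : normc (z - cC) < c -> 0 < complex.Re z.
Proof.
rewrite -(@ltr_pXn2r _ 2) ?nnegrE ?normc_ge0 ?ltW// normc_sqr.
case: z => a b /= h; rewrite -(pmulr_rgt0 _ c0).
have := sqr_ge0 a; have := sqr_ge0 (b - 0); nra.
Qed.

(** D commutes with Z, and the range of Z is the domain of T. *)
Lemma D_resolvent_commutes x : op_dom T x ->
  op_dom T (D x) /\ forall z, T (D x) - z *: D x = D (T x - z *: x).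
Proof.
move=> dx; have [Z1 Z2] := rZ.
have DZ w : D (Z w) = Z (D w).
  apply: (scalerI cC0).
  by rewrite -(linear_mapZ lD) DK.
have Dx : D x = Z (D (T x - cC *: x)) by rewrite -DZ Z2.
have [dD DE] := Z1 (D (T x - cC *: x)); rewrite -Dx in dD DE.
split=> // z.
have sh w y : w - z *: y = (w - cC *: y) + (cC - z) *: y.
  by rewrite scalerBl addrA subrK.
by rewrite sh DE [in RHS]sh [RHS](linear_mapD lD) (linear_mapZ lD).
Qed.

(** By induction D kills (T - z) x, so D x is zero or an eigenvector for an unstable z. Such a z
    lies in the disc, hence D kills D x, and D x = D (D x). *)
Lemma D_generalized_eigenspace z x : 0 < complex.Re z ->
  generalized_eigenspace T z x -> D x = 0.
Proof.
move=> z0 [j _]; elim: j x => [|j IH] x /=; first by move=> ->; exact: linear_map0 lD.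
move=> [dx /IH Dy]; have [dDx DxE] := D_resolvent_commutes dx.
have TD : T (D x) = z *: D x by apply/eqP; rewrite -subr_eq0 DxE Dy.
have [//|Dx0] := pselect (D x = 0).
by rewrite -DD; apply: (eigen_disc dDx TD); exact: Tunst TD Dx0.
Qed.

(* On the span of the unstable generalized eigenspaces T - z is invertible modulo
   the generalized eigenspace of z. *)
Lemma U_solve z y : U y -> exists2 x, U x &
  if 0 < complex.Re z then generalized_eigenspace T z (y - (T x - z *: x))
  else y = T x - z *: x.
Proof.
move: y; apply: lin_span_min.
  have d0 : op_dom T 0 by case: sD.
  have sG := generalized_eigenspace_subspace lT z.
  split=> [|a y1 y2 [x1 U1 h1] [x2 U2 h2]].
    exists 0; first by case: sU.
    by rewrite T0 scaler0 !subr0; case: ifP => // _; case: sG.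
  exists (a *: x1 + x2); first by case: sU => _; apply.
  have -> : T (a *: x1 + x2) - z *: (a *: x1 + x2) =
      a *: (T x1 - z *: x1) + (T x2 - z *: x2).
    rewrite T_lin; [|exact: U_dom|exact: U_dom].
    by rewrite scalerBr scalerDr opprD addrACA !scalerA mulrC.
  case: ifP h1 h2 => _ h1 h2; last by rewrite h1 h2.
  by rewrite opprD addrACA -scalerBr; case: sG => _; apply.
move=> y [nu nu0 nuy].
have [<-|nuz] := eqVneq nu z.
  exists 0; first by case: sU.
  by rewrite nu0 T0 scaler0 !subr0.
have [x nux xE] := generalized_eigenspace_solve lT nuz nuy.
exists x; first exact: U_gen nux.
by rewrite xE subrr; case: ifP => // _; case: (generalized_eigenspace_subspace lT z).
Qed.

(** [U_solve] gives x' in U such that (T - z) (x - x') is a generalized eigenvector or 0. In the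
    first case so is x - x'; in the second x - x' is in ker T - z with z outside the disc, and D
    kills it, so it vanishes. *)
Lemma U_of_shift z x : op_dom T x -> D x = 0 -> U (T x - z *: x) -> U x.
Proof.
move=> dx Dx /(U_solve z)[x' Ux' h].
have dx' := U_dom Ux'.
have dxx : op_dom T (x - x') by apply: subspaceB.
have lin : T (x - x') - z *: (x - x') = (T x - z *: x) - (T x' - z *: x').
  by rewrite TB// scalerBr !opprD addrACA.
rewrite -lin in h.
rewrite -[x](subrK x'); apply: subspaceD => //.
case: ifP h => [z0 [j _ jh]|z0 h].
  by apply: (U_gen z0); exists j.+1.
have -> : x - x' = 0; last by case: sU.
have Txx : T (x - x') = z *: (x - x') by apply/eqP; rewrite -subr_eq0 lin h subrr.
apply: (eigen_codisc dxx Txx).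
  by rewrite leNgt; apply/negP => /re_disc; rewrite z0.
rewrite (linear_mapB lD) Dx sub0r; apply/eqP; rewrite oppr_eq0; apply/eqP.
suff : U `<=` [set w | D w = 0] by apply.
apply: lin_span_min; last by move=> w [nu nu0 nuw]; exact: D_generalized_eigenspace nuw.
split=> [|a w v Dw Dv]; first exact: linear_map0 lD.
by rewrite /= lD Dw Dv scaler0 addr0.
Qed.

(** K preserves the finite-dimensional space ker D, so a product of factors K - k annihilates it.
    Starting from 0, membership in U is pulled back through one factor at a time. *)
Lemma kernel_eq_unstable : U = [set w | D w = 0].
Proof.
apply/seteqP; split.
  apply: lin_span_min; last by move=> w [nu nu0 nuw]; exact: D_generalized_eigenspace nuw.
  split=> [|a w v Dw Dv]; first exact: linear_map0 lD.
  by rewrite /= lD Dw Dv scaler0 addr0.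
have lK : linear_map (fun w => cC *: Z w).
  by move=> a x y; rewrite lZ scalerDr !scalerA mulrC.
have KW w : D w = 0 -> D (cC *: Z w) = 0.
  by move=> Dw; rewrite DK Dw (linear_map0 lZ) scaler0.
have [s sP] := split_annihilator (T := fun w => cC *: Z w) fdim
  (fun a x y _ _ => lK a x y) KW.
move=> x /= Dx; move: (sP x Dx).
suff h t : D (foldr (fun k y => cC *: Z y - k *: y) x t) = 0 /\
    (U (foldr (fun k y => cC *: Z y - k *: y) x t) -> U x).
  by move=> s0; apply: (h s).2; rewrite s0; case: sU.
have [Z1 Z2] := rZ.
elim: t => [|k t [Dt Ut]] //=.
set y := foldr _ _ _ in Dt Ut *.
split.
  by rewrite (linear_mapB lD) (linear_mapZ lD k) Dt scaler0 subr0 KW.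
move=> Uy; apply: Ut.
have [dZ ZE] := Z1 y.
have ZcE : T (cC *: Z y) - cC *: (cC *: Z y) = cC *: y.
  by rewrite TZ// -scalerBr ZE.
(* The factor K itself is undone by T - c, which preserves U. *)
have [k0|k0] := eqVneq k 0.
  rewrite k0 scale0r subr0 in Uy.
  have -> : y = cC^-1 *: (T (cC *: Z y) - cC *: (cC *: Z y)).
    by rewrite ZcE scalerA mulVf// scale1r.
  apply: subspaceZ => //; apply: subspaceB => //; first exact: U_stable.
  exact: subspaceZ.
have dK : op_dom T (cC *: Z y) by apply: subspaceZ.
set v := cC *: Z y - k *: y in Uy.
have kyE : k *: y = cC *: Z y - v by rewrite /v subKr.
have dky : op_dom T (k *: y) by rewrite kyE; apply: subspaceB => //; exact: U_dom.
have yE : y = k^-1 *: (k *: y) by rewrite scalerA mulVf// scale1r.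
have dy : op_dom T y by rewrite yE; apply: subspaceZ.
(* c + c/k is the point that z -> c / (z - c) sends to k: (T - c) (K y - k y) = - k (T - c - c/k)
   y. *)
apply: (@U_of_shift (cC + cC / k)) => //.
have -> : T y - (cC + cC / k) *: y = - k^-1 *: (T v - cC *: v).
  have vE : T v - cC *: v = cC *: y - (k *: T y - cC *: (k *: y)).
    by rewrite /v TB// (TZ _ dy) scalerBr !opprD addrACA ZcE.
  rewrite vE scaleNr scalerBr opprB scalerDr !scalerN !scalerA mulVf// scale1r.
  by rewrite scalerDl opprD addrA (mulrC k^-1) divfK.
apply: subspaceZ => //; apply: subspaceB => //; first exact: U_stable.
exact: subspaceZ.
Qed.

End UnstableSubspace.

(** * Comparison of unstable dimensions *)

Section UnstableDimension.
Context {R : realType} {H : hilbertType R}.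
Local Notation HC := (complexification H).
Implicit Types (T : partial_op HC) (c M d : R) (D : HC -> HC).

Definition unstable_span T := lin_span
  (\bigcup_(z in [set z : R[i] | 0 < complex.Re z]) generalized_eigenspace T z).

Definition resolvents_on_circle T c M (Z : HC -> HC) (Zc : R[i] -> HC -> HC) :=
  [/\ is_resolvent T c%:C%C Z, bounded_by M Z &
   forall z, normc z = 1 ->
     is_resolvent T (c%:C%C + c%:C%C * z) (Zc z) /\ bounded_by M (Zc z)].

Definition unstable_in_disc T c := forall z y,
  0 < complex.Re z -> op_dom T y -> T y = z *: y -> y <> 0 -> normc (z - c%:C%C) < c.

Let family c (Zc : R[i] -> HC -> HC) z w := w + (c%:C%C * z) *: Zc z w.

(** Finite dimension of ker D is a premise of the last clause because it has two sources:
    compactness for the reference operator, closeness of the projections for the perturbed one. *)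
Lemma circle_projection T c M Z Zc : linear_op T -> 0 < c -> 0 <= M ->
  resolvents_on_circle T c M Z Zc -> unstable_in_disc T c ->
  exists D, [/\ dyadic_limit (family c Zc) D, linear_map D,
    forall w, D (D w) = D w,
    finite_codim_small (fun w => c%:C%C *: Z w) -> exists m, has_dim [set w | D w = 0] m &
    forall m, has_dim [set w | D w = 0] m -> unstable_span T = [set w | D w = 0]].
Proof.
move=> lT c0 M0 [rZ ZM hZc] uT.
have nc : normc c%:C%C = c by rewrite normc_real gtr0_norm.
pose K w := c%:C%C *: Z w.
have lZ := resolvent_linear lT rZ.
have lK : linear_map K by move=> a x y; rewrite /K lZ scalerDr !scalerA mulrC.
have R0P z : normc z = 1 -> pencil_inverse K z (family c Zc z).
  by move=> /hZc[rz _]; exact: (pencil_of_resolvents lT rZ rz).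
have R0M z : normc z = 1 -> bounded_by (1 + c * M) (family c Zc z).
  move=> z1 w; have [_ zM] := hZc z z1.
  rewrite /family (le_trans (cnormD _ _))// mulrDl mul1r lerD2l.
  by rewrite cnormZ normcM nc z1 mulr1 -mulrA ler_wpM2l// ltW.
have M1 : 0 <= 1 + c * M by rewrite addr_ge0// mulr_ge0// ltW.
have kM : 0 <= c * M by rewrite mulr_ge0// ltW.
have Kk : bounded_by (c * M) K.
  by move=> w; rewrite /K cnormZ nc -mulrA ler_wpM2l// ltW.
have [D dD] := dyadic_limit_exists lK R0P M1 R0M.
have [C C0 DC] := dD.
have lD := limit_linear lK R0P DC.
have DK := limit_commutes lK kM Kk R0P DC.
have DD := limit_idempotent lK R0P M1 R0M C0 DC.
exists D; split=> //.
  exact: (limit_kernel_finite_dim lK kM Kk R0P M1 R0M DC).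
move=> m fD; apply: (kernel_eq_unstable c0 lT rZ lD DK DD _ _ _ fD uT).
- by move=> kappa y; exact: (limit_eigen_inside lK R0P M1 R0M C0 DC).
- by move=> kappa y; exact: (limit_eigen_outside lK R0P M1 R0M C0 DC).
- by move=> kappa y; exact: (eigen_unit lK R0P).
Qed.

Lemma unstable_finite_dim T c M Z Zc : linear_op T -> 0 < c -> 0 <= M ->
  resolvents_on_circle T c M Z Zc -> unstable_in_disc T c ->
  finite_codim_small (fun w => c%:C%C *: Z w) ->
  exists m, has_dim (unstable_span T) m.
Proof.
move=> lT c0 M0 hT uT cT.
have [D [_ _ _ /(_ cT)[m fD] /(_ m fD) ->]] := circle_projection lT c0 M0 hT uT.
by exists m.
Qed.

(* The complementary projections D and D' differ by less than 1 in norm, so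
   1 - D is injective on ker D' and conversely. *)
Lemma unstable_dim_stable T T' c M Z Zc Z' Zc' m d :
  linear_op T -> linear_op T' -> 0 < c -> 0 <= M ->
  resolvents_on_circle T c M Z Zc -> resolvents_on_circle T' c M Z' Zc' ->
  unstable_in_disc T c -> unstable_in_disc T' c ->
  finite_codim_small (fun w => c%:C%C *: Z w) ->
  c * d < 1 ->
  (forall z, normc z = 1 -> forall w, cnorm (Zc z w - Zc' z w) <= d * cnorm w) ->
  has_dim (unstable_span T) m -> has_dim (unstable_span T') m.
Proof.
move=> lT lT' c0 M0 hT hT' uT uT' cT cd ZZ hm.
have [D [dD lD DD /(_ cT)[m1 fD] /(_ m1 fD) kD]] := circle_projection lT c0 M0 hT uT.
have [D' [dD' lD' DD' _ kD']] := circle_projection lT' c0 M0 hT' uT'.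
have close w : cnorm (D w - D' w) <= c * d * cnorm w.
  apply: (dyadic_limit_close dD dD') => z z1 v.
  rewrite /family opprD addrACA subrr add0r -scalerBr cnormZ normcM z1 mulr1.
  by rewrite normc_real gtr0_norm// -mulrA ler_wpM2l ?ZZ// ltW.
have zero w : cnorm w <= c * d * cnorm w -> w = 0.
  by move=> h; apply: cnorm_eq0; have := cnorm_ge0 w; nra.
have lg (E : HC -> HC) (W : set HC) : linear_map E -> linear_on W (fun w => w - E w).
  by move=> lE a x y _ _; rewrite lE opprD addrACA scalerBr.
have inj w : D' w = 0 -> w - D w = 0 -> w = 0.
  move=> D'w /eqP; rewrite subr_eq0 => /eqP wD; apply: zero.
  by have := close w; rewrite D'w subr0 -wD.
have inj' w : D w = 0 -> w - D' w = 0 -> w = 0.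
  move=> Dw /eqP; rewrite subr_eq0 => /eqP wD; apply: zero.
  by have := close w; rewrite Dw sub0r cnormN -wD.
rewrite kD in hm.
have s' : lin_subspace [set w | D' w = 0].
  split=> [|a x y Dx Dy]; first exact: linear_map0 lD'.
  by rewrite /= lD' Dx Dy scaler0 addr0.
(* The coordinates of w - D w in ker D embed ker D' into an m-dimensional space. *)
have [m' fD'] : exists m', has_dim [set w | D' w = 0] m'.
  have [e [inde eW]] := hm; have [f [lf fP]] := has_dim_coord inde eW.
  have Dg w : [set w | D w = 0] (w - D w) by rewrite /= (linear_mapB lD) DD subrr.
  apply: (@has_dim_of_injection _ _ _ m (fun w => f (w - D w))) => //.
    by move=> a x y D'x D'y; rewrite (lg D [set w | D' w = 0])//; apply: lf.
  move=> w D'w fw; apply: inj => //; rewrite [LHS]fP//.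
  by rewrite fw big1// => i _; rewrite mxE scale0r.
rewrite (kD' m' fD').
suff -> : m = m' by [].
apply/eqP; rewrite eqn_leq; apply/andP; split.
- apply: (has_dim_inj_le fD' hm (lg D' _ lD')) => w Dw //=.
    by rewrite (linear_mapB lD') DD' subrr.
  exact: inj'.
- apply: (has_dim_inj_le hm fD' (lg D _ lD)) => w Dw //=.
    by rewrite (linear_mapB lD) DD subrr.
  exact: inj.
Qed.

End UnstableDimension.

(** * Self-adjoint operators with compact resolvent *)

Section SelfAdjoint.
Context {R : realType} {H : hilbertType R} {A : partial_op H}.
Implicit Types (x y u v e : H).
Hypotheses (sA : selfadjoint_op A) (pA : nonnegative_op A).

Lemma eq0_of_small (a : R) (C : R) : 0 <= C ->
  (forall d : R, 0 < d -> `|a| <= C * d) -> a = 0.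
Proof.
move=> C0 h; apply/eqP; rewrite -normr_eq0 eq_le normr_ge0 andbT.
apply/ler_addgt0Pr => d d0; rewrite add0r.
have C1 : 0 < C + 1 by lra.
have := h (d / (C + 1)) (divr_gt0 d0 C1) => /le_trans; apply.
rewrite mulrCA; apply: ler_piMr; first exact: ltW.
by rewrite ler_pdivrMr//; lra.
Qed.

Lemma selfadjoint_linear : linear_op A. Proof. by case: sA. Qed.

Let lA := selfadjoint_linear.
Let sdA : lin_subspace (op_dom A) := linear_op_subspace lA.
Let AD x y : op_dom A x -> op_dom A y -> A (x + y) = A x + A y.
Proof. by move=> dx dy; case: lA => _ _ h; rewrite -[x in LHS]scale1r h// scale1r. Qed.
Let A0 : A 0 = 0 := linear_on0 sdA (linear_op_on lA).
Let AZ a x : op_dom A x -> A (a *: x) = a *: A x.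
Proof. by move=> dx; case: lA => d0 _ h; rewrite -[a *: x]addr0 h// A0 addr0. Qed.
Let AB x y : op_dom A x -> op_dom A y -> A (x - y) = A x - A y.
Proof.
by move=> dx dy; rewrite AD//; [rewrite -[- y]scaleN1r AZ// scaleN1r|exact: subspaceN].
Qed.

Lemma selfadjoint_sym x y : op_dom A x -> op_dom A y -> inner (A x) y = inner x (A y).
Proof. by case: sA => _ _ h dx dy; apply: (h y (A y)).2. Qed.

(** A is its own adjoint, so membership in its graph is tested by pairings with A w and w, and these
    pass to the limit. *)
Lemma selfadjoint_closed x y :
  (forall d : R, 0 < d -> exists u, [/\ op_dom A u, `|u - x| <= d & `|A u - y| <= d]) ->
  op_dom A x /\ A x = y.
Proof.
move=> h; case: sA => _ _ sa; apply/sa => w dw; apply/eqP; rewrite -subr_eq0.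
apply/eqP; apply: (@eq0_of_small _ (`|A w| + `|w|)); first by rewrite addr_ge0.
move=> d /h[u [du ux uy]].
have -> : inner (A w) x - inner w y = inner w (A u - y) - inner (A w) (u - x).
  by rewrite !innerBr -selfadjoint_sym//; ring.
rewrite (le_trans (ler_normB _ _))// mulrDl addrC lerD//.
  by rewrite (le_trans (cauchy_schwarz _ _))// ler_wpM2l.
by rewrite (le_trans (cauchy_schwarz _ _))// ler_wpM2l.
Qed.

Lemma norm_le_shift x : op_dom A x -> `|x| <= `|x + A x|.
Proof.
move=> dx; rewrite -(@ler_pXn2r _ 2) ?nnegrE// sqr_normD innerC -addrA lerDl.
by rewrite addr_ge0 ?exprn_ge0// mulr_ge0// pA.
Qed.

Lemma norm_op_le_shift x : op_dom A x -> `|A x| <= `|x + A x|.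
Proof.
move=> dx; rewrite -(@ler_pXn2r _ 2) ?nnegrE// sqr_normD innerC lerDr.
by rewrite addr_ge0 ?exprn_ge0// mulr_ge0// pA.
Qed.

(** The range of 1 + A is closed, by |x| <= |x + A x| and the closed graph. A vector z orthogonal to
    it satisfies A z = - z, which nonnegativity forbids unless z = 0. *)
Lemma shift_surjective y : exists2 x, op_dom A x & x + A x = y.
Proof.
pose M := [set y | exists2 x, op_dom A x & x + A x = y].
suff : M y by [].
apply: closed_subspace_full.
- split=> [|a _ _ [x dx <-] [x' dx' <-]].
    by exists 0; [case: sdA|rewrite A0 addr0].
  exists (a *: x + x'); first by case: sdA => _; apply.
  by rewrite AD ?AZ//; [rewrite scalerDr addrACA|exact: subspaceZ].
- move=> z zM.
  have /choice[u uP] n : exists x, op_dom A x /\ `|x + A x - z| < 2^-1 ^+ n.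
    have q0 : 0 < (2^-1 : R) ^+ n by rewrite exprn_gt0.
    by have [_ [x dx <-] xz] := zM _ q0; exists x.
  have du n : op_dom A (u n) by case: (uP n).
  have q2 : 0 <= (2^-1 : R) < 1 by lra.
  have ud n : `|u n.+1 - u n| <= 2 * 2^-1 ^+ n.
    rewrite (le_trans (norm_le_shift _))//; first exact: subspaceB.
    rewrite AB// addrACA -opprD (le_trans (ler_distD z _ _))//.
    have [_ /ltW h1] := uP n.+1; have [_ /ltW h2] := uP n.
    rewrite exprS in h1; rewrite distrC in h2.
    have : 0 < (2^-1 : R) ^+ n by rewrite exprn_gt0.
    lra.
  have [x xP] := geometric_limit q2 ud.
  suff [dx Ax] : op_dom A x /\ A x = z - x by exists x => //; rewrite Ax addrC subrK.
  apply: selfadjoint_closed => d d0.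
  have [n nd] := exp_small (1 + 2 / (1 - 2^-1)) q2 d0.
  rewrite mulrDl mul1r in nd.
  have h1 := xP n; have [_ /ltW h2] := uP n.
  have p0 : 0 < (2^-1 : R) ^+ n by rewrite exprn_gt0.
  exists (u n); split=> //; first by rewrite (le_trans h1)// (le_trans _ (ltW nd))// lerDr ltW.
  have -> : A (u n) - (z - x) = (u n + A (u n) - z) - (u n - x).
    (* Pairing with an arbitrary w turns a vector identity into one that [ring] settles. *)
    by apply: inner_ext => w; rewrite !(innerDl, innerNl); ring.
  by rewrite (le_trans (ler_normB _ _))// (le_trans (lerD h2 h1))// ltW.
- move=> z zM.
  have [dz Az] : op_dom A z /\ A z = - z.
    case: sA => _ _ sa; apply/sa => x dx; rewrite innerNr.
    have := zM (x + A x) (ex_intro2 _ _ x dx erefl).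
    by rewrite innerC innerDl => h; lra.
  by have := pA dz; rewrite Az innerNl => h; apply: inner_eq0; have := inner_ge0 z; lra.
Qed.

Definition shift_inverse (S : H -> H) :=
  (forall y, op_dom A (S y) /\ S y + A (S y) = y) /\
  (forall x, op_dom A x -> S (x + A x) = x).

Lemma shift_inverse_exists : exists S, shift_inverse S.
Proof.
have /choice[S SP] y : exists x, op_dom A x /\ x + A x = y.
  by have [x dx xy] := shift_surjective y; exists x.
exists S; split=> // x dx; have [dS SE] := SP (x + A x).
have dSx : op_dom A (S (x + A x) - x) by exact: subspaceB.
apply/eqP; rewrite -subr_eq0 -normr_le0 (le_trans (norm_le_shift dSx))//.
by rewrite AB// addrACA -opprD SE subrr normr0.
Qed.

Context {S : H -> H}.
Hypothesis iS : shift_inverse S.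

Lemma shift_inverse_linear : linear_map S.
Proof.
have [S1 S2] := iS => a x y.
have [[dx xE] [dy yE]] := (S1 x, S1 y).
have daxy : op_dom A (a *: S x + S y) by case: sdA => _; apply.
rewrite -[RHS]S2//; congr S; rewrite AD ?AZ//; last exact: subspaceZ.
by rewrite addrACA -scalerDr xE yE.
Qed.

Lemma shift_inverse_bounded y : `|S y| <= `|y|.
Proof. by have [/(_ y)[dy yE] _] := iS; rewrite -{2}yE; exact: norm_le_shift. Qed.

Lemma shift_inverse_sym x y : inner (S x) y = inner x (S y).
Proof.
have [S1 S2] := iS; have [[dx xE] [dy yE]] := (S1 x, S1 y).
by rewrite -{1}yE -{2}xE innerDr innerDl selfadjoint_sym.
Qed.

Lemma shift_inverse_pos x : `|S x| ^+ 2 <= inner (S x) x.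
Proof.
have [/(_ x)[dx xE] _] := iS.
by rewrite -[x in inner _ x]xE innerDr inner_norm lerDl innerC; exact: pA.
Qed.

Lemma shift_inverse_inj x : S x = 0 -> x = 0.
Proof. by have [/(_ x)[dx xE] _] := iS => Sx; rewrite -xE Sx A0 addr0. Qed.

Definition eigenspaceA (l : R) := [set e | op_dom A e /\ A e = l *: e].

Lemma eigenspaceA_subspace l : lin_subspace (eigenspaceA l).
Proof.
split=> [|a x y [dx Ax] [dy Ay]]; first by split; [case: sdA|rewrite A0 scaler0].
split; first by case: sdA => _; apply.
by rewrite AD ?AZ//; [rewrite Ax Ay scalerDr !scalerA mulrC|exact: subspaceZ].
Qed.

Lemma eigenspaceA_closed l : norm_closed (eigenspaceA l).
Proof.
move=> x hx; apply: selfadjoint_closed => d d0.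
have l0 : 0 < `|l| + 1 by rewrite ltr_wpDl.
have d1 : 0 < d / (`|l| + 1) by rewrite divr_gt0.
have [y [dy Ay] yx] := hx _ d1; exists y; split=> //.
  apply: le_trans (ltW yx) _; rewrite ler_pdivrMr//.
  by have := normr_ge0 l; nra.
rewrite Ay -scalerBr normrZ (le_trans (ler_wpM2l _ (ltW yx)))//.
rewrite mulrCA; apply: ler_piMr; first exact: ltW.
by rewrite ler_pdivrMr//; lra.
Qed.

Lemma eigenspaceA_ge0 l e : eigenspaceA l e -> e != 0 -> 0 <= l.
Proof.
move=> [de Ae] e0; have := pA de; rewrite Ae innerZl inner_norm pmulr_lge0//.
by rewrite exprn_gt0// normr_gt0.
Qed.

Lemma eigenspaceA_orth l l' e e' : l != l' -> eigenspaceA l e -> eigenspaceA l' e' ->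
  inner e e' = 0.
Proof.
move=> ll' [de Ae] [de' Ae']; have := selfadjoint_sym de de'.
rewrite Ae Ae' innerZl innerZr => /eqP; rewrite -subr_eq0 -mulrBl mulf_eq0.
by rewrite subr_eq0 (negbTE ll') => /eqP.
Qed.

Lemma inner_shift_eigen l x e : op_dom A x -> eigenspaceA l e ->
  inner (x + A x) e = (1 + l) * inner x e.
Proof.
move=> dx [de Ae]; rewrite innerDl selfadjoint_sym// Ae innerZr; ring.
Qed.

Lemma shift_inverse_eigen p (l : R) : l != 0 -> S p = l *: p ->
  eigenspaceA (l^-1 - 1) p.
Proof.
move=> l0 Sp; have [/(_ p)[dS SE] _] := iS.
have pE : p = l^-1 *: S p by rewrite Sp scalerA mulVf// scale1r.
have dp : op_dom A p by rewrite pE; apply: subspaceZ.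
split=> //; rewrite scalerBl scale1r.
have -> : A p = l^-1 *: A (S p) by rewrite {1}pE AZ.
by rewrite -[X in _ = _ *: X - _]SE scalerDr -pE addrAC subrr add0r.
Qed.

End SelfAdjoint.

(** * Compactness and completeness of the eigenvectors *)

Section CompactResolvent.
Context {R : realType} {H : hilbertType R} {A : partial_op H} {S : H -> H}.
Implicit Types (x y u v e : H).
Hypotheses (sA : selfadjoint_op A) (pA : nonnegative_op A)
  (cA : compact_resolvent A) (iS : shift_inverse (A := A) S).

Let lS : linear_map S := shift_inverse_linear sA iS.

(** Since S y = S0 (y - (1 + z) S y), compactness of the resolvent at an arbitrary z passes to -1.
    The scaling by k t brings the argument of S0 into the unit ball. *)
Lemma shift_inverse_compact : exists E : set H, compact E /\
  exists2 k : R, 0 < k & forall y t, 0 < t -> `|y| <= t -> E ((k * t)^-1 *: S y).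
Proof.
have [z [S0 [rS0 cS0]]] := cA.
have lS0 := resolvent_linear (selfadjoint_linear sA) rS0.
have [_ S02] := rS0; have [S1 S2] := iS.
exists (closure (S0 @` [set x | `|x| <= 1])); split; first by rewrite -precompactE.
have k0 : 0 < 1 + `|1 + z| by rewrite ltr_wpDr.
exists (1 + `|1 + z|) => // y t t0 yt; apply: subset_closure.
have [dS SE] := S1 y.
have yb : `|y - (1 + z) *: S y| <= (1 + `|1 + z|) * t.
  rewrite (le_trans (ler_normB _ _))// mulrDl mul1r lerD// normrZ ler_wpM2l//.
  exact: le_trans (shift_inverse_bounded pA iS y) yt.
move: (1 + `|1 + z|) k0 yb => k k0 yb.
exists ((k * t)^-1 *: (y - (1 + z) *: S y)) => /=.
  have kt : 0 < k * t by rewrite mulr_gt0.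
  by rewrite normrZ gtr0_norm ?invr_gt0// ler_pdivrMl// mulr1.
rewrite (linear_mapZ lS0); congr (_ *: _); rewrite -[RHS](S02 _ dS); congr S0.
by rewrite -{1}SE scalerDl scale1r opprD addrA [S y + _]addrC addrK.
Qed.

(** The compact set is covered by finitely many balls of radius d/k. A point g in the ball of centre
    c and orthogonal to c satisfies |g|^2 = <g, g - c> <= |g| d/k. *)
Lemma shift_inverse_finite_codim (d : R) : 0 < d -> exists s : seq H,
  forall y, (forall c, c \in s -> inner (S y) c = 0) -> `|S y| <= d * `|y|.
Proof.
move=> d0; have [E [cE [k k0 hE]]] := shift_inverse_compact.
have dk : 0 < d / k by rewrite divr_gt0.
move: cE; rewrite compact_cover => /(_ H setT (fun c => ball c (d / k))) [].
- by move=> c _; exact: ball_open.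
- by move=> x _; exists x => //; exact: ballxx.
move=> D' _ cover; exists (finmap.enum_fset D') => y hy.
have [y0|y0] := eqVneq y 0; first by rewrite y0 (linear_map0 lS) !normr0 mulr0.
have ny : 0 < `|y| by rewrite normr_gt0.
have [c /= cD'] := cover _ (hE y _ ny (lexx _)).
rewrite -ball_normE /= => cy.
set g := _ *: S y in cy.
have gc : inner g c = 0 by rewrite /g innerZl hy ?mulr0.
have gn : `|g| <= d / k.
  have [g0|g0] := eqVneq `|g| 0; first by rewrite g0 ltW.
  have gp : 0 < `|g| by rewrite lt_def g0 normr_ge0.
  rewrite -(ler_pM2l gp) -expr2 -inner_norm.
  have -> : inner g g = inner g (g - c) by rewrite innerBr gc subr0.
  by rewrite (le_trans (inner_le _ _))// ler_wpM2l// distrC ltW.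
have kt : 0 < k * `|y| by rewrite mulr_gt0.
move: gn; rewrite /g normrZ gtr0_norm ?invr_gt0// ler_pdivrMl// => /le_trans; apply.
by rewrite [leLHS](_ : _ = d * `|y|)//; field; lra.
Qed.

(* p is a cluster point of S along a maximizing sequence of the Rayleigh quotient. *)
Lemma invariant_subspace_eigenvector (X : set H) x0 : lin_subspace X -> norm_closed X ->
  (forall x, X x -> X (S x)) -> X x0 -> x0 != 0 ->
  exists p (l : R), [/\ X p, p != 0, l != 0 & S p = l *: p].
Proof.
move=> sX cX SX Xx0 x00.
pose Q := [set inner (S x) x | x in [set x | X x /\ `|x| = 1]].
have unit x : x != 0 -> `| `|x|^-1 *: x | = 1.
  by move=> h; rewrite normrZ normfV normr_id mulVf// normr_eq0.
have Qle q : Q q -> q <= 1.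
  move=> [x [Xx x1] <-]; rewrite (le_trans (inner_le _ _))// x1 mulr1 -x1.
  exact: (shift_inverse_bounded pA iS).
have Qx x : X x -> x != 0 -> Q (inner (S x) x / `|x| ^+ 2).
  move=> Xx xn0; exists (`|x|^-1 *: x); first by split; [exact: subspaceZ|exact: unit].
  by rewrite (linear_mapZ lS) innerZl innerZr mulrA -invfM mulrC.
have supQ : has_sup Q.
  by split; [exists (inner (S x0) x0 / `|x0| ^+ 2); exact: Qx|exists 1; exact: Qle].
set l := sup Q.
have lub q : Q q -> q <= l by move=> Qq; apply: sup_upper_bound.
have l0 : 0 < l.
  apply: lt_le_trans (lub _ (Qx _ Xx0 x00)); rewrite divr_gt0 ?exprn_gt0 ?normr_gt0//.
  apply: lt_le_trans (shift_inverse_pos pA iS x0); rewrite exprn_gt0// normr_gt0.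
  by apply: contra_neq x00; exact: (shift_inverse_inj sA iS).
have form x : X x -> 0 <= l * `|x| ^+ 2 - inner (S x) x.
  move=> Xx; have [->|xn0] := eqVneq x 0.
    by rewrite inner0r normr0 expr0n /= mulr0 subr0.
  have := lub _ (Qx _ Xx xn0); rewrite ler_pdivrMr ?exprn_gt0 ?normr_gt0//.
  by rewrite subr_ge0.
(* Cauchy-Schwarz for the nonnegative form of l - S, obtained by evaluating this form at x - w/l. A
   near-maximizer of the quotient is thus a near-eigenvector. *)
have cs x : X x -> `|l *: x - S x| ^+ 2 <= l * (l * `|x| ^+ 2 - inner (S x) x).
  move=> Xx; set w := l *: x - S x.
  have Xw : X w by apply: subspaceB; [|apply: subspaceZ|exact: SX].
  have := form _ (subspaceB sX Xx (subspaceZ l^-1 sX Xw)).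
  rewrite (linear_mapB lS) (linear_mapZ lS) sqr_normB normrZ exprMn.
  rewrite !innerBl !innerBr !innerZl !innerZr (shift_inverse_sym sA iS w x).
  rewrite [inner w (S x)]innerC [inner x w]innerC.
  have wE : `|w| ^+ 2 = l * inner w x - inner (S x) w.
    by rewrite -inner_norm {2}/w innerBr innerZr [inner w (S x)]innerC.
  have Sw := le_trans (exprn_ge0 2 (normr_ge0 _)) (shift_inverse_pos pA iS w).
  rewrite real_normK ?num_real// exprVn => h.
  have := mulr_ge0 (ltW l0) h => h'.
  have : l^-1 * inner (S w) w >= 0 by rewrite mulr_ge0// invr_ge0 ltW.
  move: h'; set a := inner (S x) x; set b := inner w x in wE *.
  set c := inner (S x) w in wE *; set f := inner (S w) w.
  set W := `|w| ^+ 2 in wE *; set X2 := `|x| ^+ 2.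
  have -> : l * (l * (X2 - 2 * (l^-1 * b) + (l ^+ 2)^-1 * W) -
       (a - l^-1 * c - (l^-1 * c - l^-1 * (l^-1 * f)))) =
     l * (l * X2 - a) - 2 * (l * b - c) + W - l^-1 * f by field; lra.
  rewrite -wE; lra.
have [E [cE [k k0 hE]]] := shift_inverse_compact.
have q0 n : 0 < (2^-1 : R) ^+ n by rewrite exprn_gt0.
have /choice[u uP] n : exists x, [/\ X x, `|x| = 1 & l - 2^-1 ^+ n < inner (S x) x].
  have [_ [x [Xx x1] <-] h] := sup_adherent (q0 n) supQ.
  by exists x.
pose g n := (k * 1)^-1 *: S (u n).
have [q [_ clq]] : E `&` cluster (g @ \oo) !=set0.
  apply: cE; exists 0%N => // n _ /=.
  by apply: hE => //; have [_ -> _] := uP n.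
pose p := k *: q.
have near d : 0 < d -> exists x, [/\ X x, `|x| = 1, `|S x - p| < d & `|l *: x - S x| < d].
  move=> d0.
  have dk : 0 < d / k by rewrite divr_gt0.
  have d2 : 0 < d ^+ 2 by rewrite exprn_gt0.
  have q01 : 0 <= (2^-1 : R) < 1 by lra.
  have [N hN] := exp_small l q01 d2.
  have gN : (g @ \oo) (g @` [set n | (N <= n)%N]).
    by exists N => // n Nn /=; exists n.
  have [_ [[n /= Nn <-] qn]] := clq _ _ gN (nbhsx_ballx q _ dk).
  have [Xu u1 ul] := uP n; exists (u n); split=> //.
    move: qn; rewrite -ball_normE /= /g mulr1 => qn.
    have -> : S (u n) - p = - (k *: (q - k^-1 *: S (u n))).
      by rewrite scalerBr scalerA mulfV ?gt_eqF// scale1r opprB.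
    by rewrite normrN normrZ gtr0_norm// -ltr_pdivlMl// mulrC.
  rewrite -(@ltr_pXn2r _ 2) ?nnegrE ?(ltW d0)// (le_lt_trans (cs _ Xu))//.
  rewrite u1 expr1n mulr1 (le_lt_trans _ hN)// ler_wpM2l ?(ltW l0)//.
  have : (2^-1 : R) ^+ n <= 2^-1 ^+ N by rewrite ler_wiXn2l//; lra.
  lra.
exists p, l; split.
- apply: cX => d d0; have d2 : 0 < d / 2 by rewrite divr_gt0.
  have [x [Xx x1 h1 h2]] := near _ d2; exists (l *: x); first exact: subspaceZ.
  by rewrite (le_lt_trans (ler_distD (S x) _ _))//; lra.
- apply/eqP => p0; have l4 : 0 < l / 4 by rewrite divr_gt0.
  have [x [Xx x1 h1 h2]] := near _ l4; rewrite p0 subr0 in h1.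
  have : `|l *: x| <= `|l *: x - S x| + `|S x| by rewrite -{1}(subrK (S x) (l *: x)) ler_normD.
  by rewrite normrZ x1 gtr0_norm//; lra.
- by rewrite gt_eqF.
- apply/eqP; rewrite -subr_eq0 -normr_eq0; apply/eqP.
  apply: (@eq0_of_small _ _ (2 + l)); first by lra.
  move=> d d0; have [x [Xx x1 h1 h2]] := near _ d0; rewrite normr_id.
  have -> : S p - l *: p = (S (p - l *: x)) + l *: (S x - p).
    by rewrite (linear_mapB lS) (linear_mapZ lS l x) scalerBr addrA subrK.
  rewrite (le_trans (ler_normD _ _))// mulrDl lerD//.
    rewrite (le_trans (shift_inverse_bounded pA iS _))//.
    rewrite (le_trans (ler_distD (S x) _ _))//.
    by have := distrC p (S x); have := distrC (S x) (l *: x); lra.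
  by rewrite normrZ gtr0_norm// ler_wpM2l ?ltW.
Qed.

(** The orthogonal complement of all eigenvectors is closed and S-invariant. If nonzero, it would
    contain an eigenvector, which would be orthogonal to itself. *)
Lemma eigenvectors_complete x :
  (forall l e, eigenspaceA (A := A) l e -> inner x e = 0) -> x = 0.
Proof.
move=> hx; have [//|x0] := eqVneq x 0.
pose X := [set x | forall l e, eigenspaceA (A := A) l e -> inner x e = 0].
have sX : lin_subspace X.
  split=> [l e _|a u v Xu Xv l e le]; first exact: inner0l.
  by rewrite innerDl innerZl (Xu l)// (Xv l)// mulr0 addr0.
have cX : norm_closed X.
  move=> u hu l e le; apply: (@eq0_of_small _ _ `|e|) => // d /hu[v Xv vu].
  rewrite -[inner u e]opprK -[- inner u e]add0r -(Xv l e le) -innerBl normrN.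
  by rewrite (le_trans (cauchy_schwarz _ _))// mulrC ler_wpM2l// ltW.
have SX u : X u -> X (S u).
  move=> Xu l e [de Ae]; have [_ S2] := iS.
  have Se : (1 + l) *: S e = e by rewrite -(linear_mapZ lS) scalerDl scale1r -Ae S2.
  rewrite (shift_inverse_sym sA iS).
  have [l1|l1] := eqVneq (1 + l) 0.
    by rewrite -Se l1 scale0r (linear_map0 lS) inner0r.
  have -> : S e = (1 + l)^-1 *: e by rewrite -[in RHS]Se scalerA mulVf// scale1r.
  by rewrite innerZr (Xu l)// mulr0.
have [p [l [Xp p0 l0 Sp]]] := invariant_subspace_eigenvector sX cX SX hx x0.
have := Xp _ _ (shift_inverse_eigen sA iS l0 Sp) => /inner_eq0 pp.
by rewrite pp eqxx in p0.
Qed.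

End CompactResolvent.

(** * Functional calculus and the frequency cut-off *)

Section FunctionalCalculus.
Context {R : realType} {H : hilbertType R} {A : partial_op H}.
Implicit Types (x y u v w e : H) (f g : R -> R).
Hypotheses (sA : selfadjoint_op A) (pA : nonnegative_op A) (cA : compact_resolvent A).

Local Notation E := (eigenspaceA (A := A)).

Lemma complete_eq x y : (forall l e, E l e -> inner x e = inner y e) -> x = y.
Proof.
have [S iS] := shift_inverse_exists sA pA => xy; apply/eqP; rewrite -subr_eq0.
apply/eqP; apply: (eigenvectors_complete sA pA cA iS) => l e le.
by rewrite innerBl (xy l e le) subrr.
Qed.

Lemma eigenprojP l x : E l (eigenproj A l x) /\
  forall e, E l e -> inner (eigenproj A l x) e = inner x e.
Proof.
have [h1 h2] := orth_projP x (eigenspaceA_subspace sA l) (eigenspaceA_closed sA (l := l)).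
split=> // e /h2; rewrite innerBl => /eqP; rewrite subr_eq0 => /eqP <-.
by [].
Qed.

Lemma fcalc_graphP f u v : fcalc_graph A f u v <->
  forall l e, E l e -> inner v e = f l * inner u e.
Proof.
split=> h l.
  move=> e le; have [_ pv] := eigenprojP l v; have [_ pu] := eigenprojP l u.
  by rewrite -pv// -pu// h innerZl.
have [Ev pv] := eigenprojP l v; have [Eu pu] := eigenprojP l u.
have Ed : E l (eigenproj A l v - f l *: eigenproj A l u).
  by apply: subspaceB; [exact: eigenspaceA_subspace|exact: Ev|
     apply: subspaceZ => //; exact: eigenspaceA_subspace].
apply/eqP; rewrite -subr_eq0; apply/eqP/inner_eq0.
by rewrite {1}innerBl innerZl pv// pu// (h l)// subrr.
Qed.

(** Completeness makes the graph single-valued, so the vector selected by [xget] must be v. *)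
Lemma fcalcE f u v : (forall l e, E l e -> inner v e = f l * inner u e) ->
  op_dom (fcalc A f) u /\ fcalc A f u = v.
Proof.
move=> h; have gv : fcalc_graph A f u v by apply/fcalc_graphP.
split; first by exists v.
rewrite /fcalc /=; case: xgetP => [w -> /= /fcalc_graphP gw|/(_ v)//].
by apply: complete_eq => l e le; rewrite (gw l e le) (h l e le).
Qed.

Lemma fcalc_inner f u : op_dom (fcalc A f) u ->
  forall l e, E l e -> inner (fcalc A f u) e = f l * inner u e.
Proof. by move=> [v /fcalc_graphP h]; have [_ ->] := fcalcE h. Qed.

Lemma fracpow2_inner l e u : op_dom A u -> E l e ->
  inner (u + A u) e = (1 + l) `^ (2 / 2) * inner u e.
Proof.
move=> du le; rewrite (inner_shift_eigen sA du le).
have [->|e0] := eqVneq e 0; first by rewrite !inner0r !mulr0.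
rewrite divff// powRr1//.
by have := eigenspaceA_ge0 pA le e0; lra.
Qed.

(** If v has components (1 + l) <u, e>, then S v has the same components as u, so u lies in the
    range of S. *)
Lemma Hsp2E : Hsp A 2 = op_dom A.
Proof.
have [S iS] := shift_inverse_exists sA pA.
have [S1 S2] := iS.
apply/seteqP; split=> u; last first.
  by move=> du; have [] := fcalcE (fun l e le => fracpow2_inner du le).
move=> Hu; have h := fcalc_inner Hu.
set v := fcalc A _ u in h.
have [dS SE] := S1 v.
suff -> : u = S v by [].
apply: complete_eq => l e le; have := fracpow2_inner dS le; rewrite SE (h l e le).
have [->|e0] := eqVneq e 0; first by rewrite !inner0r.
move=> /mulfI; apply; rewrite gt_eqF// powR_gt0//.
by have := eigenspaceA_ge0 pA le e0; lra.
Qed.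

Lemma Hnorm2E u : op_dom A u -> Hnorm A 2 u = `|u + A u|.
Proof.
move=> du; rewrite /Hnorm /fracpow.
by have [_ ->] := fcalcE (fun l e le => fracpow2_inner du le).
Qed.

(* Pairing with finite sums of eigenvectors, which are dense, reduces the
   bound to Pythagoras. *)
Lemma multiplier_bound g (c : R) v w : 0 <= c ->
  (forall l e, E l e -> e != 0 -> `|g l| <= c) ->
  (forall l e, E l e -> inner w e = g l * inner v e) -> `|w| <= c * `|v|.
Proof.
move=> c0 gc wE.
pose Y := [set x | exists (s : seq R) (f : R -> H),
  [/\ uniq s, forall l, E l (f l) & x = \sum_(l <- s) f l]].
have sE l := eigenspaceA_subspace sA l.
(* Two sums over different lists of eigenvalues are padded with zeros to a common list before being
   added. *)
have ext (s t : seq R) (f : R -> H) : uniq s -> uniq t -> {subset s <= t} ->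
    \sum_(l <- s) f l = \sum_(l <- t) (if l \in s then f l else 0).
  move=> us ut st; rewrite -big_mkcond /= -[RHS]big_filter; apply: perm_big.
  apply: uniq_perm; rewrite ?filter_uniq// => l; rewrite mem_filter.
  by case: (boolP (l \in s)) => // /st ->.
have sY : lin_subspace Y.
  split=> [|a _ _ [s [f [us Ef ->]]] [t [h [ut Eh ->]]]].
    exists [::], (fun=> 0); split=> //; last by rewrite big_nil.
    by move=> l; case: (sE l).
  exists (undup (s ++ t)), (fun l => a *: (if l \in s then f l else 0) +
    (if l \in t then h l else 0)); split; first exact: undup_uniq.
    move=> l; have [E0 El] := sE l.
    by apply: El; case: ifP.
  rewrite big_split /= -scaler_sumr.
  congr (_ *: _ + _); apply: ext => //; rewrite ?undup_uniq// => l ls;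
    by rewrite mem_undup mem_cat ls ?orbT.
have pyth (s : seq R) (f : R -> H) : uniq s -> (forall l, E l (f l)) ->
    `|\sum_(l <- s) f l| ^+ 2 = \sum_(l <- s) `|f l| ^+ 2.
  move=> + Ef; elim: s => [_|l s IH /= /andP[ls us]].
    by rewrite !big_nil normr0 expr0n.
  rewrite !big_cons sqr_normD IH// inner_sumr big_seq big1 ?mulr0 ?addr0// => l' l's.
  by apply: (eigenspaceA_orth sA _ (Ef l) (Ef l')); apply: contraNneq ls => ->.
have bound x : Y x -> inner w x <= c * `|v| * `|x|.
  move=> [s [f [us Ef ->]]].
  have -> : inner w (\sum_(l <- s) f l) = inner v (\sum_(l <- s) g l *: f l).
    rewrite !inner_sumr; apply: eq_bigr => l _.
    by rewrite (wE l)// innerZr.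
  rewrite (le_trans (inner_le _ _))// [c * _]mulrC -mulrA ler_wpM2l//.
  rewrite -(@ler_pXn2r _ 2) ?nnegrE ?mulr_ge0// exprMn !pyth//; last first.
    by move=> l; apply: subspaceZ.
  rewrite mulr_sumr; apply: ler_sum => l _; rewrite normrZ exprMn.
  have [->|fl] := eqVneq (f l) 0; first by rewrite normr0 expr0n /= !mulr0.
  by rewrite ler_wpM2r ?exprn_ge0// lerXn2r ?nnegrE// (gc l (f l)).
(* The closure of Y is the whole space by completeness; the bound on Y is then evaluated near w
   itself. *)
pose Yc := [set x | forall d : R, 0 < d -> exists2 y, Y y & `|y - x| < d].
have sYc : lin_subspace Yc.
  split=> [d d0|a x y Yx Yy d d0]; first by exists 0; [case: sY|rewrite subrr normr0].
  have a0 : 0 < `|a| + 1 by have := normr_ge0 a; lra.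
  have d1 : 0 < d / 2 / (`|a| + 1) by rewrite !divr_gt0.
  have d2 : 0 < d / 2 by rewrite divr_gt0.
  have [x' Yx' xx'] := Yx _ d1; have [y' Yy' yy'] := Yy _ d2.
  exists (a *: x' + y'); first by case: sY => _; apply.
  rewrite opprD addrACA -scalerBr (le_lt_trans (ler_normD _ _))// normrZ.
  have : `|a| * `|x' - x| <= d / 2.
    rewrite (le_trans (ler_wpM2l _ (ltW xx')))// mulrCA ler_piMr ?(ltW d2)//.
    by rewrite ler_pdivrMr//; lra.
  lra.
have cYc : norm_closed Yc.
  move=> x hx d d0; have d2 : 0 < d / 2 by rewrite divr_gt0.
  have [y Yy yx] := hx _ d2; have [z Yz zy] := Yy _ d2; exists z => //.
  by rewrite (le_lt_trans (ler_distD y _ _))//; lra.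
have : Yc w.
  apply: closed_subspace_full => // y hy; apply: complete_eq => l e le.
  rewrite inner0l; apply: hy => d d0; exists e; last by rewrite subrr normr0.
  exists [:: l], (fun l' => if l' == l then e else 0); split=> //.
    by move=> l'; case: eqP => [->//|_]; case: (sE l').
  by rewrite big_seq1 eqxx.
move=> Yw.
have key d : 0 < d -> `|w| ^+ 2 <= c * `|v| * `|w| + (`|w| + c * `|v|) * d.
  move=> d0; have [y Yy yw] := Yw _ d0.
  rewrite -inner_norm -{2}(subrK y w) innerDr.
  have h1 := inner_le w (w - y); have h2 := bound y Yy.
  have h3 : `|y| <= `|w| + d.
    by rewrite -(subrK w y) (le_trans (ler_normD _ _))// addrC lerD2l ltW.
  have h4 : `|w| * `|w - y| <= `|w| * d by rewrite ler_wpM2l// distrC ltW.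
  have h5 : c * `|v| * `|y| <= c * `|v| * (`|w| + d) by rewrite ler_wpM2l// mulr_ge0.
  lra.
have sq : `|w| ^+ 2 <= c * `|v| * `|w|.
  apply/ler_addgt0Pr => d d0.
  have p0 : 0 < `|w| + c * `|v| + 1 by rewrite ltr_wpDl// addr_ge0// mulr_ge0.
  have := key (d / (`|w| + c * `|v| + 1)) (divr_gt0 d0 p0) => /le_trans; apply.
  rewrite lerD2l mulrCA ler_piMr ?(ltW d0)// ler_pdivrMr//; lra.
have [->|w0] := eqVneq `|w| 0; first by rewrite mulr_ge0.
have wp : 0 < `|w| by rewrite lt_def w0 normr_ge0.
by rewrite -(ler_pM2r wp) -expr2.
Qed.

Context {mu eps : R}.
Hypotheses (mu0 : 0 < mu) (eps0 : 0 < eps).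
Let Lam := mu * eps ^- 2.
Let Lam0 : 0 < Lam.
Proof. by rewrite mulr_gt0// invr_gt0 exprn_gt0. Qed.
Let ind : R -> R := \1_(`[0, mu * eps ^- 2]%classic).

Let indE l : 0 <= l -> ind l = if l <= Lam then 1 else 0.
Proof.
by move=> l0; rewrite /ind indicE mem_setE in_itv /= l0 /= -/Lam; case: ifP.
Qed.

(** Low-frequency subspace, described as an orthogonal complement so that it is closed by
    construction. Its projection realizes the calculus of the indicator on every vector. *)
Let M := [set x | forall l e, Lam < l -> E l e -> inner x e = 0].

Let sM : lin_subspace M.
Proof.
split=> [l' e' _ _|a x y Mx My l' e' ll' le']; first exact: inner0l.
by rewrite innerDl innerZl (Mx l')// (My l')// mulr0 addr0.
Qed.

Let cM : norm_closed M.
Proof.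
move=> x hx l' e' ll' le'; apply: (@eq0_of_small _ _ `|e'|) => // d /hx[v Mv vx].
rewrite -[inner x e']opprK -[- inner x e']add0r -(Mv l' e' ll' le') -innerBl normrN.
by rewrite (le_trans (cauchy_schwarz _ _))// mulrC ler_wpM2l// ltW.
Qed.

Let orth_proj_inner u l e : E l e -> inner (orth_proj M u) e = ind l * inner u e.
Proof.
have [Mp pP] := orth_projP u sM cM.
move=> le; have [->|e0] := eqVneq e 0; first by rewrite !inner0r mulr0.
rewrite indE; last exact: eigenspaceA_ge0 le e0.
case: ifPn => [lL|]; last by rewrite -ltNge => lL; rewrite mul0r (Mp l).
rewrite mul1r; have Me : M e.
  move=> l2 e2 ll2 le2; apply: (eigenspaceA_orth sA _ le le2).
  by rewrite lt_eqF// (le_lt_trans lL).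
by have /eqP := pP _ Me; rewrite innerBl subr_eq0 => /eqP ->.
Qed.

Let lowprojE u : lowproj A mu eps u = orth_proj M u.
Proof. exact: (fcalcE (fun l e => @orth_proj_inner u l e)).2. Qed.

Lemma lowproj_inner u l e : E l e ->
  inner (lowproj A mu eps u) e = (if l <= Lam then 1 else 0) * inner u e.
Proof.
move=> le; rewrite lowprojE (orth_proj_inner _ le).
have [->|e0] := eqVneq e 0; first by rewrite !inner0r !mulr0.
by rewrite indE//; exact: eigenspaceA_ge0 le e0.
Qed.

Definition highproj u := u - lowproj A mu eps u.

Lemma highproj_idem u v : inner (highproj u) v = inner (highproj u) (highproj v).
Proof.
rewrite /highproj [in RHS]innerBr !lowprojE.
have [_ pP] := orth_projP u sM cM; have [Mv _] := orth_projP v sM cM.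
by rewrite (pP _ Mv) subr0.
Qed.

Lemma highproj_inner u l e : E l e ->
  inner (highproj u) e = (if l <= Lam then 0 else 1) * inner u e.
Proof.
by move=> le; rewrite innerBl (lowproj_inner u le); case: ifP => _; ring.
Qed.

Lemma highproj_linear : linear_map highproj.
Proof.
move=> a x y; apply: complete_eq => l e le.
rewrite (innerDl (a *: highproj x)) (innerZl a (highproj x)) !(highproj_inner _ le).
by rewrite innerDl innerZl; ring.
Qed.

(** Q u arises from (1 + A)^(r/2) u through the multiplier (1 + l)^(-r/2) cut off below [Lam], which
    is bounded by its value at [Lam]. *)
Lemma highproj_bound u (r : R) : 0 <= r -> Hsp A r u ->
  `|highproj u| <= (1 + Lam) `^ (- (r / 2)) * Hnorm A r u.
Proof.
move=> r0 Hu.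
pose g l := if l <= Lam then 0 else (1 + l) `^ (- (r / 2)).
apply: (@multiplier_bound g); first exact: powR_ge0.
  move=> l e le e0; rewrite /g; case: ifPn => [_|]; first by rewrite normr0 powR_ge0.
  rewrite -ltNge => lL; rewrite ger0_norm ?powR_ge0// !powRN.
  have L1 : 0 < 1 + Lam by rewrite addr_gt0.
  have Ll : 1 + Lam <= 1 + l by rewrite lerD2l ltW.
  have l1 := lt_le_trans L1 Ll.
  rewrite lef_pV2 ?posrE ?powR_gt0//.
  by apply: ge0_ler_powR => //; rewrite ?nnegrE ?divr_ge0// ltW.
move=> l e le; rewrite (highproj_inner u le) /Hnorm (fcalc_inner Hu le).
have [->|e0] := eqVneq e 0; first by rewrite !inner0r !mulr0.
have l0 := eigenspaceA_ge0 pA le e0.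
rewrite /g; case: ifP => _; first by rewrite !mul0r.
rewrite mulrA -powRD; last by apply/implyP => _; rewrite gt_eqF//; lra.
by rewrite addNr powRr0.
Qed.

End FunctionalCalculus.

Arguments highproj {R H} A mu eps u.

(** * Stability of the Morse index *)

Section Linearization.
Context {R : realType} {H : hilbertType R}.
Local Notation HC := (complexification H).
Implicit Types (A : partial_op H) (B : H -> H) (z : R[i]) (w : HC) (b : R).

Lemma cplx_scaleE z w : z *: w =
  (complex.Re z *: w.1 - complex.Im z *: w.2, complex.Re z *: w.2 + complex.Im z *: w.1).
Proof. by []. Qed.

Lemma complexify_linear A : linear_op A -> linear_op (complexify A).
Proof.
move=> lA; have sA := linear_op_subspace lA; have [d0 dl Al] := lA.
have A0 := linear_on0 sA (linear_op_on lA).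
have AZ a x : op_dom A x -> A (a *: x) = a *: A x.
  by move=> dx; rewrite -[a *: x]addr0 Al// A0 addr0.
have AD x y : op_dom A x -> op_dom A y -> A (x + y) = A x + A y.
  by move=> dx dy; rewrite -[x in LHS]scale1r Al// scale1r.
have AB x y : op_dom A x -> op_dom A y -> A (x - y) = A x - A y.
  by move=> dx dy; rewrite AD//; [rewrite -[- y]scaleN1r AZ// scaleN1r|exact: subspaceN].
split=> [|z [x1 x2] [y1 y2] [/= dx1 dx2] [/= dy1 dy2]|z [x1 x2] [y1 y2] [/= dx1 dx2] [/= dy1 dy2]].
- by [].
- split=> /=; apply: (subspaceD sA) => //.
    by apply: (subspaceB sA); apply: subspaceZ.
  by apply: (subspaceD sA); apply: subspaceZ.
- have dZ a x := @subspaceZ _ _ _ a x sA.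
  rewrite /= !cplx_scaleE /=.
  have -> : A (complex.Re z *: x1 - complex.Im z *: x2 + y1) =
      complex.Re z *: A x1 - complex.Im z *: A x2 + A y1.
    rewrite AD//; last by apply: (subspaceB sA); apply: dZ.
    by rewrite AB; [rewrite !AZ| exact: dZ|exact: dZ].
  have -> : A (complex.Re z *: x2 + complex.Im z *: x1 + y2) =
      complex.Re z *: A x2 + complex.Im z *: A x1 + A y2.
    rewrite AD//; last by apply: (subspaceD sA); apply: dZ.
    by rewrite AD; [rewrite !AZ| exact: dZ|exact: dZ].
  by [].
Qed.

Lemma linearization_linear A B : linear_op A -> linear_map B ->
  linear_op (linearization A B).
Proof.
move=> [d0 dl Al] lB; split=> // a x y dx dy /=.
by rewrite Al// lB opprD addrACA scalerDr scalerN.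
Qed.

(** The properties common to A and A_eps from which the a priori bounds are derived. *)
Definition sym_nonneg A := [/\ linear_op A,
  forall x y, op_dom A x -> op_dom A y -> inner (A x) y = inner x (A y) &
  nonnegative_op A].

Lemma cnorm_le (w v : HC) : `|w.1| <= `|v.1| -> `|w.2| <= `|v.2| -> cnorm w <= cnorm v.
Proof.
move=> h1 h2; rewrite -(@ler_pXn2r _ 2) ?nnegrE ?cnorm_ge0// !cnorm_sqr.
by rewrite lerD// ler_pXn2r ?nnegrE.
Qed.

Lemma cnorm_real_scale (a : R) (x y : H) : 0 <= a ->
  cnorm ((a *: x, a *: y) : HC) = a * cnorm ((x, y) : HC).
Proof.
move=> a0; have -> : ((a *: x, a *: y) : HC) = a%:C%C *: ((x, y) : HC).
  by rewrite cplx_scaleE /= !scale0r subr0 addr0.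
by rewrite cnormZ normc_real ger0_norm.
Qed.

(** In |A w + z w|^2 the terms with Im z cancel by symmetry, and what exceeds |z|^2 |w|^2 is |A w|^2
    plus 2 Re z times the form of A, all nonnegative. *)
Lemma shift_a_priori A z w : sym_nonneg A -> 0 <= complex.Re z ->
  op_dom (complexify A) w -> normc z * cnorm w <= cnorm (complexify A w + z *: w).
Proof.
move=> [lA sym pA] z0 [dx dy].
rewrite -(@ler_pXn2r _ 2) ?nnegrE ?mulr_ge0 ?cnorm_ge0 ?normc_ge0//.
rewrite exprMn !cnorm_sqr normc_sqr cplx_scaleE.
case: w dx dy => x y /= dx dy; case: z z0 => s t /= s0.
have pos : 0 <= s * (inner (A x) x + inner (A y) y).
  by rewrite mulr_ge0// addr_ge0// pA.
have := inner_ge0 (A x); have := inner_ge0 (A y).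
rewrite -!inner_norm !(innerDl, innerDr, innerNl, innerNr, innerZl, innerZr).
rewrite [inner x (A x)]innerC [inner y (A y)]innerC [inner x (A y)]innerC.
rewrite (sym _ _ dy dx) [inner y (A x)]innerC [inner y x]innerC.
lra.
Qed.

Lemma linearization_a_priori A B b z w : sym_nonneg A ->
  (forall x, `|B x| <= b * `|x|) -> 0 <= b -> 0 <= complex.Re z ->
  op_dom (complexify A) w ->
  (normc z - b) * cnorm w <= cnorm (complexify (linearization A B) w - z *: w).
Proof.
move=> sA Bb b0 z0 dw.
have -> : complexify (linearization A B) w - z *: w =
    (B w.1, B w.2) - (complexify A w + z *: w).
  rewrite opprD addrA; congr (_ + _).
  transitivity ((B w.1 - A w.1, B w.2 - A w.2) : HC); last by [].
  by rewrite /= [- A w.1 + _]addrC [- A w.2 + _]addrC.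
have h1 := shift_a_priori sA z0 dw.
have h2 : cnorm ((B w.1, B w.2) : HC) <= b * cnorm w.
  case: w {dw h1} => x y /=; rewrite -cnorm_real_scale//.
  by apply: cnorm_le; rewrite /= normrZ ger0_norm.
set u : HC := (B w.1, B w.2) in h2 *; set v := _ + _ in h1 *.
have := cnormB u (u - v); rewrite subKr; lra.
Qed.

End Linearization.

(** * Resolvent bounds in the closed right half plane *)

Section HalfPlane.
Context {R : realType} {H : hilbertType R}.
Local Notation HC := (complexification H).
Implicit Types (A : partial_op H) (B : H -> H) (z : R[i]) (w : HC) (M : R).

Lemma goodW (T : partial_op HC) z M M' : M <= M' -> good T z M -> good T z M'.
Proof. by move=> MM' [S rS SM]; exists S => //; exact: bounded_byW SM. Qed.

Lemma hyperbolicP (T : partial_op H) : hyperbolic T <->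
  forall z, complex.Re z = 0 -> exists M, good (complexify T) z M.
Proof.
split=> [hT z z0|hT].
  have [[S [rS [M SM]]]|nz] := pselect (resolvent_set T z); first by exists M, S.
  suff : (spectrum T `&` [set z | complex.Re z = 0]) z by rewrite hT.
  by split.
rewrite /hyperbolic -subset0 => z [nz /hT[M [S rS SM]]].
by apply: nz; exists S; split=> //; exists M.
Qed.

Lemma normc_ge_Re z : `|complex.Re z| <= normc z.
Proof.
rewrite -(@ler_pXn2r _ 2) ?nnegrE ?normc_ge0// normc_sqr real_normK ?num_real//.
by rewrite lerDl sqr_ge0.
Qed.

Lemma normc_ge_Im z : `|complex.Im z| <= normc z.
Proof.
rewrite -(@ler_pXn2r _ 2) ?nnegrE ?normc_ge0// normc_sqr real_normK ?num_real//.
by rewrite lerDr sqr_ge0.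
Qed.

Section Fixed.
Context {A : partial_op H} {B : H -> H} {b : R}.
Hypotheses (sA : sym_nonneg A) (lB : linear_map B)
  (Bb : forall x, `|B x| <= b * `|x|) (b0 : 0 <= b).
Local Notation T := (complexify (linearization A B)).

Lemma linearizationC_linear : linear_op T.
Proof.
by apply: complexify_linear; apply: linearization_linear => //; case: sA.
Qed.

Lemma a_priori1 z w : 0 <= complex.Re z -> b + 1 <= normc z -> op_dom T w ->
  cnorm w <= cnorm (T w - z *: w).
Proof.
move=> z0 zb dw; have := linearization_a_priori sA Bb b0 z0 dw.
by apply: le_trans; have := cnorm_ge0 w; nra.
Qed.

(** The sign s selects the upper or lower side. On the segment from the axis point s (b + 1) i to
    the target, Re stays nonnegative and s Im stays at least b + 1, so the a priori bound applies
    all along. *)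
Lemma good_far_up (s : R) M x y : s ^+ 2 = 1 -> good T (Complex 0 (s * (b + 1))) M ->
  0 <= x -> b + 1 <= s * y -> good T (Complex x y) 1.
Proof.
move=> s1 ga x0 sy.
rewrite (_ : Complex x y = Complex 0 (s * (b + 1)) + Complex x (y - s * (b + 1))); last first.
  by apply/eqP; rewrite eq_complex /= add0r addrC subrK !eqxx.
apply: (good_continuation linearizationC_linear ga) => t /andP[t0 t1] w dw.
apply: a_priori1 => //; first by rewrite /= !mul0r subr0 add0r mulr_ge0.
rewrite (le_trans _ (normc_ge_Im _))// /= mul0r addr0.
have sn : `|s| = 1 by apply/eqP; rewrite -sqrp_eq1 ?normr_ge0// real_normK ?num_real// s1.
rewrite -[leRHS]mul1r -[X in X * _]sn -normrM (le_trans _ (ler_norm _))//.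
have -> : s * (s * (b + 1) + t * (y - s * (b + 1))) =
  s ^+ 2 * (b + 1) + t * (s * y - s ^+ 2 * (b + 1)) by ring.
by rewrite s1 !mul1r lerDl mulr_ge0// subr_ge0.
Qed.

(** The a priori bound gives only injectivity; existence of the resolvent is continued from the
    axis, where it is assumed. *)
Lemma good_far : (forall z, complex.Re z = 0 -> exists M, good T z M) ->
  forall z, 0 <= complex.Re z ->
    b + 1 <= `|complex.Im z| \/ b + 1 <= complex.Re z -> good T z 1.
Proof.
move=> axis [x y] /= x0.
have up s : s ^+ 2 = 1 -> forall x' y', 0 <= x' -> b + 1 <= s * y' -> good T (Complex x' y') 1.
  move=> s1 x' y' x'0 sy; have [M gM] := axis (Complex 0 (s * (b + 1))) erefl.
  exact: good_far_up gM _ _.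
case=> [|xb].
  have [y0|y0] := leP 0 y; first by rewrite ger0_norm// => h; apply: (up 1); rewrite ?expr1n ?mul1r.
  by rewrite ltr0_norm// => h; apply: (up (-1)); rewrite ?sqrrN ?expr1n ?mulN1r.
(* For a large real part the path goes first to height b + 1 and then vertically, with |z| >= Re z
   >= b + 1. *)
have g1 : good T (Complex x (b + 1)) 1 by apply: (up 1); rewrite ?expr1n ?mul1r.
rewrite (_ : Complex x y = Complex x (b + 1) + Complex 0 (y - (b + 1))); last first.
  by apply/eqP; rewrite eq_complex /= addr0 addrC subrK !eqxx.
apply: (good_continuation linearizationC_linear g1) => t /andP[t0 t1] w dw.
have e : complex.Re (Complex x (b + 1) + t%:C%C * Complex 0 (y - (b + 1))) = x.
  by rewrite /= mulr0 mul0r subr0 addr0.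
apply: a_priori1 => //; first by rewrite e.
by rewrite (le_trans _ (normc_ge_Re _))// e ger0_norm.
Qed.

Lemma good_axis_uniform : (forall z, complex.Re z = 0 -> exists M, good T z M) ->
  exists2 M, 1 <= M & forall z, complex.Re z = 0 -> good T z M.
Proof.
move=> axis.
have lT := linearizationC_linear.
have := @segment_compact R (- (b + 1)) (b + 1).
(* Compactness of the segment is applied along the filter of large M: near each point the resolvent
   bound at most doubles, hence one M serves for all. Beyond the segment [good_far] gives the bound
   1. *)
move=> /compact_near_coveringP /(_ R (@pinfty_nbhs R) (fun M t => good T (Complex 0 t) M) _) h.
have {h} : \forall M \near +oo, `[- (b + 1), b + 1] `<=` (fun t => good T (Complex 0 t) M).
  apply: h => t _.
  have [M0 [Z rZ ZM0]] := axis (Complex 0 t) erefl.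
  have gt : good T (Complex 0 t) (`|M0| + 1).
    by exists Z => //; apply: bounded_byW ZM0; have := ler_norm M0; lra.
  have M1 : 0 < `|M0| + 1 by have := normr_ge0 M0; lra.
  have d0 : 0 < 2^-1 / (`|M0| + 1) by rewrite divr_gt0.
  exists (ball t (2^-1 / (`|M0| + 1)), [set M | 2 * (`|M0| + 1) < M]).
    split; first exact: nbhsx_ballx.
    by exists (2 * (`|M0| + 1)); split => //; rewrite num_real.
  move=> [t' M] [/= tt' MM].
  apply: (goodW (ltW MM)); apply: (good_nearby lT (ltW M1) gt).
  rewrite -ler_pdivlMr// (_ : Complex 0 t' - Complex 0 t = Complex 0 (t' - t)); last first.
    by apply/eqP; rewrite eq_complex /= subr0 !eqxx.
  by rewrite /= expr0n /= add0r sqrtr_sqr distrC ltW.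
move=> [M [_ hM]].
exists (Num.max 1 (M + 1)) => [|[x y] /= ->]; first by rewrite le_max lexx.
have [yb|yb] := leP (b + 1) `|y|.
  apply: (@goodW _ _ 1); first by rewrite le_max lexx.
  by apply: good_far => //=; left.
apply: (@goodW _ _ (M + 1)); first by rewrite le_max lexx orbT.
apply: hM; first by rewrite ltrDl.
by rewrite /= in_itv /= -ler_norml ltW.
Qed.

End Fixed.
End HalfPlane.

(** * Perturbations small relative to 1 + A *)

Section SpectralStability.
Context {R : realType} {H : hilbertType R}.
Local Notation HC := (complexification H).
Local Notation LC A B := (complexify (linearization A B)).
Implicit Types (A : partial_op H) (B : H -> H) (z : R[i]) (w : HC).

Definition shiftC A w : HC := (w.1 + A w.1, w.2 + A w.2).

(** (1 + A) Z f = Z f + B Z f - z Z f - f. The perturbation is measured against 1 + A, so the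
    resolvent has to be bounded in that norm too. *)
Lemma resolvent_shift_bound A B (b M : R) z Z f : 0 <= b ->
  (forall x, `|B x| <= b * `|x|) ->
  is_resolvent (LC A B) z Z -> bounded_by M Z ->
  cnorm (shiftC A (Z f)) <= (1 + (1 + b + normc z) * M) * cnorm f.
Proof.
move=> b0 Bb [Z1 _] ZM; have [_ ZE] := Z1 f.
pose BC w : HC := (B w.1, B w.2).
have BCb w : cnorm (BC w) <= b * cnorm w.
  case: w => x y /=; rewrite -cnorm_real_scale//.
  by apply: cnorm_le; rewrite /= normrZ ger0_norm.
have -> : shiftC A (Z f) = Z f + BC (Z f) - z *: Z f - f.
  rewrite -[X in _ - X]ZE subr_cancel_r.
  have -> : LC A B (Z f) = BC (Z f) - (A (Z f).1, A (Z f).2).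
    transitivity ((B (Z f).1 - A (Z f).1, B (Z f).2 - A (Z f).2) : HC); last by [].
    by rewrite /= [- A _ + _]addrC [- A (Z f).2 + _]addrC.
  by rewrite opprB [RHS]addrACA subrr addr0.
have h1 := cnormB (Z f + BC (Z f) - z *: Z f) f.
have h2 := cnormB (Z f + BC (Z f)) (z *: Z f).
have h3 := cnormD (Z f) (BC (Z f)).
have h4 := BCb (Z f).
rewrite cnormZ in h2.
have h5 : (1 + b + normc z) * cnorm (Z f) <= (1 + b + normc z) * (M * cnorm f).
  by rewrite ler_wpM2l// !addr_ge0// normc_ge0.
lra.
Qed.

Lemma linearization_perturbation A B A' B' (b M eta : R) z Z :
  linear_op A -> linear_map B -> linear_op A' -> linear_map B' ->
  op_dom A' = op_dom A -> 0 <= b -> (forall x, `|B x| <= b * `|x|) -> 0 <= eta ->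
  (forall x, op_dom A x ->
     `|linearization A' B' x - linearization A B x| <= eta * `|x + A x|) ->
  0 <= M -> is_resolvent (LC A B) z Z -> bounded_by M Z ->
  eta * (1 + (1 + b + normc z) * M) <= 2^-1 ->
  exists Z', [/\ is_resolvent (LC A' B') z Z', bounded_by (2 * M) Z' &
    forall f, cnorm (Z' f - Z f) <=
      2 * (eta * (1 + (1 + b + normc z) * M)) * M * cnorm f].
Proof.
move=> lA lB lA' lB' dA b0 Bb eta0 hE M0 rZ ZM small.
apply: (resolvent_perturbation _ _ _ M0 rZ ZM small).
- by apply: complexify_linear; apply: linearization_linear.
- by apply: complexify_linear; apply: linearization_linear.
- by rewrite /= dA.
move=> f; have [[dw1 dw2] ZE] := rZ.1 f.
have -> : LC A' B' (Z f) - z *: Z f - f = LC A' B' (Z f) - LC A B (Z f).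
  by rewrite -[X in _ - X = _]ZE subr_cancel_r.
apply: le_trans (_ : eta * cnorm (shiftC A (Z f)) <= _).
  rewrite -cnorm_real_scale//; apply: cnorm_le; rewrite /= normrZ ger0_norm//;
    exact: hE.
by rewrite -mulrA ler_wpM2l//; apply: resolvent_shift_bound rZ ZM.
Qed.

(** Each component of Z w is S applied to its image under 1 + A. The functionals pair Z w with the
    finitely many vectors that control S, and d / (c k) absorbs the scaling c and the bound k on (1
    + A) Z. *)
Lemma linearization_codim A B (b M : R) z (c : R) Z :
  selfadjoint_op A -> nonnegative_op A -> compact_resolvent A -> 0 < c -> 0 <= M ->
  linear_map B -> 0 <= b -> (forall x, `|B x| <= b * `|x|) ->
  is_resolvent (LC A B) z Z -> bounded_by M Z ->
  finite_codim_small (fun w => c%:C%C *: Z w).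
Proof.
move=> sA pA cA c0 M0 lB b0 Bb rZ ZM d d0.
have [S iS] := shift_inverse_exists sA pA; have [S1 S2] := iS.
pose k := 1 + (1 + b + normc z) * M.
have k0 : 0 < k by rewrite ltr_wpDr// mulr_ge0// !addr_ge0// normc_ge0.
have e0 : 0 < d / (c * k) by rewrite divr_gt0// mulr_gt0.
have [s sP] := shift_inverse_finite_codim sA pA cA iS e0.
exists (size s), (fun w : HC => \row_(i < size s)
  Complex (inner w.1 (nth 0 s i)) (inner w.2 (nth 0 s i))).
  move=> a x y; apply/rowP => i; rewrite !mxE cplx_scaleE; case: a => a a' /=.
  apply/eqP; rewrite eq_complex /= !(innerDl, innerNl, innerZl).
  by rewrite !eqxx.
move=> w /rowP h.
have [dw _] := rZ.1 w; case: dw => dw1 dw2.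
have cE : c%:C%C *: Z w = (c *: (Z w).1, c *: (Z w).2).
  by rewrite cplx_scaleE /= !scale0r subr0 addr0.
have hz i : (i < size s)%N -> inner (Z w).1 (nth 0 s i) = 0 /\ inner (Z w).2 (nth 0 s i) = 0.
  move=> si; have := h (Ordinal si); rewrite !mxE cE /= !innerZl => -[/eqP + /eqP].
  by rewrite !mulf_eq0 gt_eqF//= => /eqP -> /eqP ->.
rewrite cE cnorm_real_scale ?(ltW c0)//.
pose u := shiftC A (Z w).
have part (y : H) : op_dom A y -> (forall i, (i < size s)%N -> inner y (nth 0 s i) = 0) ->
    `|y| <= d / (c * k) * `|y + A y|.
  move=> dy hy; rewrite -{1}(S2 y dy); apply: sP => q /(nthP 0)[i si <-].
  by rewrite S2// hy.
have hu : cnorm (Z w) <= d / (c * k) * cnorm u.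
  rewrite -cnorm_real_scale ?(ltW e0)//; apply: cnorm_le; rewrite normrZ gtr0_norm//.
    by apply: part => // i /hz[].
  by apply: part => // i /hz[].
have ku : cnorm u <= k * cnorm w by exact: resolvent_shift_bound rZ ZM.
have -> : ((Z w).1, (Z w).2) = Z w by case: (Z w).
apply: le_trans (ler_wpM2l (ltW c0) hu) _.
apply: le_trans (ler_wpM2l (ltW c0) (ler_wpM2l (ltW e0) ku)) _.
by rewrite [leLHS](_ : _ = d * cnorm w)//; field; rewrite !gt_eqF.
Qed.

(** An unstable eigenvalue satisfies |z| <= b and Re z > d, hence |z|^2 < (b + 1)^2 <= 2 c d < 2 c
    Re z, which says |z - c| < c. *)
Lemma linearization_unstable_in_disc A B (b c d : R) : sym_nonneg A -> 0 <= b ->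
  (forall x, `|B x| <= b * `|x|) -> 0 < c -> (b + 1) ^+ 2 <= 2 * c * d -> b + 1 <= 2 * c ->
  (forall z, 0 <= complex.Re z <= d -> normc z <= 2 * c -> exists M, good (LC A B) z M) ->
  linear_map B -> unstable_in_disc (LC A B) c.
Proof.
move=> sA b0 Bb c0 cd cb hg lB z y z0 dy Ty y0.
have yp : 0 < cnorm y.
  by rewrite lt_def cnorm_ge0 andbT; apply/eqP => /cnorm_eq0.
have zb : normc z <= b.
  have := linearization_a_priori sA Bb b0 (ltW z0) dy.
  by rewrite Ty subrr cnorm0 pmulr_lle0// subr_le0.
have zd : d < complex.Re z.
  rewrite ltNge; apply/negP => zd.
  have [||M [Z rZ _]] := hg z; [by rewrite ltW| by lra|].
  have lZ := resolvent_linear (linearizationC_linear sA lB) rZ.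
  have [_ Z2] := rZ; have := Z2 y dy.
  by rewrite Ty subrr (linear_map0 lZ) => /esym.
rewrite -(@ltr_pXn2r _ 2) ?nnegrE ?normc_ge0 ?(ltW c0)//.
have z2 : normc z ^+ 2 < (b + 1) ^+ 2.
  by rewrite ltr_pXn2r ?nnegrE ?normc_ge0//; lra.
move: z2; rewrite !normc_sqr; case: z {Ty z0 zb} zd => s t /= zd.
have := ltr_pM2l c0 d s; rewrite zd; lra.
Qed.

End SpectralStability.

Section MorseStability.
Context {R : realType} {H : hilbertType R}.
Local Notation HC := (complexification H).
Local Notation LC A B := (complexify (linearization A B)).

Lemma selfadjoint_sym_nonneg (A : partial_op H) :
  selfadjoint_op A -> nonnegative_op A -> sym_nonneg A.
Proof.
by move=> sA pA; split=> //; [exact: selfadjoint_linear|exact: selfadjoint_sym].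
Qed.

(* For large c the circle |z - c| = c stays in the region where the resolvents
   are uniformly bounded, and its disc contains exactly the unstable spectrum. *)
Lemma morse_index_stable (A : partial_op H) (B : H -> H) (b : R) :
  selfadjoint_op A -> nonnegative_op A -> compact_resolvent A ->
  linear_map B -> 0 <= b -> (forall x, `|B x| <= b * `|x|) ->
  hyperbolic (linearization A B) ->
  exists m, has_morse_index (linearization A B) m /\
  exists2 eta0 : R, 0 < eta0 & forall (A' : partial_op H) (B' : H -> H),
    sym_nonneg A' -> op_dom A' = op_dom A -> linear_map B' ->
    (forall x, `|B' x| <= b * `|x|) ->
    (forall x, op_dom A x ->
       `|linearization A' B' x - linearization A B x| <= eta0 * `|x + A x|) ->
    hyperbolic (linearization A' B') /\ has_morse_index (linearization A' B') m.
Proof.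
move=> sA pA cA lB b0 Bb /hyperbolicP axis.
have snA := selfadjoint_sym_nonneg sA pA.
have lA := selfadjoint_linear sA.
have lT := linearizationC_linear snA lB.
have [M M1 gM] := good_axis_uniform snA lB Bb b0 axis.
have M0 : 0 < M by exact: lt_le_trans M1.
pose rho := b + 1; have rho1 : 1 <= rho by rewrite lerDr.
(* Width of the strip along the axis in which the bound M at most doubles. *)
pose d := (2 * M)^-1; have d0 : 0 < d by rewrite invr_gt0 mulr_gt0.
(* Gives both c >= rho, so that the centre is far, and c d >= 2 rho^2, which rules out the remaining
   points of the circle. *)
pose c := rho + 2 * rho ^+ 2 / d.
have cE : (c - rho) * d = 2 * rho ^+ 2 by rewrite /c addrAC subrr add0r divfK ?gt_eqF.
have c_rho : rho <= c by rewrite lerDl divr_ge0 ?mulr_ge0 ?exprn_ge0 ?ltW//; lra.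
have c0 : 0 < c by lra.
have cd : 2 * rho ^+ 2 <= c * d by rewrite -cE ler_wpM2r ?(ltW d0)//; lra.
have rho2 : 0 <= rho ^+ 2 by rewrite exprn_ge0//; lra.
have good1 z : 0 <= complex.Re z ->
    [\/ complex.Re z <= d, rho <= `|complex.Im z| | rho <= complex.Re z] ->
    good (LC A B) z (2 * M).
  move=> z0 [zd|zI|zR].
  - have g0 : good (LC A B) (Complex 0 (complex.Im z)) M by exact: gM.
    apply: (good_nearby lT (ltW M0) g0).
    have -> : z - Complex 0 (complex.Im z) = (complex.Re z)%:C%C.
      by case: z {z0 zd g0} => s t; apply/eqP; rewrite eq_complex /= subr0 subrr !eqxx.
    rewrite normc_real ger0_norm// -ler_pdivlMr//.
    by rewrite -invfM.
  - by apply: (@goodW _ _ _ _ 1); [lra|apply: (good_far snA lB Bb b0 axis) => //; left].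
  - by apply: (@goodW _ _ _ _ 1); [lra|apply: (good_far snA lB Bb b0 axis) => //; right].
have circle zeta : normc zeta = 1 -> let z := c%:C%C + c%:C%C * zeta in
    [/\ 0 <= complex.Re z, normc z <= 2 * c & good (LC A B) z (2 * M)].
  move=> z1 z.
  have zle : normc z <= 2 * c.
    rewrite (le_trans (le_normcD _ _))// normcM z1 mulr1 normc_real gtr0_norm//; lra.
  have := normc_sqr zeta; rewrite z1 expr1n.
  case: zeta z1 @z zle => s t z1 z zle st; rewrite /= in st.
  have s1 : -1 <= s by nra.
  have zE : z = Complex (c + c * s) (c * t).
    by apply/eqP; rewrite eq_complex /= !mul0r subr0 add0r addr0 !eqxx.
  have re0 : 0 <= c + c * s by nra.
  clearbody z; subst z; split; [exact: re0|exact: zle|apply: good1 => //=].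
  have [sd|sd] := leP (c + c * s) d; first by constructor 1.
  have [h|h] := leP rho `|c * t|; first by constructor 2.
  have [h'|h'] := leP rho (c + c * s); first by constructor 3.
  (* On the circle |z|^2 = 2 c Re z. With Re z > d and both parts below rho this gives 2 c d < 2
     rho^2. *)
  exfalso.
  have e1 : (c + c * s) ^+ 2 + (c * t) ^+ 2 = 2 * c * (c + c * s).
    have -> : (c * t) ^+ 2 = c ^+ 2 * (1 - s ^+ 2) by rewrite exprMn st; ring.
    by ring.
  have e2 : (c * t) ^+ 2 < rho ^+ 2.
    by rewrite -[(c * t) ^+ 2]real_normK ?num_real// ltrXn2r// ?nnegrE//; lra.
  have e3 : (c + c * s) ^+ 2 < rho ^+ 2 by rewrite ltrXn2r// ?nnegrE//; lra.
  have e4 : c * d < c * (c + c * s) by rewrite ltr_pM2l.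
  lra.
have [Z rZ ZM] : good (LC A B) c%:C%C (2 * M).
  by apply: good1 => /=; [exact: ltW|constructor 3].
have /choice[Zc ZcP] zeta : exists Z', normc zeta = 1 ->
    is_resolvent (LC A B) (c%:C%C + c%:C%C * zeta) Z' /\ bounded_by (2 * M) Z'.
  have [z1|nz] := pselect (normc zeta = 1); last by exists id => /nz.
  by have [_ _ [Z' rZ' Z'M]] := circle _ z1; exists Z'.
have M2 : 0 <= 2 * M by lra.
have M4 : 2 * M <= 2 * (2 * M) by lra.
(* The bound is relaxed from 2 M to 4 M, the one that the perturbed resolvents will satisfy. *)
have onc : resolvents_on_circle (LC A B) c (2 * (2 * M)) Z Zc.
  split=> //; first exact: bounded_byW ZM.
  by move=> zeta /ZcP[rz zM]; split=> //; exact: bounded_byW zM.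
have disc : unstable_in_disc (LC A B) c.
  apply: (linearization_unstable_in_disc (d := d) snA b0 Bb c0) => //.
  - by rewrite -/rho; lra.
  - by rewrite -/rho; lra.
  - move=> z /andP[z0 zd] _; exists (2 * M); apply: good1 => //; by constructor 1.
have codim := linearization_codim sA pA cA c0 M2 lB b0 Bb rZ ZM.
have M40 : 0 <= 2 * (2 * M) by lra.
have [m hm] := unstable_finite_dim lT c0 M40 onc disc codim.
exists m; split; first exact: hm.
(* [kap] dominates the factor of the perturbation estimate for |z| <= 2 c. With [eta0] as below, the
   resolvents move by at most d' = 1 / (2 (c + 1)), so c d' < 1. *)
pose kap := 1 + (1 + b + 2 * c) * (2 * M).
have kap0 : 0 < kap by rewrite ltr_pwDl// mulr_ge0//; lra.
pose eta0 := (4 * (c + 1) * kap * (2 * M))^-1.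
have eta00 : 0 < eta0 by rewrite invr_gt0 !mulr_gt0//; lra.
have ek : eta0 * kap * (2 * M) * (4 * (c + 1)) = 1.
  by rewrite /eta0; field; rewrite !gt_eqF//; lra.
exists eta0 => // A' B' snA' dA' lB' B'b hE.
have lA' : linear_op A' by case: snA'.
have ek4 : eta0 * kap <= 4^-1.
  have X0 : 0 <= eta0 * kap by rewrite mulr_ge0// ltW.
  have Y4 : 4 <= 2 * M * (4 * (c + 1)) by nra.
  by have := ler_wpM2l X0 Y4; lra.
have pert z Z1 : normc z <= 2 * c -> is_resolvent (LC A B) z Z1 -> bounded_by (2 * M) Z1 ->
    exists Z', [/\ is_resolvent (LC A' B') z Z', bounded_by (2 * (2 * M)) Z' &
    forall f, cnorm (Z1 f - Z' f) <= 2 * (eta0 * kap) * (2 * M) * cnorm f].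
  move=> zc r1 b1.
  have kz : eta0 * (1 + (1 + b + normc z) * (2 * M)) <= eta0 * kap.
    by rewrite ler_wpM2l ?(ltW eta00)// lerD2l ler_wpM2r// lerD2l.
  have [|Z' [rZ' Z'M Z'd]] := linearization_perturbation lA lB lA' lB' dA' b0 Bb
    (ltW eta00) hE M2 r1 b1; first by lra.
  exists Z'; split=> // f; rewrite cnorm_distC (le_trans (Z'd f))//.
  by rewrite ler_wpM2r ?cnorm_ge0// ler_wpM2r// ler_wpM2l.
have pertg z : normc z <= 2 * c -> good (LC A B) z (2 * M) ->
    good (LC A' B') z (2 * (2 * M)).
  by move=> zc [Z1 r1 b1]; have [Z' [r' b' _]] := pert z Z1 zc r1 b1; exists Z'.
split.
  (* On the axis, points with |y| <= b + 1 are reached by perturbation. The others are continued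
     from the perturbed resolvents at the two points of height b + 1 and - (b + 1). *)
  apply/hyperbolicP => -[x y] /= ->.
  have bd : b + 1 <= 2 * c by rewrite -/rho; lra.
  have ax s : s ^+ 2 = 1 -> good (LC A' B') (Complex 0 (s * (b + 1))) (2 * (2 * M)).
    move=> s1; apply: pertg; last first.
      by apply: good1 => //=; constructor 1; exact: ltW.
    rewrite /= expr0n /= add0r exprMn s1 mul1r sqrtr_sqr ger0_norm//; lra.
  have [y1|y1] := leP (b + 1) y.
    exists 1; apply: (good_far_up snA' lB' B'b b0 (s := 1)) => //.
    - by rewrite expr1n.
    - by apply: ax; rewrite expr1n.
    - by rewrite mul1r.
  have [y2|y2] := leP (b + 1) (- y).
    exists 1; apply: (good_far_up snA' lB' B'b b0 (s := -1)) => //.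
    - by rewrite sqrrN expr1n.
    - by apply: ax; rewrite sqrrN expr1n.
    - by rewrite mulN1r.
  exists (2 * (2 * M)); apply: pertg; last first.
    by apply: good1 => //=; constructor 1; exact: ltW.
  rewrite /= expr0n /= add0r sqrtr_sqr (le_trans _ bd)// ler_norml.
  by apply/andP; split; lra.
have [Z' [rZ' Z'M _]] : exists Z', [/\ is_resolvent (LC A' B') c%:C%C Z',
    bounded_by (2 * (2 * M)) Z' &
    forall f, cnorm (Z f - Z' f) <= 2 * (eta0 * kap) * (2 * M) * cnorm f].
  by apply: pert => //; rewrite normc_real gtr0_norm//; lra.
have /choice[Zc' Zc'P] zeta : exists Z', normc zeta = 1 ->
    [/\ is_resolvent (LC A' B') (c%:C%C + c%:C%C * zeta) Z', bounded_by (2 * (2 * M)) Z' &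
    forall f, cnorm (Zc zeta f - Z' f) <= 2 * (eta0 * kap) * (2 * M) * cnorm f].
  have [z1|nz] := pselect (normc zeta = 1); last by exists id => /nz.
  have [_ zc _] := circle _ z1; have [r1 b1] := ZcP _ z1.
  by have [Z2 hZ2] := pert _ _ zc r1 b1; exists Z2.
apply: (unstable_dim_stable (Z' := Z') (Zc' := Zc')
  (d := 2 * (eta0 * kap) * (2 * M)) lT _ c0 M40 onc _ disc _ codim _ _ hm).
- exact: linearizationC_linear.
- by split=> // zeta /Zc'P[].
- apply: (linearization_unstable_in_disc (d := d) snA' b0 B'b c0) => //.
  + by rewrite -/rho; lra.
  + by rewrite -/rho; lra.
  + move=> z /andP[z0 zd] zc; exists (2 * (2 * M)); apply: pertg => //.
    by apply: good1 => //; constructor 1.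
- have : 0 <= eta0 * kap * (2 * M) by rewrite !mulr_ge0// ltW.
  nra.
- by move=> zeta /Zc'P[].
Qed.

End MorseStability.

(** * The equilibria of the renormalized equation *)

Section Calculus.
Context {R : realType}.

Lemma is_derive_eps (f : R -> R) (t l : R) :
  (forall e : R, 0 < e -> exists2 d : R, 0 < d &
     forall s, `|s| < d -> `|f (t + s) - f t - s * l| <= e * `|s|) ->
  is_derive t 1 f l.
Proof.
move=> h.
have cv : (fun s => s^-1 *: ((f \o shift t) (s *: 1) - f t)) @ 0^' --> l.
  apply/cvgrPdist_le => e e0; have [d d0 hd] := h e e0.
  exists d => // s sd s0.
  have {}sd : `|s| < d by move: sd; rewrite /ball_ /= add0r normrN.
  have sn : 0 < `|s| by rewrite normr_gt0.
  have -> : (f \o shift t) (s *: 1) = f (t + s) by rewrite /= [s *: 1]mulr1 addrC.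
  rewrite -(ler_pM2l sn) -normrM mulrBr.
  have -> : s * (s^-1 *: (f (t + s) - f t)) = f (t + s) - f t by exact: mulVKf.
  by rewrite distrC [leRHS]mulrC hd.
by apply: DeriveDef; [apply/cvg_ex; exists l|exact: cvg_lim].
Qed.

Lemma slope_bound (f : R -> R) (K : R) :
  (forall t : R, 0 <= t <= 1 -> exists2 l : R, is_derive t 1 f l & l <= K) -> f 1 - f 0 <= K.
Proof.
move=> h.
have /choice[df dfP] (t : R) : exists l : R, 0 <= t <= 1 -> is_derive t 1 f l /\ l <= K.
  have [t01|nt] := pselect (is_true (0 <= t <= 1)); last by exists 0 => /nt.
  by have [l] := h t t01; exists l.
have [| |c c01 ->] := @MVT R f df 0 1 ltr01.
- move=> t; rewrite in_itv /= => /andP[/ltW t0 /ltW t1].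
  by have [] := dfP t _; rewrite ?t0.
- apply: derivable_within_continuous => t; rewrite in_itv /= => t01.
  by have [dt _] := dfP t t01; exact: ex_derive.
- rewrite subr0 mulr1; move: c01; rewrite in_itv /= => /andP[/ltW c0 /ltW c1].
  by have [] := dfP c _; rewrite ?c0.
Qed.

Lemma contraction_in_ball (V : completeNormedModType R) (Phi : V -> V) (s : R) :
  (forall g g', `|g| <= s -> `|g'| <= s -> `|Phi g - Phi g'| <= 2^-1 * `|g - g'|) ->
  `|Phi 0| <= s / 2 -> exists2 g, `|g| <= s & Phi g = g.
Proof.
move=> ctr Phi0.
have s0 : 0 <= s by have := normr_ge0 (Phi 0); lra.
(* Half of the radius is spent on Phi 0 and half on the contraction. *)
have stay g : `|g| <= s -> `|Phi g| <= s.
  move=> gs; have := ctr g 0 gs; rewrite normr0 subr0 => /(_ s0).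
  have := ler_normD (Phi g - Phi 0) (Phi 0); rewrite subrK; lra.
pose u n := iter n Phi 0.
have us n : `|u n| <= s by elim: n => [|n IH]; [rewrite /= normr0|exact: stay].
have q01 : 0 <= (2^-1 : R) < 1 by lra.
have uq n : `|u n.+1 - u n| <= s * 2^-1 ^+ n.
  elim: n => [|n IH]; first by rewrite expr0 mulr1 subr0; exact: us.
  rewrite (le_trans (ctr _ _ (us n.+1) (us n)))// exprS mulrCA.
  by rewrite ler_wpM2l.
have [g gP] := geometric_limit q01 uq.
have small e : 0 < e -> exists n, `|u n - g| < e /\ `|u n.+1 - g| < e.
  move=> e0; have [n nP] := exp_small (s / (1 - 2^-1)) q01 e0.
  exists n; split; first exact: le_lt_trans (gP n) nP.
  apply: le_lt_trans (gP n.+1) (le_lt_trans _ nP).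
  have C0 : 0 <= s / (1 - 2^-1) by rewrite divr_ge0//; lra.
  have p0 : 0 <= (2^-1 : R) ^+ n by rewrite exprn_ge0.
  by rewrite exprS; apply: ler_wpM2l => //; lra.
have gs : `|g| <= s.
  apply/ler_addgt0Pr => e /small[n [h _]].
  have := ler_normB (u n) (u n - g); rewrite subKr; have := us n; lra.
exists g => //; apply/eqP; rewrite -subr_eq0 -normr_eq0; apply/eqP.
apply: (@eq0_of_small _ _ 2) => // d d0; have [n [h1 h2]] := small d d0; rewrite normr_id.
rewrite (le_trans (ler_distD (u n.+1) _ _))//.
have := ctr _ _ gs (us n); rewrite -[Phi (u n)]/(u n.+1) (distrC g); lra.
Qed.

End Calculus.

Section HighFrequency.
Context {R : realType} {H : hilbertType R} {A : partial_op H}.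
Hypotheses (sA : selfadjoint_op A) (pA : nonnegative_op A) (cA : compact_resolvent A).
Context {mu eps : R}.
Hypotheses (mu0 : 0 < mu) (eps01 : 0 < eps <= 1).
Local Notation Q := (highproj A mu eps).

Let eps0 : 0 < eps. Proof. by case/andP: eps01. Qed.

(** With [Lam] = mu eps^-2 the cut-off bound is at most mu^(-r/2) eps^r, and the prefactor eps^-1
    costs one power. This is the origin of the rate r - 1. *)
Lemma highproj_rate u (r : R) : 0 <= r -> Hsp A r u ->
  eps^-1 * `|Q u| <= mu `^ (- (r / 2)) * eps `^ (r - 1) * Hnorm A r u.
Proof.
move=> r0 Hu; have := highproj_bound sA pA cA mu0 eps0 r0 Hu => hQ.
have L0 : 0 < mu / eps ^+ 2 by rewrite divr_gt0// exprn_gt0.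
have le1 : (1 + mu / eps ^+ 2) `^ (- (r / 2)) <= mu `^ (- (r / 2)) * eps `^ r.
  rewrite !powRN.
  have -> : (mu `^ (r / 2))^-1 * eps `^ r = ((mu / eps ^+ 2) `^ (r / 2))^-1.
    rewrite powRM ?invr_ge0 ?exprn_ge0 ?ltW// invfM; congr (_ * _).
    rewrite -powR_mulrn ?ltW// -powR_inv1 ?powR_ge0// -!powRrM -powRN; congr (_ `^ _).
    by field.
  rewrite lef_pV2 ?posrE ?powR_gt0//; last by rewrite addr_gt0.
  have L0' := ltW L0; have r2 : 0 <= r / 2 by rewrite divr_ge0.
  by apply: ge0_ler_powR; rewrite ?nnegrE ?lerDr// addr_ge0.
have -> : mu `^ (- (r / 2)) * eps `^ (r - 1) = eps^-1 * (mu `^ (- (r / 2)) * eps `^ r).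
  rewrite [RHS]mulrCA; congr (_ * _).
  rewrite -powR_inv1 ?ltW// -powRD; last by apply/implyP => _; rewrite gt_eqF.
  by rewrite addrC.
rewrite -!mulrA ler_wpM2l ?invr_ge0 ?(ltW eps0)// mulrA (le_trans hQ)//.
by rewrite ler_wpM2r// normr_ge0.
Qed.

Lemma highproj_small u : op_dom A u -> eps^-1 * `|Q u| <= eps / mu * `|u + A u|.
Proof.
move=> du; have := @highproj_rate u 2; rewrite Hsp2E// => /(_ (ler0n _ _) du).
rewrite Hnorm2E// divff// powRN powRr1 ?(ltW mu0)//.
rewrite (_ : 2 - 1 = 1 :> R); last lra.
by rewrite powRr1 ?(ltW eps0)// [mu^-1 * eps]mulrC.
Qed.

Lemma renorm_sym_nonneg : sym_nonneg (renorm_op A mu eps).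
Proof.
have lQ : linear_map Q by exact: highproj_linear.
have lA := selfadjoint_linear sA.
have QE u v : inner (Q u) v = inner (Q u) (Q v) by exact: highproj_idem.
split.
- have [d0 dl Al] := lA; split=> // a x y dx dy /=.
  rewrite Al// -!/(Q _) lQ !scalerDr !scalerA (mulrC a) addrACA.
  by [].
- move=> x y dx dy /=; rewrite innerDl innerDr innerZl innerZr.
  rewrite (selfadjoint_sym sA dx dy) -!/(Q _) (QE x y) [inner x (Q y)]innerC (QE y x).
  by rewrite [inner (Q y) _]innerC.
- move=> x dx /=; rewrite innerDl innerZl -/(Q x) QE inner_norm.
  by rewrite addr_ge0 ?pA// mulr_ge0 ?exprn_ge0// invr_ge0 ltW.
Qed.

End HighFrequency.

Section Nonlinearity.
Context {R : realType} {H : hilbertType R}.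

(** Pairing with the remainder y itself reduces the vector-valued mean value inequality to a scalar
    one: the slope bound for [phi] gives |y|^2 <= L rho |g - g'| |y|. *)
Lemma frechet_lipschitz (S : H -> H) (F : H -> H) (DF : H -> {linear H -> H})
    (U : set H) (us : H) (L rho : R) :
  linear_map S -> (forall g, `|S g| <= `|g|) -> 0 <= L -> 0 < rho ->
  (forall u, U u -> forall e : R, 0 < e -> exists2 d : R, 0 < d & forall g, `|g| < d ->
     `|F (u + S g) - F u - DF u (S g)| <= e * `|g|) ->
  (forall g h, `|g| < rho -> `|DF (us + S g) h - DF us h| <= L * `|g| * `|h|) ->
  (forall g, `|g| < rho -> U (us + S g)) ->
  forall g g', `|g| < rho -> `|g'| < rho ->
    `|F (us + S g) - F (us + S g') - DF us (S (g - g'))| <= L * rho * `|g - g'|.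
Proof.
move=> lS Sb L0 rho0 hF hL hU g g' gr g'r.
set v := g - g'; set y := _ - DF us (S v).
pose p (t : R) : H := g' + t *: v.
have pr t : 0 <= t <= 1 -> `|p t| < rho.
  move=> /andP[t0 t1].
  have -> : p t = (1 - t) *: g' + t *: g.
    by rewrite /p /v scalerBr scalerBl scale1r addrA addrAC.
  rewrite (le_lt_trans (ler_normD _ _))// !normrZ !ger0_norm ?subr_ge0//.
  have [->|t0'] := eqVneq t 0; first by rewrite subr0 mul1r mul0r addr0.
  have tp : 0 < t by rewrite lt_def t0' t0.
  have h1 : (1 - t) * `|g'| <= (1 - t) * rho by rewrite ler_wpM2l ?subr_ge0// ltW.
  have h2 : t * `|g| < t * rho by rewrite ltr_pM2l.
  lra.
pose phi t := inner (F (us + S (p t)) - t *: DF us (S v)) y.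
have phi1 : phi 1 - phi 0 = `|y| ^+ 2.
  rewrite /phi /p !scale0r !scale1r addr0 subr0 /v [g' + _]addrC subrK -innerBl -inner_norm.
  by congr inner; rewrite /y addrAC.
have slope : phi 1 - phi 0 <= L * rho * `|v| * `|y|.
  apply: slope_bound => t t01; have ptr := pr t t01.
  have Ut := hU _ ptr.
  exists (inner (DF (us + S (p t)) (S v) - DF us (S v)) y).
    apply: is_derive_eps => e e0.
    (* The Frechet error is multiplied by |v| |y|; adding 1 makes k a valid divisor when that
       product is 0. *)
    pose k := `|v| * `|y| + 1.
    have k0 : 0 < k by rewrite ltr_wpDl// mulr_ge0.
    have [d d0 hd] := hF _ Ut (e / k) (divr_gt0 e0 k0).
    have v0 : 0 < `|v| + 1 by rewrite ltr_wpDl.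
    exists (d / (`|v| + 1)); first by rewrite divr_gt0.
    move=> s; rewrite ltr_pdivlMr// => sd.
    have svd : `|s *: v| < d.
      rewrite normrZ (le_lt_trans _ sd)// ler_wpM2l//; lra.
    have -> : phi (t + s) - phi t - s * inner (DF (us + S (p t)) (S v) - DF us (S v)) y =
        inner (F (us + S (p t) + S (s *: v)) - F (us + S (p t))
               - DF (us + S (p t)) (S (s *: v))) y.
      have Sp : S (p (t + s)) = S (p t) + S (s *: v).
        by rewrite -(linear_mapD lS); congr S; rewrite /p scalerDl addrA.
      have Dz : DF (us + S (p t)) (s *: S v) = s *: DF (us + S (p t)) (S v).
        by rewrite linearZ.
      rewrite /phi Sp (linear_mapZ lS) Dz [us + (_ + _)]addrA.
      by rewrite !(innerDl, innerNl, innerZl); ring.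
    rewrite (le_trans (cauchy_schwarz _ _))//.
    apply: le_trans (_ : e / k * (`|s| * `|v|) * `|y| <= _).
      by rewrite ler_wpM2r// -normrZ hd.
    have -> : e / k * (`|s| * `|v|) * `|y| = e * `|s| * (`|v| * `|y| / k) by ring.
    by rewrite ler_piMr ?mulr_ge0 ?(ltW e0)// ler_pdivrMr// mul1r /k; lra.
  rewrite (le_trans (inner_le _ _))// ler_wpM2r// (le_trans (hL _ _ ptr))//.
  apply: ler_pM; [by rewrite mulr_ge0|by []| |exact: Sb].
  by rewrite ler_wpM2l// ltW.
rewrite phi1 in slope.
have [->|y0] := eqVneq `|y| 0; first by rewrite !mulr_ge0// ltW.
have yp : 0 < `|y| by rewrite lt_def y0 normr_ge0.
by rewrite -(ler_pM2r yp) -expr2.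
Qed.

End Nonlinearity.

Section Equilibria.
Context {R : realType} {H : hilbertType R} {A : partial_op H}.
Hypotheses (sA : selfadjoint_op A) (pA : nonnegative_op A).

Lemma selfadjointD x y : op_dom A x -> op_dom A y -> A (x + y) = A x + A y.
Proof.
have [_ _ Al] := selfadjoint_linear sA.
by move=> dx dy; rewrite -[x in LHS]scale1r Al// scale1r.
Qed.

Lemma selfadjointN x : op_dom A x -> A (- x) = - A x.
Proof.
have [d0 _ Al] := selfadjoint_linear sA; move=> dx.
have A0 := linear_on0 (linear_op_subspace (selfadjoint_linear sA))
  (linear_op_on (selfadjoint_linear sA)).
by rewrite -scaleN1r -[- 1 *: x]addr0 Al// A0 addr0 scaleN1r.
Qed.

Lemma selfadjoint_domB x y : op_dom A x -> op_dom A y -> op_dom A (x - y).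
Proof. by apply: subspaceB; apply: linear_op_subspace; exact: selfadjoint_linear. Qed.

Lemma selfadjointB x y : op_dom A x -> op_dom A y -> A (x - y) = A x - A y.
Proof.
move=> dx dy; have dN : op_dom A (- y).
  by apply: subspaceN => //; apply: linear_op_subspace; exact: selfadjoint_linear.
by rewrite selfadjointD// selfadjointN.
Qed.

(** Hyperbolicity at the single point 0, read on real vectors. The H^2 bound follows from x + A x =
    x + B x + (A x - B x). *)
Lemma hyperbolic_inverse (B : H -> H) (b : R) : linear_map B -> 0 <= b ->
  (forall x, `|B x| <= b * `|x|) -> hyperbolic (linearization A B) ->
  exists (Z : H -> H) (k : R), [/\ 0 < k,
    forall f, op_dom A (Z f) /\ A (Z f) - B (Z f) = f &
    forall x, op_dom A x -> `|x + A x| <= k * `|A x - B x|].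
Proof.
move=> lB b0 Bb /hyperbolicP/(_ 0 erefl)[M [Z rZ ZM]].
have lA := selfadjoint_linear sA.
have lT : linear_op (complexify (linearization A B)).
  by apply: complexify_linear; apply: linearization_linear.
have lZ := resolvent_linear lT rZ.
have [Z1 Z2] := rZ.
have [d0 _ _] := lA.
have A0 : A 0 = 0 := linear_on0 (linear_op_subspace lA) (linear_op_on lA).
have inj x : op_dom A x -> A x - B x = 0 -> x = 0.
  move=> dx ABx; have := Z2 (x, 0) (conj dx d0).
  rewrite scale0r subr0.
  have -> : complexify (linearization A B) (x, 0) = 0.
    transitivity ((- A x + B x, - A 0 + B 0) : complexification H) => //.
    have -> : - A x + B x = 0 by rewrite addrC -opprB ABx oppr0.
    by rewrite A0 (linear_map0 lB) oppr0 addr0.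
  by rewrite (linear_map0 lZ) => -[<-].
(* Z inverts - A + B, hence the sign. *)
pose Zr f := - (Z (f, 0)).1.
have ZrP f : op_dom A (Zr f) /\ A (Zr f) - B (Zr f) = f.
  have [[d1 _] /=] := Z1 (f, 0); rewrite scale0r subr0 => -[E _].
  split; first by apply: subspaceN => //; exact: linear_op_subspace.
  by rewrite /Zr selfadjointN// (linear_mapN lB) opprK E.
exists Zr, (1 + (1 + b) * `|M|); split=> //.
  by rewrite ltr_wpDr// mulr_ge0// addr_ge0.
move=> x dx; set f := A x - B x.
have [dZ ZE] := ZrP f.
have xE : x = Zr f.
  apply/eqP; rewrite -subr_eq0; apply/eqP/inj; first exact: selfadjoint_domB.
  rewrite selfadjointB// (linear_mapB lB) opprD addrACA -opprD ZE.
  by rewrite /f subrr.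
have xf : `|x| <= `|M| * `|f|.
  rewrite {1}xE normrN (le_trans (cnorm_fst _))// (le_trans (ZM _))//.
  have -> : cnorm ((f, 0) : complexification H) = `|f|.
    by rewrite /cnorm /= normr0 expr0n /= addr0 sqrtr_sqr normr_id.
  by rewrite ler_wpM2r// ler_norm.
have -> : x + A x = x + B x + f by rewrite /f -addrA [B x + _]addrC subrK.
rewrite (le_trans (ler_normD _ _))// (le_trans (lerD (ler_normD _ _) (lexx _)))//.
have := Bb x; have : (1 + b) * `|x| <= (1 + b) * (`|M| * `|f|).
  by rewrite ler_wpM2l// addr_ge0.
lra.
Qed.

End Equilibria.

Theorem theorem6p10 (R : realType) (H : hilbertType R) (A : partial_op H)
    (mu r : R) (F : H -> H) (DF : H -> {linear H -> H}) (U : set H)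
    (ustar : H) :
  infinite_dimensional H ->
  selfadjoint_op A -> nonnegative_op A -> compact_resolvent A ->
  0 < mu -> 2 <= r ->
  Hsp A r ustar ->
  H2_open A U -> H2_bounded A U -> U ustar ->
  regular_on A F DF U ->
  equilibrium A F ustar ->
  hyperbolic (linearization A (DF ustar)) ->
  nondegenerate_equilibrium A (DF ustar) /\
  exists m : nat, has_morse_index (linearization A (DF ustar)) m /\
  exists (V : set H) (C eps0 : R),
    [/\ H2_open A V, V ustar, V `<=` U, 0 < C & 0 < eps0 <= 1] /\
    forall eps : R, 0 < eps <= eps0 ->
      (exists! u, V u /\ equilibrium (renorm_op A mu eps) F u) /\
      (forall u, V u -> equilibrium (renorm_op A mu eps) F u ->
         [/\ Hnorm A 2 (u - ustar) <= C * eps `^ (r - 1) * Hnorm A r ustar,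
             hyperbolic (linearization (renorm_op A mu eps) (DF u))
           & has_morse_index (linearization (renorm_op A mu eps) (DF u)) m]).
Proof.
move=> _ sA pA cA mu0 r2 Hr [Usub Uopen] _ Uu [hF1 _ [b b0 hb] [L L0 hL]] [du Eu] hyp.
have domE : Hsp A 2 = op_dom A := Hsp2E sA pA cA.
have HnE u : op_dom A u -> Hnorm A 2 u = `|u + A u| by exact: Hnorm2E.
have [S iS] := shift_inverse_exists sA pA.
have lS := shift_inverse_linear sA iS.
have Sb := shift_inverse_bounded pA iS.
have [S1 S2] := iS.
have dS g : op_dom A (S g) by case: (S1 g).
have HnS g : Hnorm A 2 (S g) = `|g| by rewrite HnE//; case: (S1 g) => _ ->.
have r0 : 0 <= r by lra.
set B := DF ustar.
have lDF u : linear_map (DF u) by move=> a x y; rewrite linearP.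
have Bb := hb _ Uu.
have [Z [k [k0 ZP Zk]]] := hyperbolic_inverse sA (lDF ustar) (ltW b0) Bb hyp.
have nondeg : nondegenerate_equilibrium A B.
  split; first by move=> f; have [dZ ZE] := ZP f; exists (Z f) => //; rewrite domE.
  exists k^-1, (1 + b); split; rewrite ?invr_gt0 ?addr_gt0// => u; rewrite domE => du'.
  rewrite HnE// ler_pdivrMl// Zk//= (le_trans (ler_normB _ _))// mulrDl mul1r lerD//.
    exact: norm_op_le_shift.
  by rewrite (le_trans (Bb u))// ler_wpM2l ?(ltW b0)//; exact: norm_le_shift.
split=> //.
have [m [hm [eta0 eta00 hstab]]] :=
  morse_index_stable sA pA cA (lDF ustar) (ltW b0) Bb hyp.
exists m; split=> //.
have [d d0 hd] := Uopen _ Uu.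
(* [d] keeps the ball inside [U]; the other term limits the nonlinear part of the contraction
   constant to 1/4. *)
pose rho := Num.min d (4 * k * L)^-1.
have kL0 : 0 < 4 * k * L by rewrite !mulr_gt0.
have rho0 : 0 < rho by rewrite lt_min d0 invr_gt0.
have rhod : rho <= d by rewrite ge_min lexx.
have rhok : 4 * k * L * rho <= 1.
  by rewrite -ler_pdivlMl// mulr1 ge_min lexx orbT.
have HnV u : op_dom A u -> exists2 g, u = ustar + S g & Hnorm A 2 (u - ustar) = `|g|.
  move=> du'; have dB : op_dom A (u - ustar) by exact: selfadjoint_domB.
  by exists ((u - ustar) + A (u - ustar)); [rewrite S2// addrC subrK|rewrite HnE].
have domD g : op_dom A (ustar + S g).
  by apply: subspaceD => //; apply: linear_op_subspace; exact: selfadjoint_linear.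
have hU g : `|g| < rho -> U (ustar + S g).
  move=> gr; apply: hd; first by rewrite domE.
  by rewrite addrAC subrr add0r HnS (lt_le_trans gr).
have hFd u : U u -> forall e : R, 0 < e -> exists2 d : R, 0 < d & forall g, `|g| < d ->
    `|F (u + S g) - F u - DF u (S g)| <= e * `|g|.
  move=> Uu' e e0; have [d' d'0 h] := hF1 _ Uu' e e0.
  by exists d' => // g gd; rewrite -(HnS g); apply: h; rewrite ?domE ?HnS.
have hDL g h : `|g| < rho -> `|DF (ustar + S g) h - DF ustar h| <= L * `|g| * `|h|.
  by move=> gr; have := hL _ _ (hU g gr) Uu h; rewrite addrAC subrr add0r HnS.
have lip := frechet_lipschitz lS Sb (ltW L0) rho0 hFd hDL hU.
(* W eps^(r-1) bounds [Phi 0], the image under the solution operator of the residual eps^-1 Q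
   ustar. *)
pose W := k * (mu `^ (- (r / 2)) * Hnorm A r ustar).
have W0 : 0 <= W by rewrite mulr_ge0 ?(ltW k0)// mulr_ge0 ?powR_ge0// normr_ge0.
(* One summand per smallness condition on eps <= 1/K: the part of the contraction constant due to Q
   is at most 1/4, [Phi 0] is within rho/4, the operator perturbation is below [eta0], and eps <=
   1. *)
pose K := 4 * k / mu + 8 * W / rho + (mu^-1 + 2 * L * W) / eta0 + 1.
have k0' := ltW k0; have mu0' := ltW mu0; have rho0' := ltW rho0; have L0' := ltW L0.
have K1 : 0 <= 4 * k / mu by rewrite divr_ge0// mulr_ge0.
have K2 : 0 <= 8 * W / rho by rewrite divr_ge0// mulr_ge0.
have K3 : 0 <= (mu^-1 + 2 * L * W) / eta0.
  have eta0' := ltW eta00; rewrite divr_ge0// addr_ge0 ?invr_ge0//.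
  by apply: mulr_ge0 => //; apply: mulr_ge0.
have Kge1 : 1 <= K by rewrite /K; lra.
have K0 : 0 < K by lra.
pose V := [set u | op_dom A u /\ Hnorm A 2 (u - ustar) < rho].
exists V, (2 * k * mu `^ (- (r / 2))), K^-1.
have VU : V `<=` U.
  move=> u [/HnV[g -> ->] gr]; exact: hU.
have oV : H2_open A V.
  split=> [u [du' _]|u [du' ur]]; first by rewrite domE.
  exists (rho - Hnorm A 2 (u - ustar)); first by rewrite subr_gt0.
  move=> v; rewrite domE => dv vu; split=> //.
  have d1 : op_dom A (v - u) by exact: selfadjoint_domB.
  have d2 : op_dom A (u - ustar) by exact: selfadjoint_domB.
  have e : v - ustar = (v - u) + (u - ustar) by rewrite addrA subrK.
  have d3 : op_dom A (v - ustar) by exact: selfadjoint_domB.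
  move: vu; rewrite ltrBrDr; apply: le_lt_trans.
  rewrite (HnE _ d1) (HnE _ d2) (HnE _ d3) e (selfadjointD sA d1 d2) addrACA.
  exact: ler_normD.
split.
  split=> //.
  - by split=> //; rewrite subrr -(linear_map0 lS) HnS normr0.
  - by rewrite !mulr_gt0// powR_gt0.
  - by rewrite invr_gt0 K0 /= invf_le1.
move=> eps /andP[eps0 epsK].
have epsK1 : eps * K <= 1 by rewrite -ler_pdivlMr// mul1r.
have eps1 : eps <= 1 by apply: le_trans epsK _; rewrite invf_le1.
have eps01 : 0 < eps <= 1 by rewrite eps0.
have c1 : eps * (4 * k / mu) <= 1.
  by apply: le_trans epsK1; rewrite ler_wpM2l ?(ltW eps0)// /K; lra.
have c2 : eps * (8 * W / rho) <= 1.
  by apply: le_trans epsK1; rewrite ler_wpM2l ?(ltW eps0)// /K; lra.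
have c3 : eps * ((mu^-1 + 2 * L * W) / eta0) <= 1.
  by apply: le_trans epsK1; rewrite ler_wpM2l ?(ltW eps0)// /K; lra.
pose Q := highproj A mu eps.
have lQ : linear_map Q by exact: highproj_linear.
have Qs x : op_dom A x -> eps^-1 * `|Q x| <= eps / mu * `|x + A x|.
  exact: highproj_small.
have QS g : eps^-1 * `|Q (S g)| <= eps / mu * `|g|.
  by have := Qs _ (dS g); case: (S1 g) => _ ->.
(* This uses r >= 2. *)
have epsr : eps `^ (r - 1) <= eps.
  by rewrite -[leRHS]powRr1 ?(ltW eps0)//; apply: ger_powR => //; lra.
(* Subtracting A ustar = F ustar from the renormalized equation at ustar + S g leaves (A - B) (S g)
   = rhs g. [Phi] applies (1 + A) (A - B)^-1 to the right-hand side, so its fixed points are the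
   equilibria. *)
pose rhs g := F (ustar + S g) - F ustar - B (S g) - eps^-1 *: Q (ustar + S g).
pose Phi g := Z (rhs g) + A (Z (rhs g)).
have dZ f : op_dom A (Z f) by case: (ZP f).
have ZE f : A (Z f) - B (Z f) = f by case: (ZP f).
have PhiB g g' : `|Phi g - Phi g'| <= k * `|rhs g - rhs g'|.
  have eR : A (Z (rhs g)) - A (Z (rhs g')) - (B (Z (rhs g)) - B (Z (rhs g'))) =
      rhs g - rhs g'.
    by rewrite -[in RHS](ZE (rhs g)) -[in RHS](ZE (rhs g')) !opprD addrACA.
  have := Zk _ (selfadjoint_domB sA (dZ (rhs g)) (dZ (rhs g'))).
  by rewrite (selfadjointB sA)// (linear_mapB (lDF ustar)) eR addrACA -opprD.
have ctr g g' : `|g| < rho -> `|g'| < rho -> `|Phi g - Phi g'| <= 2^-1 * `|g - g'|.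
  move=> gr g'r; apply: le_trans (PhiB g g') _.
  have -> : rhs g - rhs g' =
      (F (ustar + S g) - F (ustar + S g') - B (S (g - g'))) - eps^-1 *: Q (S (g - g')).
    rewrite /rhs !(linear_mapD lQ) (linear_mapB lS) (linear_mapB lQ).
    rewrite (linear_mapB (lDF ustar)) -/B.
    move: (F (ustar + S g)) (F (ustar + S g')) (F ustar) (B (S g)) (B (S g')) (Q ustar)
      (Q (S g)) (Q (S g')) => *.
    by apply: inner_ext => z; rewrite !(innerDl, innerNl, innerZl); ring.
  have h1 := lip g g' gr g'r.
  have h2 := QS (g - g').
  have h3 := ler_normB (F (ustar + S g) - F (ustar + S g') - B (S (g - g')))
    (eps^-1 *: Q (S (g - g'))).
  rewrite normrZ gtr0_norm ?invr_gt0// in h3.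
  have e1 : k * (L * rho * `|g - g'|) <= 4^-1 * `|g - g'|.
    by rewrite mulrA ler_wpM2r//; lra.
  have e2 : k * (eps / mu * `|g - g'|) <= 4^-1 * `|g - g'|.
    by rewrite mulrA ler_wpM2r//; lra.
  have := ler_wpM2l (ltW k0) (le_trans h3 (lerD h1 h2)); lra.
have Phi0 : `|Phi 0| <= W * eps `^ (r - 1).
  have := Zk _ (dZ (rhs 0)); rewrite ZE => /le_trans; apply.
  have -> : rhs 0 = - (eps^-1 *: Q ustar).
    by rewrite /rhs (linear_map0 lS) addr0 subrr (linear_map0 (lDF ustar)) subrr sub0r.
  rewrite normrN normrZ gtr0_norm ?invr_gt0// /W -mulrA ler_wpM2l ?(ltW k0)//.
  by rewrite mulrAC; apply: highproj_rate.
have eqv g : `|g| < rho -> equilibrium (renorm_op A mu eps) F (ustar + S g) <-> Phi g = g.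
  move=> gr.
  have resE : renorm_op A mu eps (ustar + S g) - F (ustar + S g) =
      A (S g) - B (S g) - rhs g.
    rewrite /= (selfadjointD sA du (dS g)) -[_ - lowproj _ _ _ _]/(Q (ustar + S g)) /rhs.
    have -> : A ustar = F ustar by apply/eqP; rewrite -subr_eq0 Eu.
    move: (A (S g)) (B (S g)) (F ustar) (F (ustar + S g)) (Q (ustar + S g)) => *.
    by apply: inner_ext => z; rewrite !(innerDl, innerNl, innerZl); ring.
  split=> [[_]|gE].
    rewrite resE => /eqP; rewrite subr_eq0 => /eqP E.
    have dd : op_dom A (S g - Z (rhs g)) by exact: selfadjoint_domB.
    have AB0 : A (S g - Z (rhs g)) - B (S g - Z (rhs g)) = 0.
      rewrite (selfadjointB sA)// (linear_mapB (lDF ustar)).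
      by rewrite [- (_ - DF _ _)]opprD addrACA -opprD E ZE subrr.
    have := Zk _ dd; rewrite AB0 normr0 mulr0.
    move=> /(le_trans (norm_le_shift pA dd)); rewrite normr_le0 subr_eq0 => /eqP SZ.
    by rewrite /Phi -SZ; case: (S1 g).
  split; first exact: domD.
  have SZ : S g = Z (rhs g) by rewrite -{1}gE S2.
  by rewrite resE SZ ZE subrr.
have uniq g g' : `|g| < rho -> `|g'| < rho -> Phi g = g -> Phi g' = g' -> g = g'.
  move=> gr g'r gE g'E; have := ctr g g' gr g'r; rewrite gE g'E => h.
  apply/eqP; rewrite -subr_eq0 -normr_le0; have := normr_ge0 (g - g'); lra.
split.
  have half : rho / 2 < rho by lra.
  have [||g gr gE] := @contraction_in_ball _ _ Phi (rho / 2).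
  - by move=> g g' gr g'r; apply: ctr; apply: le_lt_trans half.
  - apply: le_trans Phi0 _; apply: le_trans (ler_wpM2l W0 epsr) _.
    have : eps * (8 * W / rho) * rho = 8 * (W * eps) by field; rewrite gt_eqF.
    have := ler_wpM2r rho0' c2; lra.
  have gr' := le_lt_trans gr half.
  exists (ustar + S g); split.
    split; last by apply/eqv.
    by split=> //; rewrite addrAC subrr add0r HnS.
  move=> u' [[/HnV[g' -> ->] g'r] /eqv-/(_ g'r) g'E].
  by rewrite (uniq g g').
move=> u [/HnV[g -> ->] gr] /eqv-/(_ gr) gE.
(* |g| <= |Phi g - Phi 0| + |Phi 0| <= |g|/2 + |Phi 0|. *)
have est : `|g| <= 2 * (W * eps `^ (r - 1)).
  have h0 : `|0 : H| < rho by rewrite normr0.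
  have := ctr g 0 gr h0; rewrite gE subr0 => h.
  have := ler_normD (g - Phi 0) (Phi 0); rewrite subrK; lra.
have [hh hm'] : hyperbolic (linearization (renorm_op A mu eps) (DF (ustar + S g))) /\
    has_morse_index (linearization (renorm_op A mu eps) (DF (ustar + S g))) m.
  (* Relative to 1 + A, the change of derivative costs at most L |g| <= 2 L W eps and the added term
     at most eps / mu; the third summand of [K] keeps their sum below [eta0]. *)
  apply: hstab => //.
  - exact: renorm_sym_nonneg.
  - exact: hb (hU g gr).
  - move=> x dx.
    have -> : linearization (renorm_op A mu eps) (DF (ustar + S g)) x -
        linearization A (DF ustar) x =
        (DF (ustar + S g) x - DF ustar x) - eps^-1 *: Q x.
      rewrite /= -[x - lowproj _ _ _ _]/(Q x).
      move: (A x) (Q x) (DF ustar x) (DF (ustar + S g) x) => *.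
      by apply: inner_ext => z; rewrite !(innerDl, innerNl, innerZl); ring.
    apply: le_trans (ler_normB _ _) _; rewrite normrZ gtr0_norm ?invr_gt0//.
    have h1 := hDL g x gr; have h2 := Qs x dx; have h3 := norm_le_shift pA dx.
    have h4 : L * `|g| * `|x| <= L * (2 * (W * eps)) * `|x + A x|.
      apply: ler_pM => //; first exact: mulr_ge0.
      apply: ler_wpM2l => //; apply: le_trans est _.
      by apply: ler_wpM2l => //; exact: ler_wpM2l.
    have h5 : eps * (mu^-1 + 2 * L * W) * `|x + A x| <= eta0 * `|x + A x|.
      by rewrite ler_wpM2r//; move: c3; rewrite mulrA ler_pdivrMr// mul1r.
    lra.
split=> //; apply: le_trans est _; rewrite /W.
by rewrite le_eqVlt; apply/orP; left; apply/eqP; ring.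
Qed.
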